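(* Let $0<\lambda\le1\le\Lambda$, let $\omega$ be as in the context, let $\Omega\subset\mathbb H^n$ be open, and let $\eta=2\sqrt{\Lambda/\lambda}+1$. There exist constants $C\ge1$ and $K\ge\eta$ depending only on $\lambda,\Lambda,Q$, and a constant $\epsilon_0>0$ depending only on $\lambda,\Lambda,Q,\omega$, such that for every symplectic $A\in M_n(\lambda,\Lambda,\Omega)\cap C(\Omega,\omega)$ and every $u\in C^2(\Omega)$ satisfying $u\ge0$ and $\mathcal L_Au=0$ in $B_{Kr}(z_0)\subset\Omega$ for some $z_0\in\Omega$ and some $0<r\le\frac{\eta}{K}\epsilon_0$, one has $$\sup_{B_r(z_0)}u\le C\inf_{B_r(z_0)}u.$$
   Context: Points $z=(x,t)\in\mathbb R^{2n+1}$; $J=\begin{pmatrix}0&-\mathbb I_n\\ \mathbb I_n&0\end{pmatrix}$, $Q=2n+2$. $\mathbb H^n$: $(x,t)\circ(\xi,\tau)=(x+\xi,t+\tau+2\langle Jx,\xi\rangle)$, $(x,t)^{-1}=(-x,-t)$; $\rho(x,t)=(|x|^4+t^2)^{1/4}$, $d(z,\zeta)=\rho(z^{-1}\circ\zeta)$, $B_R(z)=\{\zeta:d(z,\zeta)<R\}$. $X_i=\partial_{x_i}+2(Jx)_i\partial_t$, $D^2_{\mathbb H}u=(\tfrac12(X_iX_j+X_jX_i)u)_{i,j=1}^{2n}$, $\mathcal L_Au(z)=\mathrm{tr}(A(z)D^2_{\mathbb H}u(z))=\sum a_{ij}(z)X_iX_ju(z)$. $M_n(\lambda,\Lambda,\Omega)$: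 symmetric matrix functions on $\Omega$ with $\det A(z)=1$ and $\lambda\mathbb I\le A(z)\le\Lambda\mathbb I$; symplectic means $A(z)^{-1}=J^tA(z)J$ for all $z$. $\omega:[0,1)\to[0,1)$ nondecreasing with $\omega(0)=\lim_{s\to0^+}\omega(s)=0$; $C(\Omega,\omega)$: continuous $A$ with $\sup_{z\in B_\epsilon(z_0)\cap\Omega}\|A(z)-A(z_0)\|\le\omega(\epsilon)$ for all $z_0\in\Omega$, $0<\epsilon<1$ ($\|\cdot\|$ operator norm). *)

(* Defs.v *)
From Stdlib Require Import Reals Lra Arith.
Open Scope R_scope.

(* Points of H^n = R^{2n+1}: z = (x, t) with x : nat -> R, only the
   coordinates x_0..x_{2n-1} are meaningful; "valid" points have x_i = 0
   for i >= 2n, and all sets below consist of valid points. *)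
Definition pt : Type := ((nat -> R) * R)%type.

Definition valid (n : nat) (z : pt) : Prop :=
  forall i, (2 * n <= i)%nat -> fst z i = 0.

Fixpoint rsum (k : nat) (f : nat -> R) : R :=
  match k with
  | O => 0
  | S k' => rsum k' f + f k'
  end.

(* the matrix J = [[0, -I_n], [I_n, 0]] (2n x 2n), entries J_{jk} *)
Definition Jm (n : nat) (j k : nat) : R :=
  if Nat.ltb j n then (if Nat.eqb k (j + n) then -1 else 0)
  else if andb (Nat.ltb j (2 * n)) (Nat.eqb k (j - n)) then 1 else 0.

Definition Jx (n : nat) (x : nat -> R) (j : nat) : R :=
  rsum (2 * n) (fun k => Jm n j k * x k).

Definition hmul (n : nat) (z w : pt) : pt :=
  (fun i => fst z i + fst w i,
   snd z + snd w + 2 * rsum (2 * n) (fun i => Jx n (fst z) i * fst w i)).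

Definition hinv (z : pt) : pt := (fun i => - fst z i, - snd z).

Definition rho (n : nat) (z : pt) : R :=
  sqrt (sqrt ((rsum (2 * n) (fun i => fst z i ^ 2)) ^ 2 + snd z ^ 2)).

Definition hdist (n : nat) (z w : pt) : R := rho n (hmul n (hinv z) w).

Definition ball (n : nat) (z : pt) (R0 : R) (w : pt) : Prop :=
  valid n w /\ hdist n z w < R0.

Definition edist (n : nat) (z w : pt) : R :=
  sqrt (rsum (2 * n) (fun i => (fst z i - fst w i) ^ 2) + (snd z - snd w) ^ 2).

Definition is_open (n : nat) (Om : pt -> Prop) : Prop :=
  (forall z, Om z -> valid n z) /\
  forall z, Om z -> exists delta, 0 < delta /\
    forall w, valid n w -> edist n z w < delta -> Om w.

Definition cont_on (n : nat) (Om : pt -> Prop) (f : pt -> R) : Prop :=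
  forall z, Om z -> forall eps, 0 < eps -> exists delta, 0 < delta /\
    forall w, Om w -> edist n z w < delta -> Rabs (f w - f z) < eps.

Definition shift (n : nat) (z : pt) (a : nat) (h : R) : pt :=
  if Nat.ltb a (2 * n)
  then (fun i => if Nat.eqb i a then fst z i + h else fst z i, snd z)
  else (fst z, snd z + h).

Definition partial_lim (n : nat) (f : pt -> R) (z : pt) (a : nat) (l : R) : Prop :=
  derivable_pt_lim (fun h => f (shift n z a h)) 0 l.

Definition C2_on (n : nat) (Om : pt -> Prop) (u : pt -> R)
  (Du : nat -> pt -> R) (D2u : nat -> nat -> pt -> R) : Prop :=
  (forall z, Om z -> forall a, (a <= 2 * n)%nat ->
     partial_lim n u z a (Du a z) /\
     forall b, (b <= 2 * n)%nat -> partial_lim n (Du b) z a (D2u a b z)) /\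
  cont_on n Om u /\
  (forall a, (a <= 2 * n)%nat -> cont_on n Om (Du a)) /\
  (forall a b, (a <= 2 * n)%nat -> (b <= 2 * n)%nat -> cont_on n Om (D2u a b)).

(* X_i X_j u (z), with X_i = d_{x_i} + 2 (Jx)_i d_t, written out in terms
   of the partial derivatives of u *)
Definition XXu (n : nat) (Du : nat -> pt -> R) (D2u : nat -> nat -> pt -> R)
  (i j : nat) (z : pt) : R :=
  let tI := (2 * n)%nat in
  let x := fst z in
  D2u i j z + 2 * Jm n j i * Du tI z + 2 * Jx n x j * D2u i tI z
  + 2 * Jx n x i * D2u tI j z + 4 * Jx n x i * Jx n x j * D2u tI tI z.

Definition LA (n : nat) (A : pt -> nat -> nat -> R)
  (Du : nat -> pt -> R) (D2u : nat -> nat -> pt -> R) (z : pt) : R :=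
  rsum (2 * n) (fun i => rsum (2 * n) (fun j => A z i j * XXu n Du D2u i j z)).

Definition minor (M : nat -> nat -> R) (j : nat) : nat -> nat -> R :=
  fun a b => M (S a) (if Nat.ltb b j then b else S b).

Fixpoint det (k : nat) (M : nat -> nat -> R) : R :=
  match k with
  | O => 1
  | S k' => rsum (S k') (fun j => (-1) ^ j * M O j * det k' (minor M j))
  end.

Definition matmul (k : nat) (M N : nat -> nat -> R) : nat -> nat -> R :=
  fun i j => rsum k (fun l => M i l * N l j).

Definition transp (M : nat -> nat -> R) : nat -> nat -> R := fun i j => M j i.

Definition qform (k : nat) (M : nat -> nat -> R) (xi : nat -> R) : R :=
  rsum k (fun i => rsum k (fun j => M i j * xi i * xi j)).

Definition sqnorm (k : nat) (xi : nat -> R) : R := rsum k (fun i => xi i ^ 2).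

Definition in_Mn (n : nat) (lam Lam : R) (Om : pt -> Prop)
  (A : pt -> nat -> nat -> R) : Prop :=
  forall z, Om z ->
    (forall i j, (i < 2 * n)%nat -> (j < 2 * n)%nat -> A z i j = A z j i) /\
    det (2 * n) (A z) = 1 /\
    (forall xi : nat -> R,
       lam * sqnorm (2 * n) xi <= qform (2 * n) (A z) xi /\
       qform (2 * n) (A z) xi <= Lam * sqnorm (2 * n) xi).

(* symplectic: A(z)^{-1} = J^t A(z) J, i.e. (J^t A(z) J) A(z) = I *)
Definition symplectic (n : nat) (Om : pt -> Prop) (A : pt -> nat -> nat -> R) : Prop :=
  forall z, Om z -> forall i j, (i < 2 * n)%nat -> (j < 2 * n)%nat ->
    matmul (2 * n)
      (matmul (2 * n) (matmul (2 * n) (transp (Jm n)) (A z)) (Jm n)) (A z) i j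
    = (if Nat.eqb i j then 1 else 0).

Definition is_modulus (om : R -> R) : Prop :=
  (forall s, 0 <= s < 1 -> 0 <= om s < 1) /\
  (forall s s', 0 <= s -> s <= s' -> s' < 1 -> om s <= om s') /\
  om 0 = 0 /\
  (forall eps, 0 < eps -> exists delta, 0 < delta /\
     forall s, 0 < s < delta -> s < 1 -> Rabs (om s) < eps).

(* A in C(Om, omega): continuous, and sup_{B_eps(z0) cap Om} ||A(z)-A(z0)|| <= omega eps
   (operator norm bound written out: |(A(z)-A(z0)) xi| <= omega(eps) |xi|) *)
Definition in_C (n : nat) (Om : pt -> Prop) (om : R -> R)
  (A : pt -> nat -> nat -> R) : Prop :=
  (forall i j, (i < 2 * n)%nat -> (j < 2 * n)%nat -> cont_on n Om (fun z => A z i j)) /\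
  (forall z0, Om z0 -> forall eps, 0 < eps < 1 ->
     forall z, ball n z0 eps z -> Om z ->
       forall xi : nat -> R,
         sqrt (sqnorm (2 * n)
                 (fun i => rsum (2 * n) (fun j => (A z i j - A z0 i j) * xi j)))
         <= om eps * sqrt (sqnorm (2 * n) xi)).

(* Main.v *)
Require Import Defs.
From Stdlib Require Import Reals Lra Lia Arith List Classical ClassicalEpsilon FunctionalExtensionality.
Open Scope R_scope.

(** A Landis-type argument. Let [A0 = A z0], [G = A0^-1 = J^t A0 J]
    (symplecticity), and for a pole [zeta = (xi, tau)] put [y = x - xi],
    [T = t - tau - 2 <J xi, x>] and [f = <G y, y>^2 + T^2], a gauge adapted to
    [A0].  The horizontal Hessian and the squared horizontal gradient of [f]
    both degenerate like [<G y, y>], so [f^(-(Q-1)/4)], whose exponent lies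
    strictly between the fundamental solution's [(Q-2)/4] and the integrability
    threshold [Q/4], is an [L_A]-subsolution off the pole for every [A] close
    enough to [A0]; the modulus of continuity only enters here, through the
    choice of the radius.  Summing these barriers over the lattice points where
    a nonnegative solution is at least [l] gives a subsolution that is bounded
    (the kernel is integrable) and the maximum principle yields the growth
    lemma: [inf v >= c l * density {v >= l}], for any density.  For the Harnack
    inequality, maximise [u (2r - d(z0, .))^Q] at [z1] with value [M = u z1]
    and distance [tau] to the sphere: near [z1], [u] exceeds [M] only slightly,
    so by the growth lemma for [S - u] the set [{u >= M/2}] fills half of a
    small ball about [z1] of radius comparable to [tau], and the growth lemma
    for [u] on the ball of radius [2r] concludes.  Lattice counting replaces
    Lebesgue measure throughout. *)

Local Arguments Nat.mul : simpl never.

(** * Finite sums and linear algebra *)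

(** Where [y = 0] the horizontal gradient and Hessian of the barrier vanish, so a fixed positive
    margin could not absorb the error coming from [A - A0]. It is absorbed because it vanishes there
    too, at the same rate [<G y, y>]. Symplecticity enters through [A0 G = I]: the cross term in
    [<A0 Xf, Xf>] becomes a multiple of [<y, J y> = 0], which leaves exactly [16 <G y, y> f]. The
    lattice spacing [h] is chosen after [u], since uniform continuity is what turns a value at a
    lattice point into a bound on the surrounding ball of radius [h]. Hence no constant may depend
    on [h]: counts enter only in the scale-free form [N (h / R)^Q], and integrability of the kernel
    is replaced by one packing bound at all scales above [h]. The weight exponent is [Q] because the
    last use of the growth lemma loses a factor [(rho / 2r)^Q], with [rho] a fixed multiple of
    [tau], while the maximisation controls [M tau^Q]. That multiple is fixed by keeping the excess
    [S - M = kap M / 2] below the gain [kap M]. *)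

Lemma rsum_ext k f g : (forall i, (i < k)%nat -> f i = g i) -> rsum k f = rsum k g.
Proof.
  induction k as [|k IH]; intros H; simpl; [reflexivity|].
  rewrite IH, H; auto.
Qed.

Lemma rsum_plus k f g : rsum k (fun i => f i + g i) = rsum k f + rsum k g.
Proof. induction k as [|k IH]; simpl; [ring|]. rewrite IH; ring. Qed.

Lemma rsum_scal k c f : rsum k (fun i => c * f i) = c * rsum k f.
Proof. induction k as [|k IH]; simpl; [ring|]. rewrite IH; ring. Qed.

Lemma rsum_scal_r k c f : rsum k (fun i => f i * c) = rsum k f * c.
Proof. induction k as [|k IH]; simpl; [ring|]. rewrite IH; ring. Qed.

Lemma rsum_minus k f g : rsum k (fun i => f i - g i) = rsum k f - rsum k g.
Proof. induction k as [|k IH]; simpl; [ring|]. rewrite IH; ring. Qed.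

Lemma rsum_opp k f : rsum k (fun i => - f i) = - rsum k f.
Proof. induction k as [|k IH]; simpl; [ring|]. rewrite IH; ring. Qed.

Lemma rsum_zero k f : (forall i, (i < k)%nat -> f i = 0) -> rsum k f = 0.
Proof.
  intros H; induction k as [|k IH]; simpl; [reflexivity|].
  rewrite IH, H; auto; ring.
Qed.

Lemma rsum_le k f g : (forall i, (i < k)%nat -> f i <= g i) -> rsum k f <= rsum k g.
Proof.
  intros H; induction k as [|k IH]; simpl; [lra|].
  apply Rplus_le_compat; auto.
Qed.

Lemma rsum_nonneg k f : (forall i, (i < k)%nat -> 0 <= f i) -> 0 <= rsum k f.
Proof.
  intros H. rewrite <- (rsum_zero k (fun _ => 0)) by auto. apply rsum_le; auto.
Qed.

Lemma rsum_const k c : rsum k (fun _ => c) = INR k * c.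
Proof. induction k as [|k IH]; [simpl; ring|]. rewrite S_INR; simpl rsum; rewrite IH; ring. Qed.

Lemma rsum_term_le k f i :
  (forall j, (j < k)%nat -> 0 <= f j) -> (i < k)%nat -> f i <= rsum k f.
Proof.
  intros H Hi; induction k as [|k IH]; [lia|simpl].
  destruct (Nat.eq_dec i k) as [->|Hik].
  - assert (0 <= rsum k f) by (apply rsum_nonneg; auto). lra.
  - assert (f i <= rsum k f) by (apply IH; auto; lia). assert (0 <= f k) by auto. lra.
Qed.

Lemma rsum_Rabs k f : Rabs (rsum k f) <= rsum k (fun i => Rabs (f i)).
Proof.
  induction k as [|k IH]; simpl; [rewrite Rabs_R0; lra|].
  eapply Rle_trans; [apply Rabs_triang|]. lra.
Qed.

Lemma rsum_swap k l f :
  rsum k (fun i => rsum l (fun j => f i j)) = rsum l (fun j => rsum k (fun i => f i j)).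
Proof.
  induction k as [|k IH]; simpl.
  - symmetry; apply rsum_zero; auto.
  - rewrite IH, <- rsum_plus. reflexivity.
Qed.

Lemma rsum_delta k i f :
  (i < k)%nat -> rsum k (fun j => (if Nat.eqb i j then 1 else 0) * f j) = f i.
Proof.
  induction k as [|k IH]; intros Hi; [lia|simpl].
  destruct (Nat.eqb_spec i k) as [->|Hik].
  - rewrite rsum_zero; [ring|]. intros j Hj.
    destruct (Nat.eqb_spec k j); [lia|ring].
  - rewrite IH by lia. ring.
Qed.

Lemma rsum_app k l f : rsum (k + l) f = rsum k f + rsum l (fun i => f (k + i)%nat).
Proof.
  induction l as [|l IH]; simpl.
  - rewrite Nat.add_0_r; ring.
  - rewrite Nat.add_succ_r; simpl; rewrite IH; ring.
Qed.

(** * Dot products, matrix action, quadratic forms *)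

Definition dot (k : nat) (x y : nat -> R) : R := rsum k (fun i => x i * y i).

Definition mvec (k : nat) (M : nat -> nat -> R) (x : nat -> R) (i : nat) : R :=
  rsum k (fun j => M i j * x j).

Lemma dot_sym k x y : dot k x y = dot k y x.
Proof. apply rsum_ext; intros; ring. Qed.

Lemma dot_plus_r k x y z : dot k x (fun i => y i + z i) = dot k x y + dot k x z.
Proof. unfold dot. rewrite <- rsum_plus. apply rsum_ext; intros; ring. Qed.

Lemma dot_scal_r k c x y : dot k x (fun i => c * y i) = c * dot k x y.
Proof. unfold dot. rewrite <- rsum_scal. apply rsum_ext; intros; ring. Qed.

Lemma dot_plus_l k x y z : dot k (fun i => y i + z i) x = dot k y x + dot k z x.
Proof. rewrite !(dot_sym k _ x); apply dot_plus_r. Qed.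

Lemma dot_scal_l k c x y : dot k (fun i => c * y i) x = c * dot k y x.
Proof. rewrite !(dot_sym k _ x); apply dot_scal_r. Qed.

Lemma dot_nonneg k x : 0 <= dot k x x.
Proof. apply rsum_nonneg; intros; nra. Qed.

Lemma sqnorm_dot k x : sqnorm k x = dot k x x.
Proof. apply rsum_ext; intros; ring. Qed.

Lemma dot_ext k x x' y y' :
  (forall i, (i < k)%nat -> x i = x' i) -> (forall i, (i < k)%nat -> y i = y' i) ->
  dot k x y = dot k x' y'.
Proof. intros H H'; apply rsum_ext; intros; rewrite H, H'; auto. Qed.

Lemma dot_CS k x y : dot k x y ^ 2 <= dot k x x * dot k y y.
Proof.
  assert (H : forall a b, 0 <= a ^ 2 * dot k x x + 2 * a * b * dot k x y + b ^ 2 * dot k y y).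
  { intros a b.
    replace (a ^ 2 * dot k x x + 2 * a * b * dot k x y + b ^ 2 * dot k y y)
      with (dot k (fun i => a * x i + b * y i) (fun i => a * x i + b * y i)).
    - apply dot_nonneg.
    - rewrite dot_plus_l, !dot_plus_r, !dot_scal_l, !dot_scal_r, (dot_sym k y x). ring. }
  pose proof (dot_nonneg k x) as Hx. pose proof (dot_nonneg k y) as Hy.
  destruct (Rle_lt_or_eq_dec _ _ Hx) as [Hx'|Hx'].
  - pose proof (H (- dot k x y) (dot k x x)) as H1. nra.
  (* When [<x, x> = 0], this choice of coefficients gives [0 <= - <x, y>^2 (<y, y> + 2)]. *)
  - rewrite <- Hx'. pose proof (H (- (dot k y y + 1)) (dot k x y)) as H1.
    rewrite <- Hx' in H1. nra.
Qed.

Lemma qform_dot k M x : qform k M x = dot k x (mvec k M x).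
Proof.
  unfold qform, dot, mvec. apply rsum_ext; intros i _.
  rewrite <- rsum_scal. apply rsum_ext; intros; ring.
Qed.

Lemma mvec_plus k M x y i : mvec k M (fun j => x j + y j) i = mvec k M x i + mvec k M y i.
Proof. unfold mvec. rewrite <- rsum_plus. apply rsum_ext; intros; ring. Qed.

Lemma mvec_scal k M c x i : mvec k M (fun j => c * x j) i = c * mvec k M x i.
Proof. unfold mvec. rewrite <- rsum_scal. apply rsum_ext; intros; ring. Qed.

Lemma mvec_ext k M x y i : (forall j, (j < k)%nat -> x j = y j) -> mvec k M x i = mvec k M y i.
Proof. intros H; apply rsum_ext; intros; rewrite H; auto. Qed.

Lemma mvec_transp k M x y : dot k x (mvec k M y) = dot k (mvec k (transp M) x) y.
Proof.
  unfold dot, mvec, transp.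
  transitivity (rsum k (fun i => rsum k (fun j => x i * M i j * y j))).
  - apply rsum_ext; intros; rewrite <- rsum_scal; apply rsum_ext; intros; ring.
  - rewrite rsum_swap. apply rsum_ext; intros j _.
    rewrite <- rsum_scal_r. apply rsum_ext; intros; ring.
Qed.

Lemma mvec_matmul k M N x i : mvec k (matmul k M N) x i = mvec k M (mvec k N x) i.
Proof.
  unfold mvec, matmul.
  transitivity (rsum k (fun j => rsum k (fun l => M i l * N l j * x j))).
  - apply rsum_ext; intros; rewrite <- rsum_scal_r; reflexivity.
  - rewrite rsum_swap. apply rsum_ext; intros l _.
    rewrite <- rsum_scal. apply rsum_ext; intros; ring.
Qed.

(** The Frobenius product, that is [tr (A H)] for symmetric [A]; [LA] is this product of [A z] with
    the matrix of the [X_i X_j u]. *)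
Definition pairing (k : nat) (A H : nat -> nat -> R) : R :=
  rsum k (fun i => rsum k (fun j => A i j * H i j)).

Lemma qform_S k M x : qform (S k) M x
  = qform k M x + rsum k (fun i => (M i k + M k i) * x i) * x k + M k k * x k ^ 2.
Proof.
  unfold qform; simpl.
  rewrite rsum_plus.
  replace (rsum k (fun i => M i k * x i * x k)) with (rsum k (fun i => M i k * x i) * x k)
    by (rewrite <- rsum_scal_r; apply rsum_ext; intros; ring).
  replace (rsum k (fun j => M k j * x k * x j)) with (rsum k (fun i => M k i * x i) * x k)
    by (rewrite <- rsum_scal_r; apply rsum_ext; intros; ring).
  replace (rsum k (fun i => (M i k + M k i) * x i))
    with (rsum k (fun i => M i k * x i) + rsum k (fun i => M k i * x i))
    by (rewrite <- rsum_plus; apply rsum_ext; intros; ring).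
  ring.
Qed.

Lemma qform_ext k M N x y :
  (forall i j, (i < k)%nat -> (j < k)%nat -> M i j = N i j) ->
  (forall i, (i < k)%nat -> x i = y i) -> qform k M x = qform k N y.
Proof.
  intros H H'; apply rsum_ext; intros; apply rsum_ext; intros.
  rewrite H, !H'; auto.
Qed.

Lemma pairing_ext k A B H K :
  (forall i j, (i < k)%nat -> (j < k)%nat -> A i j * H i j = B i j * K i j) ->
  pairing k A H = pairing k B K.
Proof. intros E; apply rsum_ext; intros; apply rsum_ext; auto. Qed.

Lemma pairing_plus_r k A H K :
  pairing k A (fun i j => H i j + K i j) = pairing k A H + pairing k A K.
Proof.
  unfold pairing. rewrite <- rsum_plus. apply rsum_ext; intros.
  rewrite <- rsum_plus. apply rsum_ext; intros; ring.
Qed.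

Lemma pairing_scal_r k A c H : pairing k A (fun i j => c * H i j) = c * pairing k A H.
Proof.
  unfold pairing. rewrite <- rsum_scal. apply rsum_ext; intros.
  rewrite <- rsum_scal. apply rsum_ext; intros; ring.
Qed.

Lemma pairing_sym k A H : pairing k A H = pairing k H A.
Proof. apply rsum_ext; intros; apply rsum_ext; intros; ring. Qed.

Lemma pairing_rank1 k A x : pairing k A (fun i j => x i * x j) = qform k A x.
Proof. apply rsum_ext; intros; apply rsum_ext; intros; ring. Qed.

(* Induction by Schur complements: [A - a a^T / A k k], with [a] the last
   column, lives on the first [k] indices and is again positive. *)
Lemma pairing_nonneg k A H :
  (forall i j, (i < k)%nat -> (j < k)%nat -> A i j = A j i) ->
  (forall x, 0 <= qform k A x) -> (forall x, 0 <= qform k H x) ->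
  0 <= pairing k A H.
Proof.
  revert A. induction k as [|k IH]; intros A Hsym HA HH; [unfold pairing; simpl; lra|].
  assert (HHk : forall x, 0 <= qform k H x).
  { intros x. specialize (HH (fun i => if Nat.eqb i k then 0 else x i)).
    rewrite qform_S, Nat.eqb_refl in HH.
    rewrite (qform_ext k H H _ x) in HH; [lra|auto|].
    intros i Hi. destruct (Nat.eqb_spec i k); [lia|auto]. }
  assert (HAk : forall x y, 0 <= qform k A x + 2 * y * rsum k (fun i => A i k * x i)
                                + A k k * y ^ 2).
  { intros x y. specialize (HA (fun i => if Nat.eqb i k then y else x i)).
    rewrite qform_S, Nat.eqb_refl in HA.
    rewrite (qform_ext k A A _ x) in HA; [|auto|].
    2:{ intros i Hi. destruct (Nat.eqb_spec i k); [lia|auto]. }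
    rewrite (rsum_ext k _ (fun i => 2 * (A i k * x i))), rsum_scal in HA; [lra|].
    intros i Hi. destruct (Nat.eqb_spec i k); [lia|]. rewrite (Hsym k i) by lia. ring. }
  assert (Hkk : 0 <= A k k).
  { specialize (HAk (fun _ => 0) 1). unfold qform in HAk.
    rewrite (rsum_zero k) in HAk.
    2:{ intros; apply rsum_zero; intros; ring. }
    rewrite (rsum_zero k) in HAk; [lra|intros; ring]. }
  destruct (Rle_lt_or_eq_dec _ _ Hkk) as [Hpos|Hz].
  - set (A' := fun i j => A i j - A i k * A j k / A k k).
    assert (E : pairing (S k) A H
                = pairing k A' H + qform (S k) H (fun i => A i k) / A k k).
    { transitivity (pairing (S k) A' H + qform (S k) H (fun i => A i k) / A k k).
      - rewrite <- pairing_rank1. unfold Rdiv. rewrite (Rmult_comm _ (/ A k k)).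
        rewrite <- pairing_scal_r. unfold pairing. rewrite <- rsum_plus.
        apply rsum_ext; intros. rewrite <- rsum_plus. apply rsum_ext; intros.
        unfold A'. field. lra.
      - f_equal. unfold pairing; simpl.
        rewrite (rsum_ext k _ (fun i => rsum k (fun j => A' i j * H i j))).
        + rewrite (rsum_zero k (fun j => A' k j * H k j)).
          * replace (A' k k) with 0 by (unfold A'; field; lra). ring.
          * intros i Hi. unfold A'. rewrite (Hsym k i) by lia. field. lra.
        + intros i Hi. replace (A' i k) with 0 by (unfold A'; field; lra). ring. }
    rewrite E. apply Rplus_le_le_0_compat.
    + apply IH; auto.
      * intros i j Hi Hj. unfold A'. rewrite (Hsym i j) by lia. field. lra.
      * intros x. set (s := rsum k (fun i => A i k * x i)).
        replace (qform k A' x) with (qform k A x - s ^ 2 / A k k).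
        -- specialize (HAk x (- s / A k k)). fold s in HAk.
           replace (qform k A x - s ^ 2 / A k k) with
             (qform k A x + 2 * (- s / A k k) * s + A k k * (- s / A k k) ^ 2) by (field; lra).
           exact HAk.
        -- unfold s. replace (rsum k (fun i => A i k * x i) ^ 2)
             with (qform k (fun i j => A i k * A j k) x).
           ++ unfold qform, Rdiv. rewrite <- rsum_scal_r, <- rsum_minus.
              apply rsum_ext; intros. rewrite <- rsum_scal_r, <- rsum_minus.
              apply rsum_ext; intros. unfold A'. field. lra.
           ++ unfold qform. simpl. rewrite Rmult_1_r, <- rsum_scal_r.
              apply rsum_ext; intros. rewrite <- rsum_scal.
              apply rsum_ext; intros. ring.
    + apply Rmult_le_pos; [apply HH|]. left; apply Rinv_0_lt_compat; auto.
  (* Zero pivot: the last column vanishes. For [s = A i k] nonzero, the nonnegative quantity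
     [A i i + 2 y s] is affine in [y] and would take the value [-1]. *)
  - assert (Hik : forall i, (i < k)%nat -> A i k = 0).
    { intros i Hi.
      set (s := A i k).
      assert (HQ : forall y, 0 <= A i i + 2 * y * s).
      { intros y. specialize (HAk (fun j => if Nat.eqb i j then 1 else 0) y).
        rewrite <- Hz in HAk.
        rewrite (rsum_ext k _ (fun j => (if Nat.eqb i j then 1 else 0) * A j k)) in HAk
          by (intros; ring).
        rewrite rsum_delta in HAk by auto. fold s in HAk.
        replace (qform k A (fun j => if Nat.eqb i j then 1 else 0)) with (A i i) in HAk; [lra|].
        unfold qform.
        rewrite (rsum_ext k _ (fun a => (if Nat.eqb i a then 1 else 0) * A a i)).
        - rewrite rsum_delta; auto.
        - intros a Ha.
          rewrite (rsum_ext k _ (fun b => (if Nat.eqb i b then 1 else 0)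
             * (A a b * (if Nat.eqb i a then 1 else 0)))) by (intros; ring).
          rewrite rsum_delta by auto. ring. }
      destruct (Req_dec s 0) as [|Hs]; auto.
      specialize (HQ (- (A i i + 1) / (2 * s))).
      replace (A i i + 2 * (- (A i i + 1) / (2 * s)) * s) with (-1) in HQ by (field; auto). lra. }
    replace (pairing (S k) A H) with (pairing k A H).
    + apply IH; auto. intros x. specialize (HAk x 0). lra.
    + unfold pairing; simpl. rewrite <- Hz.
      rewrite (rsum_ext k (fun i => rsum k _ + _) (fun i => rsum k (fun j => A i j * H i j))).
      * rewrite (rsum_zero k (fun j => A k j * H k j)); [ring|].
        intros j Hj. rewrite (Hsym k j), Hik by lia. ring.
      * intros i Hi. rewrite Hik by lia. ring.
Qed.

(** * The symplectic matrix and the Cygan gauge *)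

Lemma Jx_eq n x j :
  Jx n x j = if Nat.ltb j n then - x (j + n)%nat
             else if Nat.ltb j (2 * n) then x (j - n)%nat else 0.
Proof.
  unfold Jx, Jm.
  destruct (Nat.ltb_spec j n) as [H|H].
  - rewrite (rsum_ext _ _ (fun k => (if Nat.eqb (j + n) k then 1 else 0) * - x k)).
    + rewrite rsum_delta; [auto|lia].
    + intros k _. rewrite Nat.eqb_sym. destruct (Nat.eqb (j + n) k); ring.
  - destruct (Nat.ltb_spec j (2 * n)) as [H'|H']; simpl andb.
    + rewrite (rsum_ext _ _ (fun k => (if Nat.eqb (j - n) k then 1 else 0) * x k)).
      * rewrite rsum_delta; [auto|lia].
      * intros k _. rewrite Nat.eqb_sym. destruct (Nat.eqb (j - n) k); ring.
    + apply rsum_zero; intros; ring.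
Qed.

Lemma Jm_antisym n i j : (i < 2 * n)%nat -> (j < 2 * n)%nat -> Jm n i j = - Jm n j i.
Proof.
  intros Hi Hj. unfold Jm.
  destruct (Nat.ltb_spec i n); destruct (Nat.ltb_spec j n);
  destruct (Nat.ltb_spec i (2 * n)); destruct (Nat.ltb_spec j (2 * n));
  destruct (Nat.eqb_spec j (i + n)); destruct (Nat.eqb_spec i (j + n));
  destruct (Nat.eqb_spec j (i - n)); destruct (Nat.eqb_spec i (j - n));
  simpl; try lia; try ring.
Qed.

Lemma dot_J_antisym n x y : dot (2 * n) (Jx n x) y = - dot (2 * n) x (Jx n y).
Proof.
  change (dot (2 * n) x (Jx n y)) with (dot (2 * n) x (mvec (2 * n) (Jm n) y)).
  rewrite mvec_transp. unfold dot.
  rewrite <- rsum_opp. apply rsum_ext; intros i Hi.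
  rewrite Ropp_mult_distr_l. f_equal.
  unfold Jx, mvec, transp. rewrite <- rsum_opp. apply rsum_ext; intros j Hj.
  rewrite (Jm_antisym n j i) by auto. ring.
Qed.

Lemma dot_J_self n x : dot (2 * n) (Jx n x) x = 0.
Proof. pose proof (dot_J_antisym n x x). rewrite (dot_sym _ x) in H. lra. Qed.

Lemma dot_J_J n x : dot (2 * n) (Jx n x) (Jx n x) = dot (2 * n) x x.
Proof.
  unfold dot. replace (2 * n)%nat with (n + n)%nat by lia. rewrite !rsum_app.
  rewrite Rplus_comm. f_equal; apply rsum_ext; intros i Hi; rewrite !Jx_eq.
  - destruct (Nat.ltb_spec (n + i) n); [lia|].
    destruct (Nat.ltb_spec (n + i) (2 * n)); [|lia].
    replace (n + i - n)%nat with i by lia. ring.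
  - destruct (Nat.ltb_spec i n); [|lia]. rewrite (Nat.add_comm i n). ring.
Qed.

Lemma Jx_plus n x y i : Jx n (fun j => x j + y j) i = Jx n x i + Jx n y i.
Proof. apply mvec_plus. Qed.

Lemma Jx_scal n c x i : Jx n (fun j => c * x j) i = c * Jx n x i.
Proof. apply mvec_scal. Qed.

(* The pair [(<x,y>, <Jx,y>)] is the Hermitian product of [x] and [y]. *)
Lemma hermitian_CS n x y :
  dot (2 * n) x y ^ 2 + dot (2 * n) (Jx n x) y ^ 2
  <= dot (2 * n) x x * dot (2 * n) y y.
Proof.
  set (a := dot (2 * n) x y). set (b := dot (2 * n) (Jx n x) y).
  set (v := fun i => a * x i + b * Jx n x i).
  assert (H1 : dot (2 * n) v v = (a ^ 2 + b ^ 2) * dot (2 * n) x x).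
  { unfold v. rewrite dot_plus_l, !dot_plus_r, !dot_scal_l, !dot_scal_r.
    rewrite (dot_sym _ x (Jx n x)), dot_J_self, dot_J_J. ring. }
  assert (H2 : dot (2 * n) v y = a ^ 2 + b ^ 2).
  { unfold v. rewrite dot_plus_l, !dot_scal_l. fold a b. ring. }
  pose proof (dot_CS (2 * n) v y) as H. rewrite H1, H2 in H.
  pose proof (dot_nonneg (2 * n) x). pose proof (dot_nonneg (2 * n) y).
  set (s := a ^ 2 + b ^ 2) in *.
  assert (0 <= s) by (unfold s; nra).
  destruct (Req_dec s 0) as [->|]; [nra|].
  apply Rmult_le_reg_l with s; nra.
Qed.

Definition ydiff (z w : pt) (i : nat) : R := fst w i - fst z i.

(** The [t]-coordinate of the group element [z^-1 o w], whose horizontal part is [ydiff z w].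
    Working with the polynomial [dist4] postpones the two square roots in [hdist]. *)
Definition tdiff (n : nat) (z w : pt) : R :=
  snd w - snd z - 2 * dot (2 * n) (Jx n (fst z)) (fst w).

Definition dist4 (n : nat) (z w : pt) : R :=
  dot (2 * n) (ydiff z w) (ydiff z w) ^ 2 + tdiff n z w ^ 2.

Lemma dist4_nonneg n z w : 0 <= dist4 n z w.
Proof. unfold dist4; nra. Qed.

Lemma hdist_dist4 n z w : hdist n z w = sqrt (sqrt (dist4 n z w)).
Proof.
  unfold hdist, rho, dist4. do 3 f_equal; apply f_equal2; auto; simpl fst; simpl snd.
  - apply rsum_ext; intros; unfold ydiff; ring.
  - unfold tdiff, dot.
    rewrite (rsum_ext _ (fun i => Jx n _ i * _) (fun i => - (Jx n (fst z) i * fst w i))).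
    + rewrite rsum_opp. ring.
    + intros i _. unfold Jx. rewrite Ropp_mult_distr_l, <- rsum_opp. f_equal.
      apply rsum_ext; intros; ring.
Qed.

Lemma hdist_nonneg n z w : 0 <= hdist n z w.
Proof. apply sqrt_pos. Qed.

Lemma hdist_pow4 n z w : hdist n z w ^ 4 = dist4 n z w.
Proof.
  rewrite hdist_dist4. set (D := dist4 n z w).
  replace (sqrt (sqrt D) ^ 4) with ((sqrt (sqrt D) * sqrt (sqrt D)) ^ 2) by ring.
  rewrite sqrt_sqrt by apply sqrt_pos. simpl. rewrite Rmult_1_r.
  apply sqrt_sqrt, dist4_nonneg.
Qed.

Lemma pow4_le_inv a b : 0 <= b -> a ^ 4 <= b ^ 4 -> a <= b.
Proof.
  intros Hb H. destruct (Rle_or_lt a b) as [|Hab]; auto.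
  assert (b ^ 2 < a ^ 2) by nra.
  assert (b ^ 4 < a ^ 4) by (replace (b ^ 4) with ((b ^ 2) ^ 2) by ring;
    replace (a ^ 4) with ((a ^ 2) ^ 2) by ring; nra). lra.
Qed.

Lemma hdist_le_dist4 n z w a : 0 <= a -> dist4 n z w <= a ^ 4 -> hdist n z w <= a.
Proof. intros Ha H. apply pow4_le_inv; auto. rewrite hdist_pow4; auto. Qed.

Lemma CS2 p q r s X Y :
  0 <= X -> 0 <= Y -> p ^ 2 + q ^ 2 <= X ^ 2 -> r ^ 2 + s ^ 2 <= Y ^ 2 -> p * r + q * s <= X * Y.
Proof.
  intros HX HY H1 H2. destruct (Rle_or_lt (p * r + q * s) (X * Y)) as [|H]; auto.
  assert ((p * r + q * s) ^ 2 <= X ^ 2 * Y ^ 2).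
  { apply Rle_trans with ((p ^ 2 + q ^ 2) * (r ^ 2 + s ^ 2)).
    - pose proof (pow2_ge_0 (p * s - q * r)). nra.
    - apply Rmult_le_compat; nra. }
  assert (0 <= X * Y) by nra. nra.
Qed.

Lemma dot_ydiff_le n z w : dot (2 * n) (ydiff z w) (ydiff z w) <= hdist n z w ^ 2.
Proof.
  pose proof (hdist_pow4 n z w) as H. unfold dist4 in H.
  pose proof (dot_nonneg (2 * n) (ydiff z w)).
  assert (0 <= tdiff n z w ^ 2) by nra. assert (0 <= hdist n z w ^ 2) by nra.
  replace (hdist n z w ^ 4) with ((hdist n z w ^ 2) ^ 2) in H by ring. nra.
Qed.

(** Cygan's argument. Put [w1 = P + i t1] and [w2 = S + i t2], of moduli [d1^2] and [d2^2]. The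
    number [|y|^2 + i T] attached to the pair [z, w] is [w1 + w2 + 2 (a + i b)], and
    [|a + i b| <= d1 d2] by [hermitian_CS], so its modulus is at most [(d1 + d2)^2]. The proof
    expands the square of this inequality term by term. *)
Lemma hdist_triangle n z p w : hdist n z w <= hdist n z p + hdist n p w.
Proof.
  set (P := dot (2 * n) (ydiff z p) (ydiff z p)).
  set (S := dot (2 * n) (ydiff p w) (ydiff p w)).
  set (a := dot (2 * n) (ydiff z p) (ydiff p w)).
  set (b := dot (2 * n) (Jx n (ydiff z p)) (ydiff p w)).
  assert (Hy : forall i, ydiff z w i = ydiff z p i + ydiff p w i) by (intros; unfold ydiff; ring).
  assert (E1 : dot (2 * n) (ydiff z w) (ydiff z w) = P + S + 2 * a).
  { rewrite (dot_ext _ (ydiff z w) (fun i => ydiff z p i + ydiff p w i)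
                       (ydiff z w) (fun i => ydiff z p i + ydiff p w i)) by auto.
    rewrite dot_plus_l, !dot_plus_r, (dot_sym _ (ydiff p w) (ydiff z p)).
    unfold P, S, a; ring. }
  assert (E2 : tdiff n z w = tdiff n z p + tdiff n p w + 2 * b).
  { unfold b.
    rewrite (dot_ext _ (Jx n (ydiff z p)) (fun i => Jx n (fst p) i + -1 * Jx n (fst z) i)
                     (ydiff p w) (fun i => fst w i + -1 * fst p i)).
    - rewrite dot_plus_l, !dot_plus_r, !dot_scal_l, !dot_scal_r.
      change (dot (2 * n) (fun i => Jx n (fst p) i)) with (dot (2 * n) (Jx n (fst p))).
      rewrite dot_J_self. unfold tdiff. ring.
    - intros. rewrite <- Jx_scal, <- Jx_plus. unfold ydiff. f_equal.
      apply functional_extensionality; intros; ring.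
    - intros; unfold ydiff; ring. }
  pose proof (hermitian_CS n (ydiff z p) (ydiff p w)) as HC. fold P S a b in HC.
  pose proof (hdist_nonneg n z p) as H1. pose proof (hdist_nonneg n p w) as H2.
  pose proof (dot_ydiff_le n z p) as HP. pose proof (dot_ydiff_le n p w) as HS. fold P in HP. fold S in HS.
  assert (0 <= P) by apply dot_nonneg. assert (0 <= S) by apply dot_nonneg.
  pose proof (hdist_pow4 n z p) as E3. pose proof (hdist_pow4 n p w) as E4.
  unfold dist4 in E3, E4. fold P in E3. fold S in E4.
  apply hdist_le_dist4; [lra|]. unfold dist4. rewrite E1, E2.
  set (d1 := hdist n z p) in *. set (d2 := hdist n p w) in *.
  set (t1 := tdiff n z p) in *. set (t2 := tdiff n p w) in *.
  assert (Hm : a ^ 2 + b ^ 2 <= (d1 * d2) ^ 2).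
  { eapply Rle_trans; [apply HC|]. replace ((d1 * d2) ^ 2) with (d1 ^ 2 * d2 ^ 2) by ring.
    apply Rmult_le_compat; auto. }
  assert (0 <= d1 * d2) by nra. assert (0 <= d1 ^ 2) by nra. assert (0 <= d2 ^ 2) by nra.
  assert (G1 : P * S + t1 * t2 <= d1 ^ 2 * d2 ^ 2) by (apply CS2; auto; lra).
  assert (G2 : P * a + t1 * b <= d1 ^ 2 * (d1 * d2)) by (apply CS2; auto; lra).
  assert (G3 : S * a + t2 * b <= d2 ^ 2 * (d1 * d2)) by (apply CS2; auto; lra).
  replace ((P + S + 2 * a) ^ 2 + (t1 + t2 + 2 * b) ^ 2) with
    ((P ^ 2 + t1 ^ 2) + (S ^ 2 + t2 ^ 2) + 4 * (a ^ 2 + b ^ 2) + 2 * (P * S + t1 * t2)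
     + 4 * (P * a + t1 * b) + 4 * (S * a + t2 * b)) by ring.
  rewrite <- E3, <- E4.
  replace ((d1 + d2) ^ 4) with (d1 ^ 4 + d2 ^ 4 + 4 * (d1 * d2) ^ 2 + 2 * (d1 ^ 2 * d2 ^ 2)
    + 4 * (d1 ^ 2 * (d1 * d2)) + 4 * (d2 ^ 2 * (d1 * d2))) by ring.
  lra.
Qed.

Lemma tdiff_sym n z w : tdiff n w z = - tdiff n z w.
Proof.
  unfold tdiff. rewrite (dot_J_antisym n (fst w)), (dot_sym _ (fst w)). ring.
Qed.

Lemma hdist_sym n z w : hdist n z w = hdist n w z.
Proof.
  rewrite !hdist_dist4. unfold dist4. rewrite tdiff_sym. do 3 f_equal.
  - f_equal. apply rsum_ext; intros; unfold ydiff; ring.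
  - ring.
Qed.

Lemma hdist_self n z : hdist n z z = 0.
Proof.
  rewrite hdist_dist4. unfold dist4, tdiff. rewrite dot_J_self.
  unfold dot. rewrite rsum_zero by (intros; unfold ydiff; ring).
  replace (0 ^ 2 + (snd z - snd z - 2 * 0) ^ 2) with 0 by ring.
  now rewrite !sqrt_0.
Qed.

Lemma abs_le_of_sq a b : 0 <= b -> a ^ 2 <= b ^ 2 -> Rabs a <= b.
Proof. intros Hb H. apply Rabs_le. split; nra. Qed.

Lemma ydiff_abs_le n z w i : (i < 2 * n)%nat -> Rabs (ydiff z w i) <= hdist n z w.
Proof.
  intros Hi. apply abs_le_of_sq; [apply hdist_nonneg|].
  eapply Rle_trans; [|apply dot_ydiff_le].
  replace (ydiff z w i ^ 2) with (ydiff z w i * ydiff z w i) by ring.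
  apply (rsum_term_le (2 * n) (fun i => ydiff z w i * ydiff z w i)); auto.
  intros; nra.
Qed.

Lemma tdiff_abs_le n z w : Rabs (tdiff n z w) <= hdist n z w ^ 2.
Proof.
  apply abs_le_of_sq; [apply pow2_ge_0|].
  replace ((hdist n z w ^ 2) ^ 2) with (hdist n z w ^ 4) by ring.
  rewrite hdist_pow4. unfold dist4. nra.
Qed.

(** The Euclidean increment of [t] differs from [tdiff] by a term linear in the increment of [x],
    with coefficients fixed by [z]; this is what makes gauge balls bounded in coordinates. *)
Lemma snd_abs_le n z w :
  Rabs (snd w - snd z)
  <= hdist n z w ^ 2 + 2 * rsum (2 * n) (fun i => Rabs (Jx n (fst z) i)) * hdist n z w.
Proof.
  replace (snd w - snd z) with
    (tdiff n z w + 2 * dot (2 * n) (Jx n (fst z)) (ydiff z w)).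
  - eapply Rle_trans; [apply Rabs_triang|]. apply Rplus_le_compat; [apply tdiff_abs_le|].
    rewrite Rabs_mult, Rabs_right by lra. rewrite Rmult_assoc.
    apply Rmult_le_compat_l; [lra|]. unfold dot.
    eapply Rle_trans; [apply rsum_Rabs|]. rewrite <- rsum_scal_r.
    apply rsum_le; intros. rewrite Rabs_mult.
    apply Rmult_le_compat_l; [apply Rabs_pos|]. apply ydiff_abs_le; auto.
  - unfold tdiff.
    rewrite (dot_ext _ _ (Jx n (fst z)) (ydiff z w) (fun i => fst w i + -1 * fst z i));
      [|auto|intros; unfold ydiff; ring].
    rewrite dot_plus_r, dot_scal_r, dot_J_self. ring.
Qed.

(** * Euclidean continuity and compactness *)

Lemma edist_nonneg n z w : 0 <= edist n z w.
Proof. apply sqrt_pos. Qed.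

Lemma edist_sq n z w :
  edist n z w ^ 2 = rsum (2 * n) (fun i => (fst z i - fst w i) ^ 2) + (snd z - snd w) ^ 2.
Proof.
  unfold edist. rewrite <- (Rsqr_pow2 (sqrt _)). apply Rsqr_sqrt.
  apply Rplus_le_le_0_compat; [apply rsum_nonneg; intros|]; apply pow2_ge_0.
Qed.

Lemma edist_fst n z w i : (i < 2 * n)%nat -> Rabs (fst z i - fst w i) <= edist n z w.
Proof.
  intros Hi. apply abs_le_of_sq; [apply edist_nonneg|]. rewrite edist_sq.
  pose proof (pow2_ge_0 (snd z - snd w)).
  enough ((fst z i - fst w i) ^ 2 <= rsum (2 * n) (fun i => (fst z i - fst w i) ^ 2)) by lra.
  apply (rsum_term_le (2 * n) (fun i => (fst z i - fst w i) ^ 2)); auto.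
  intros; apply pow2_ge_0.
Qed.

Lemma edist_snd n z w : Rabs (snd z - snd w) <= edist n z w.
Proof.
  apply abs_le_of_sq; [apply edist_nonneg|]. rewrite edist_sq.
  assert (0 <= rsum (2 * n) (fun i => (fst z i - fst w i) ^ 2))
    by (apply rsum_nonneg; intros; apply pow2_ge_0). lra.
Qed.

Lemma edist_le n z w c :
  0 <= c -> (forall i, (i < 2 * n)%nat -> Rabs (fst z i - fst w i) <= c) ->
  Rabs (snd z - snd w) <= c -> edist n z w <= INR (2 * n + 1) * c.
Proof.
  intros Hc H1 H2. unfold edist.
  assert (HN : 1 <= INR (2 * n + 1)) by (rewrite plus_INR; pose proof (pos_INR (2 * n)); simpl INR at 2; lra).
  rewrite <- (sqrt_Rsqr (INR (2 * n + 1) * c)) by nra.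
  apply sqrt_le_1_alt.
  assert (Hsq : forall a, Rabs a <= c -> a ^ 2 <= c ^ 2).
  { intros a Ha. rewrite <- (pow2_abs a). pose proof (Rabs_pos a). nra. }
  apply Rle_trans with (INR (2 * n + 1) * c ^ 2).
  - rewrite plus_INR, Rmult_plus_distr_r. apply Rplus_le_compat.
    + rewrite <- rsum_const. apply rsum_le; intros. apply Hsq; auto.
    + simpl INR. rewrite Rmult_1_l. apply Hsq; auto.
  - unfold Rsqr. assert (0 <= c ^ 2) by nra. nra.
Qed.

Lemma cont_on_subset n (F G : pt -> Prop) f :
  (forall z, F z -> G z) -> cont_on n G f -> cont_on n F f.
Proof.
  intros H Hf z Fz eps He. destruct (Hf z (H z Fz) eps He) as [d [Hd H']].
  exists d; split; auto.
Qed.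

Lemma cont_on_ext n F f g : (forall z, f z = g z) -> cont_on n F f -> cont_on n F g.
Proof.
  intros H Hf z Fz eps He. destruct (Hf z Fz eps He) as [d [Hd H']].
  exists d; split; auto. intros; rewrite <- !H; auto.
Qed.

Lemma cont_on_comp n F f phi :
  cont_on n F f -> (forall z, F z -> continuity_pt phi (f z)) -> cont_on n F (fun z => phi (f z)).
Proof.
  intros Hf Hp z Fz eps He.
  destruct (Hp z Fz eps He) as [a [Ha H]].
  destruct (Hf z Fz a Ha) as [d [Hd H']].
  exists d; split; auto. intros w Fw Hw.
  destruct (Req_dec (f w) (f z)) as [E|E].
  - rewrite E. unfold Rminus. rewrite Rplus_opp_r, Rabs_R0; auto.
  - apply (H (f w)). split; [split; [exact I|auto]|]. apply H'; auto.
Qed.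

Lemma cont_on_plus n F f g :
  cont_on n F f -> cont_on n F g -> cont_on n F (fun z => f z + g z).
Proof.
  intros Hf Hg z Fz eps He.
  destruct (Hf z Fz (eps / 2)) as [d1 [Hd1 H1]]; [lra|].
  destruct (Hg z Fz (eps / 2)) as [d2 [Hd2 H2]]; [lra|].
  exists (Rmin d1 d2); split; [apply Rmin_pos; auto|]. intros w Fw Hw.
  assert (edist n z w < d1) by (eapply Rlt_le_trans; [apply Hw|apply Rmin_l]).
  assert (edist n z w < d2) by (eapply Rlt_le_trans; [apply Hw|apply Rmin_r]).
  replace (f w + g w - (f z + g z)) with ((f w - f z) + (g w - g z)) by ring.
  eapply Rle_lt_trans; [apply Rabs_triang|].
  specialize (H1 w Fw H). specialize (H2 w Fw H0). lra.
Qed.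

Lemma cont_on_const n F c : cont_on n F (fun _ => c).
Proof.
  intros z _ eps He. exists 1; split; [lra|]. intros.
  unfold Rminus; rewrite Rplus_opp_r, Rabs_R0; auto.
Qed.

Lemma cont_on_scal n F c f : cont_on n F f -> cont_on n F (fun z => c * f z).
Proof.
  intros Hf. apply (cont_on_comp n F f (fun x => c * x)); auto.
  intros z _. apply derivable_continuous_pt. apply derivable_pt_scal, derivable_pt_id.
Qed.

(** Polarisation, [f g = ((f + g)^2 - (f - g)^2) / 4], reduces products to sums and to composition
    with the square. *)
Lemma cont_on_mult n F f g :
  cont_on n F f -> cont_on n F g -> cont_on n F (fun z => f z * g z).
Proof.
  intros Hf Hg.
  apply cont_on_ext with (fun z => / 4 * ((fun x => x ^ 2) (f z + g z)
                                   + -1 * (fun x => x ^ 2) (f z + -1 * g z)));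
    [intros; field|].
  assert (Hc : forall x, continuity_pt (fun x => x ^ 2) x).
  { intros x. apply derivable_continuous_pt, derivable_pt_pow. }
  apply cont_on_scal, cont_on_plus; [|apply cont_on_scal];
    apply (cont_on_comp n F _ (fun x => x ^ 2)); auto;
    apply cont_on_plus; auto; apply cont_on_scal; auto.
Qed.

Lemma cont_on_minus n F f g :
  cont_on n F f -> cont_on n F g -> cont_on n F (fun z => f z - g z).
Proof.
  intros Hf Hg. apply cont_on_ext with (fun z => f z + -1 * g z); [intros; ring|].
  apply cont_on_plus; auto. apply cont_on_scal; auto.
Qed.

Lemma cont_on_pow n F f k : cont_on n F f -> cont_on n F (fun z => f z ^ k).
Proof.
  intros Hf. apply (cont_on_comp n F f (fun x => x ^ k)); auto.
  intros z _. apply derivable_continuous_pt, derivable_pt_pow.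
Qed.

Lemma cont_on_rsum n F k f :
  (forall i, (i < k)%nat -> cont_on n F (f i)) -> cont_on n F (fun z => rsum k (fun i => f i z)).
Proof.
  intros Hf. induction k as [|k IH]; simpl; [apply cont_on_const|].
  apply cont_on_plus; auto.
Qed.

Lemma cont_on_fst n F i : (i < 2 * n)%nat -> cont_on n F (fun z => fst z i).
Proof.
  intros Hi z _ eps He. exists eps; split; auto. intros w _ Hw.
  rewrite Rabs_minus_sym. eapply Rle_lt_trans; [apply edist_fst; eauto|auto].
Qed.

Lemma cont_on_snd n F : cont_on n F snd.
Proof.
  intros z _ eps He. exists eps; split; auto. intros w _ Hw.
  rewrite Rabs_minus_sym. eapply Rle_lt_trans; [apply edist_snd|eauto].
Qed.

Lemma cont_on_ydiff n F p i : (i < 2 * n)%nat -> cont_on n F (fun z => ydiff p z i).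
Proof. intros Hi. apply cont_on_minus; [apply cont_on_fst; auto|apply cont_on_const]. Qed.

Lemma cont_on_tdiff n F p : cont_on n F (fun z => tdiff n p z).
Proof.
  unfold tdiff. apply cont_on_minus.
  - apply cont_on_minus; [apply cont_on_snd|apply cont_on_const].
  - apply cont_on_scal. unfold dot. apply cont_on_rsum; intros.
    apply cont_on_scal. apply cont_on_fst; auto.
Qed.

Lemma cont_on_dist4 n F p : cont_on n F (fun z => dist4 n p z).
Proof.
  unfold dist4. apply cont_on_plus; apply cont_on_pow.
  - unfold dot. apply cont_on_rsum; intros. apply cont_on_mult; apply cont_on_ydiff; auto.
  - apply cont_on_tdiff.
Qed.

Lemma cont_on_hdist n F p : cont_on n F (fun z => hdist n p z).
Proof.
  apply cont_on_ext with (fun z => sqrt (sqrt (dist4 n p z))).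
  { intros; symmetry; apply hdist_dist4. }
  apply (cont_on_comp n F (fun z => sqrt (dist4 n p z)) sqrt).
  - apply (cont_on_comp n F (fun z => dist4 n p z) sqrt).
    + apply cont_on_dist4.
    + intros; apply continuity_pt_sqrt, dist4_nonneg.
  - intros; apply continuity_pt_sqrt, sqrt_pos.
Qed.

(** * Sequential compactness of gauge balls and its consequences *)

Definition tends_to (n : nat) (zs : nat -> pt) (l : pt) : Prop :=
  Un_cv (fun m => edist n l (zs m)) 0.

Lemma tends_to_cont n F f zs l :
  cont_on n F f -> (forall m, F (zs m)) -> F l -> tends_to n zs l ->
  Un_cv (fun m => f (zs m)) (f l).
Proof.
  intros Hf Hz Hl Ht eps He. destruct (Hf l Hl eps He) as [d [Hd H]].
  destruct (Ht d Hd) as [N HN]. exists N. intros m Hm.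
  apply H; auto. specialize (HN m Hm). unfold Rdist in HN.
  rewrite Rminus_0_r, Rabs_right in HN; auto. apply Rle_ge, edist_nonneg.
Qed.

(** Subsequences are only required to satisfy [m <= phi m], not to be increasing. This preserves
    limits and allows each [phi m] to be picked independently by choice. *)
Lemma Un_cv_reindex u l phi :
  Un_cv u l -> (forall m, (m <= phi m)%nat) -> Un_cv (fun m => u (phi m)) l.
Proof.
  intros H Hp eps He. destruct (H eps He) as [N HN]. exists N. intros m Hm.
  apply HN. specialize (Hp m). lia.
Qed.

Lemma Un_cv_inv_S : Un_cv (fun m => / INR (S m)) 0.
Proof.
  intros eps He. destruct (archimed_cor1 eps He) as [N [HN HN0]]. exists N.
  intros m Hm. unfold Rdist. rewrite Rminus_0_r, Rabs_right.
  - eapply Rle_lt_trans; [|apply HN]. apply Rinv_le_contravar.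
    + apply lt_0_INR; auto.
    + apply le_INR; lia.
  - left; apply Rinv_0_lt_compat, lt_0_INR; lia.
Qed.

Lemma Un_cv_le_const u l c : Un_cv u l -> (forall m, u m <= c) -> l <= c.
Proof.
  intros Hu H. apply (@Rle_cv_lim u (fun _ => c) l c); auto.
  intros eps He. exists 0%nat. intros. unfold Rdist.
  unfold Rminus; rewrite Rplus_opp_r, Rabs_R0; auto.
Qed.

Lemma Un_cv_ge_const u l c : Un_cv u l -> (forall m, c <= u m) -> c <= l.
Proof.
  intros Hu H. apply (@Rle_cv_lim (fun _ => c) u c l); auto.
  intros eps He. exists 0%nat. intros. unfold Rdist.
  unfold Rminus; rewrite Rplus_opp_r, Rabs_R0; auto.
Qed.

Lemma bounded_subseq_R (u : nat -> R) M :
  (forall m, Rabs (u m) <= M) ->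
  exists phi l, (forall m, (m <= phi m)%nat) /\ Un_cv (fun m => u (phi m)) l.
Proof.
  intros H.
  destruct (Bolzano_Weierstrass u (fun c => - M <= c <= M) (compact_P3 (- M) M)) as [l Hl].
  { intros m. specialize (H m). pose proof (Rle_abs (u m)). pose proof (Rle_abs (- u m)). rewrite Rabs_Ropp in *. lra. }
  assert (E : forall m, exists p, (m <= p)%nat /\ Rabs (u p - l) < / INR (S m)).
  { intros m. assert (Hp : 0 < / INR (S m)) by (apply Rinv_0_lt_compat, lt_0_INR; lia).
    destruct (Hl (disc l (mkposreal _ Hp)) m) as [p [Hp1 Hp2]].
    - exists (mkposreal _ Hp). intros x Hx; exact Hx.
    - exists p; split; auto. }
  exists (fun m => proj1_sig (constructive_indefinite_description _ (E m))), l.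
  split.
  - intros m. apply (proj2_sig (constructive_indefinite_description _ (E m))).
  - intros eps He. destruct (Un_cv_inv_S eps He) as [N HN]. exists N. intros m Hm.
    pose proof (proj2 (proj2_sig (constructive_indefinite_description _ (E m)))) as Hp.
    cbv beta in Hp. unfold Rdist. specialize (HN m Hm). unfold Rdist in HN.
    rewrite Rminus_0_r, Rabs_right in HN; [lra|].
    left; apply Rinv_0_lt_compat, lt_0_INR; lia.
Qed.

Lemma bounded_subseq (X : nat -> nat -> R) k M :
  (forall m i, (i < k)%nat -> Rabs (X m i) <= M) ->
  exists phi (l : nat -> R), (forall m, (m <= phi m)%nat) /\
    forall i, (i < k)%nat -> Un_cv (fun m => X (phi m) i) (l i).
Proof.
  induction k as [|k IH]; intros H.
  - exists (fun m => m), (fun _ => 0). split; [auto|intros; lia].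
  - destruct IH as [phi [l [Hp Hl]]]; [auto|].
    destruct (bounded_subseq_R (fun m => X (phi m) k) M) as [psi [lk [Hs Hlk]]]; [auto|].
    exists (fun m => phi (psi m)), (fun i => if Nat.eqb i k then lk else l i). split.
    + intros m. specialize (Hp (psi m)). specialize (Hs m). lia.
    + intros i Hi. destruct (Nat.eqb_spec i k) as [->|Hik]; auto.
      apply (Un_cv_reindex (fun m => X (phi m) i)); auto. apply Hl. lia.
Qed.

Definition compact_set (n : nat) (F : pt -> Prop) : Prop :=
  forall zs : nat -> pt, (forall m, F (zs m)) ->
    exists phi l, (forall m, (m <= phi m)%nat) /\ F l /\ tends_to n (fun m => zs (phi m)) l.

Lemma Un_cv_coord_max n (zs : nat -> pt) l :
  (forall i, (i < 2 * n)%nat -> Un_cv (fun m => fst (zs m) i) (fst l i)) ->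
  Un_cv (fun m => snd (zs m)) (snd l) -> tends_to n zs l.
Proof.
  intros H1 H2 eps He.
  assert (HN : 0 < INR (2 * n + 1)) by (apply lt_0_INR; lia).
  set (c := eps / (2 * INR (2 * n + 1))).
  assert (Hc : 0 < c) by (apply Rdiv_lt_0_compat; lra).
  assert (Hk : forall k, (k <= 2 * n)%nat -> exists N, forall m, (N <= m)%nat ->
            forall i, (i < k)%nat -> Rabs (fst l i - fst (zs m) i) <= c).
  { induction k as [|k IH]; intros Hk.
    - exists 0%nat. intros; lia.
    - destruct IH as [N HN1]; [lia|]. destruct (H1 k ltac:(lia) c Hc) as [N' HN2].
      exists (Nat.max N N'). intros m Hm i Hi.
      destruct (Nat.eq_dec i k) as [->|].
      + rewrite Rabs_minus_sym. left. apply HN2. lia.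
      + apply HN1; lia. }
  destruct (Hk (2 * n)%nat) as [N HN1]; [lia|]. destruct (H2 c Hc) as [N' HN2].
  exists (Nat.max N N'). intros m Hm. unfold Rdist.
  rewrite Rminus_0_r, Rabs_right by (apply Rle_ge, edist_nonneg).
  apply Rle_lt_trans with (INR (2 * n + 1) * c).
  - apply edist_le; [lra| |].
    + intros; apply HN1; [lia|auto].
    + rewrite Rabs_minus_sym. left. apply HN2. lia.
  - unfold c. replace (INR (2 * n + 1) * (eps / (2 * INR (2 * n + 1)))) with (eps / 2) by (field; lra). lra.
Qed.

Lemma compact_of_closed_bounded n (F : pt -> Prop) M :
  (forall z, F z -> valid n z /\ (forall i, (i < 2 * n)%nat -> Rabs (fst z i) <= M) /\ Rabs (snd z) <= M) ->
  (forall zs l, (forall m, F (zs m)) -> valid n l -> tends_to n zs l -> F l) ->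
  compact_set n F.
Proof.
  intros HB HC zs Hz.
  set (X := fun m i => if Nat.ltb i (2 * n) then fst (zs m) i else snd (zs m)).
  destruct (bounded_subseq X (2 * n + 1) M) as [phi [l [Hp Hl]]].
  { intros m i Hi. destruct (HB _ (Hz m)) as [_ [H1 H2]]. unfold X.
    destruct (Nat.ltb_spec i (2 * n)); auto. }
  (* The coordinates from [2 * n] on are set to [0], so that the limit is a valid point. *)
  set (L := (fun i => if Nat.ltb i (2 * n) then l i else 0, l (2 * n)%nat) : pt).
  assert (HV : valid n L).
  { intros i Hi. unfold L; simpl fst. destruct (Nat.ltb_spec i (2 * n)); [lia|auto]. }
  assert (HT : tends_to n (fun m => zs (phi m)) L).
  { apply Un_cv_coord_max.
    - intros i Hi. unfold L; simpl fst. specialize (Hl i ltac:(lia)). unfold X in Hl.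
      destruct (Nat.ltb_spec i (2 * n)); [auto|lia].
    - unfold L; simpl snd. specialize (Hl (2 * n)%nat ltac:(lia)). unfold X in Hl.
      rewrite Nat.ltb_irrefl in Hl. auto. }
  exists phi, L. repeat split; auto. apply (HC (fun m => zs (phi m))); auto.
Qed.

Lemma hdist_limit_le n zs l p c :
  tends_to n zs l -> (forall m, hdist n p (zs m) <= c) -> hdist n p l <= c.
Proof.
  intros Ht H. apply (Un_cv_le_const (fun m => hdist n p (zs m))); auto.
  apply (tends_to_cont n (fun _ => True)); auto. apply cont_on_hdist.
Qed.

Lemma hdist_limit_ge n zs l p c :
  tends_to n zs l -> (forall m, c <= hdist n p (zs m)) -> c <= hdist n p l.
Proof.
  intros Ht H. apply (Un_cv_ge_const (fun m => hdist n p (zs m))); auto.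
  apply (tends_to_cont n (fun _ => True)); auto. apply cont_on_hdist.
Qed.

Lemma ball_coord_bound n p R0 :
  exists M, 0 <= M /\ forall z, hdist n p z <= R0 ->
    (forall i, (i < 2 * n)%nat -> Rabs (fst z i) <= M) /\ Rabs (snd z) <= M.
Proof.
  set (s := rsum (2 * n) (fun i => Rabs (Jx n (fst p) i))).
  set (a := rsum (2 * n) (fun i => Rabs (fst p i))).
  assert (0 <= s) by (apply rsum_nonneg; intros; apply Rabs_pos).
  assert (0 <= a) by (apply rsum_nonneg; intros; apply Rabs_pos).
  pose proof (Rabs_pos (snd p)) as Hp. pose proof (Rabs_pos R0) as HR.
  exists (a + Rabs (snd p) + Rabs R0 + Rabs R0 ^ 2 + 2 * s * Rabs R0).
  assert (0 <= s * Rabs R0) by nra.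
  split; [nra|]. intros z Hz.
  pose proof (hdist_nonneg n p z). rewrite (Rabs_right R0) in * by lra.
  split.
  - intros i Hi. pose proof (ydiff_abs_le n p z i Hi) as H3. unfold ydiff in H3.
    assert (Rabs (fst p i) <= a)
      by (apply (rsum_term_le (2 * n) (fun i => Rabs (fst p i))); auto; intros; apply Rabs_pos).
    replace (fst z i) with ((fst z i - fst p i) + fst p i) by ring.
    eapply Rle_trans; [apply Rabs_triang|]. nra.
  - pose proof (snd_abs_le n p z) as H3. fold s in H3.
    replace (snd z) with ((snd z - snd p) + snd p) by ring.
    eapply Rle_trans; [apply Rabs_triang|].
    assert (hdist n p z ^ 2 <= R0 ^ 2) by nra.
    assert (s * hdist n p z <= s * R0) by nra. nra.
Qed.

Definition cball (n : nat) (p : pt) (R0 : R) (z : pt) : Prop := valid n z /\ hdist n p z <= R0.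

(** The domain of the later comparison argument: open balls around the poles, where the barriers are
    singular, are cut out. *)
Lemma compact_cball_holes n p R0 h (E : list pt) :
  compact_set n (fun z => cball n p R0 z /\ forall q, In q E -> h <= hdist n q z).
Proof.
  destruct (ball_coord_bound n p R0) as [M [_ HM]].
  apply compact_of_closed_bounded with M.
  - intros z [[Hv Hz] _]. destruct (HM z Hz). auto.
  - intros zs l Hz Hv Ht. split; [split; auto|].
    + apply (hdist_limit_le n zs); auto. intros m; apply (Hz m).
    + intros q Hq. apply (hdist_limit_ge n zs); auto. intros m; apply (Hz m); auto.
Qed.

Lemma compact_cball n p R0 : compact_set n (cball n p R0).
Proof.
  intros zs Hz. destruct (compact_cball_holes n p R0 0 nil zs) as [phi [l [H1 [H2 H3]]]].
  - intros m; split; [apply Hz|intros q []].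
  - exists phi, l. tauto.
Qed.

(** Composing with [atan] gives a bounded function with the same order, so a minimising sequence
    exists before [f] is known to be bounded below. *)
Lemma compact_attains_min n F f :
  compact_set n F -> cont_on n F f -> (exists z, F z) ->
  exists z, F z /\ forall w, F w -> f z <= f w.
Proof.
  intros HF Hf [z0 Hz0].
  set (E := fun y => exists z, F z /\ y = - atan (f z)).
  assert (HE : bound E).
  { exists (PI / 2). intros y [z [_ ->]]. pose proof (atan_bound (f z)). lra. }
  destruct (completeness E HE) as [L [HL1 HL2]].
  { exists (- atan (f z0)), z0; auto. }
  assert (Hs : forall m, exists z, F z /\ L - / INR (S m) <= - atan (f z)).
  { intros m. apply NNPP. intros Hn.
    assert (0 < / INR (S m)) by (apply Rinv_0_lt_compat, lt_0_INR; lia).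
    assert (L <= L - / INR (S m)); [|lra].
    apply HL2. intros y [z [Fz ->]]. apply Rnot_lt_le. intros Hlt.
    apply Hn. exists z; split; auto; lra. }
  set (zs := fun m => proj1_sig (constructive_indefinite_description _ (Hs m))).
  assert (Hzs : forall m, F (zs m) /\ L - / INR (S m) <= - atan (f (zs m))).
  { intros m. apply (proj2_sig (constructive_indefinite_description _ (Hs m))). }
  destruct (HF zs) as [phi [l [Hp [Fl Ht]]]]; [intros; apply Hzs|].
  exists l; split; auto. intros w Fw.
  apply Rnot_lt_le. intros Hlt. apply atan_increasing in Hlt.
  assert (H1 : - atan (f w) <= L) by (apply HL1; exists w; auto).
  assert (H2 : L <= - atan (f l)); [|lra].
  assert (Hc : Un_cv (fun m => - atan (f (zs (phi m))) + / INR (S (phi m))) (- atan (f l) + 0)).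
  { apply CV_plus.
    - apply (tends_to_cont n F (fun z => - atan (f z)) (fun m => zs (phi m))); auto.
      + apply (cont_on_comp n F f (fun x => - atan x)); auto.
        intros z _. apply continuity_pt_opp, derivable_continuous_pt, derivable_pt_atan.
      + intros; apply Hzs.
    - apply (Un_cv_reindex _ 0 phi Un_cv_inv_S); auto. }
  rewrite Rplus_0_r in Hc.
  apply (Un_cv_ge_const _ _ _ Hc). intros m. destruct (Hzs (phi m)). lra.
Qed.

Lemma Rabs_le_0 x : Rabs x <= 0 -> x = 0.
Proof. intros H. destruct (Req_dec x 0); auto. pose proof (Rabs_pos_lt x). lra. Qed.

(** The step is measured in the gauge distance because [h0] will bound the spacing of a lattice
    whose points are surrounded by gauge balls. *)
Lemma unif_cont_cball n p R0 f eps :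
  cont_on n (cball n p R0) f -> 0 < eps ->
  exists h0, 0 < h0 /\ forall z w, cball n p R0 z -> cball n p R0 w ->
    hdist n z w <= h0 -> Rabs (f w - f z) < eps.
Proof.
  intros Hf He. apply NNPP. intros Hn.
  assert (Hs : forall m, exists zw, (cball n p R0 (fst zw) /\ cball n p R0 (snd zw)) /\
     hdist n (fst zw) (snd zw) <= / INR (S m) /\ eps <= Rabs (f (snd zw) - f (fst zw))).
  { intros m. apply NNPP. intros Hm. apply Hn. exists (/ INR (S m)).
    split; [apply Rinv_0_lt_compat, lt_0_INR; lia|]. intros z w Hz Hw Hd.
    apply Rnot_le_lt. intros Hle. apply Hm. exists (z, w). auto. }
  set (zw := fun m => proj1_sig (constructive_indefinite_description _ (Hs m))).
  assert (Hzw : forall m, (cball n p R0 (fst (zw m)) /\ cball n p R0 (snd (zw m))) /\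
     hdist n (fst (zw m)) (snd (zw m)) <= / INR (S m) /\
     eps <= Rabs (f (snd (zw m)) - f (fst (zw m)))).
  { intros m. apply (proj2_sig (constructive_indefinite_description _ (Hs m))). }
  clearbody zw. clear Hs Hn.
  destruct (compact_cball n p R0 (fun m => fst (zw m))) as [phi [l [Hp [Fl Ht]]]];
    [intros; apply Hzw|].
  destruct (compact_cball n p R0 (fun m => snd (zw (phi m)))) as [psi [l' [Hp' [Fl' Ht']]]];
    [intros; apply Hzw|].
  assert (Hpp : forall m, (m <= phi (psi m))%nat)
    by (intros m; specialize (Hp (psi m)); specialize (Hp' m); lia).
  assert (Ht2 : tends_to n (fun m => fst (zw (phi (psi m)))) l)
    by (apply (Un_cv_reindex _ _ psi Ht); auto).
  assert (Hd : hdist n l l' <= 0).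
  { assert (Hc : Un_cv (fun m => hdist n l (fst (zw (phi (psi m)))) + / INR (S (phi (psi m)))) (0 + 0)).
    { apply CV_plus.
      - rewrite <- (hdist_self n l) at 1.
        apply (tends_to_cont n (fun _ => True) (hdist n l) (fun m => fst (zw (phi (psi m))))); auto.
        apply cont_on_hdist.
      - apply (Un_cv_reindex _ 0 (fun m => phi (psi m)) Un_cv_inv_S); auto. }
    rewrite Rplus_0_r in Hc.
    apply (@Rle_cv_lim (fun m => hdist n l (snd (zw (phi (psi m))))) _ _ _ ) with (2 := ltac:(
       apply (tends_to_cont n (fun _ => True) (hdist n l) (fun m => snd (zw (phi (psi m)))) l');
       [apply cont_on_hdist|auto|auto|exact Ht'])) (3 := Hc).
    intros m. eapply Rle_trans; [apply (hdist_triangle n l (fst (zw (phi (psi m)))))|].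
    apply Rplus_le_compat_l. apply Hzw. }
  (* Gauge distance [0] forces equality only among valid points, since [hdist] does not see the
     coordinates from [2 * n] on. *)
  assert (E : l = l').
  { destruct l as [x t], l' as [x' t']. f_equal.
    - apply functional_extensionality. intros i.
      destruct (Nat.lt_ge_cases i (2 * n)) as [Hi|Hi].
      + pose proof (ydiff_abs_le n (x, t) (x', t') i Hi) as H. unfold ydiff in H; simpl in H.
        pose proof (Rabs_pos (x' i - x i)).
        apply Rminus_diag_uniq_sym. apply Rabs_le_0. lra.
      + destruct Fl as [V _], Fl' as [V' _]. specialize (V i Hi). specialize (V' i Hi).
        simpl in *. congruence.
    - pose proof (snd_abs_le n (x, t) (x', t')) as H.
      replace (hdist n (x, t) (x', t')) with 0 in H
        by (pose proof (hdist_nonneg n (x, t) (x', t')); lra).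
      simpl snd in H. pose proof (Rabs_pos (t' - t)).
      apply Rminus_diag_uniq_sym. apply Rabs_le_0. simpl in H. nra. }
  subst l'.
  assert (H1 : Un_cv (fun m => f (snd (zw (phi (psi m)))) - f (fst (zw (phi (psi m))))) (f l - f l)).
  { apply CV_minus.
    - apply (tends_to_cont n (cball n p R0) f (fun m => snd (zw (phi (psi m))))); auto.
      intros; apply Hzw.
    - apply (tends_to_cont n (cball n p R0) f (fun m => fst (zw (phi (psi m))))); auto.
      intros; apply Hzw. }
  unfold Rminus in H1 at 2. rewrite Rplus_opp_r in H1.
  destruct (H1 eps He) as [N HN]. specialize (HN N ltac:(lia)). unfold Rdist in HN.
  rewrite Rminus_0_r in HN. destruct (Hzw (phi (psi N))) as [_ [_ H]]. lra.
Qed.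

(** * Derivatives along straight lines *)

Lemma derivable_pt_lim_ext f g x l :
  (forall s, f s = g s) -> derivable_pt_lim f x l -> derivable_pt_lim g x l.
Proof.
  intros H Hf eps He. destruct (Hf eps He) as [d Hd]. exists d. intros.
  rewrite <- !H; auto.
Qed.

Lemma derivable_pt_lim_recenter f x l :
  derivable_pt_lim (fun h => f (x + h)) 0 l -> derivable_pt_lim f x l.
Proof.
  intros Hf eps He. destruct (Hf eps He) as [d Hd]. exists d. intros h Hh Hhd.
  specialize (Hd h Hh Hhd). rewrite Rplus_0_l, Rplus_0_r in Hd. auto.
Qed.

Lemma MVT_from_0 g g' x :
  (forall c, Rabs c <= Rabs x -> derivable_pt_lim g c (g' c)) ->
  exists c, Rabs c <= Rabs x /\ g x - g 0 = g' c * x.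
Proof.
  intros H. destruct (Rtotal_order x 0) as [Hx|[->|Hx]].
  - destruct (MVT_cor2 g g' x 0) as [c [Hc1 Hc2]]; auto.
    + intros c Hc. apply H. rewrite !Rabs_left1; lra.
    + exists c. split; [rewrite !Rabs_left1; lra|]. lra.
  - exists 0. split; [lra|]. ring.
  - destruct (MVT_cor2 g g' 0 x) as [c [Hc1 Hc2]]; auto.
    + intros c Hc. apply H. rewrite !Rabs_right; lra.
    + exists c. split; [rewrite !Rabs_right; lra|]. lra.
Qed.

(** Moves only the coordinates of index below [k], index [2 * n] standing for [t]. Letting [k] grow
    gives a staircase of coordinate steps from [z] to [line n z v s]. *)
Definition pmove (n : nat) (z : pt) (v : nat -> R) (k : nat) (s : R) : pt :=
  (fun i => if andb (Nat.ltb i k) (Nat.ltb i (2 * n)) then fst z i + s * v i else fst z i,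
   if Nat.ltb (2 * n) k then snd z + s * v (2 * n)%nat else snd z).

Definition line (n : nat) (z : pt) (v : nat -> R) (s : R) : pt := pmove n z v (S (2 * n)) s.

Lemma line_fst n z v s i : (i < 2 * n)%nat -> fst (line n z v s) i = fst z i + s * v i.
Proof.
  intros Hi. unfold line, pmove; cbn [fst].
  destruct (Nat.ltb_spec i (S (2 * n))); [|lia].
  destruct (Nat.ltb_spec i (2 * n)); [reflexivity|lia].
Qed.

Lemma line_snd n z v s : snd (line n z v s) = snd z + s * v (2 * n)%nat.
Proof.
  unfold line, pmove; cbn [snd].
  destruct (Nat.ltb_spec (2 * n) (S (2 * n))); [reflexivity|lia].
Qed.

Lemma line_fst_out n z v s i : (2 * n <= i)%nat -> fst (line n z v s) i = fst z i.
Proof.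
  intros Hi. unfold line, pmove; cbn [fst].
  destruct (Nat.ltb_spec i (2 * n)); [lia|]. rewrite Bool.andb_false_r. reflexivity.
Qed.

Lemma valid_line n z v s : valid n z -> valid n (line n z v s).
Proof. intros H i Hi. rewrite line_fst_out; auto. Qed.

Lemma pmove_0 n z v s : pmove n z v 0 s = z.
Proof. destruct z; reflexivity. Qed.

Lemma line_0 n z v : line n z v 0 = z.
Proof.
  destruct z as [x t]. unfold line, pmove; cbn [fst snd].
  f_equal; [apply functional_extensionality; intros i|].
  - destruct (andb _ _); ring.
  - destruct (Nat.ltb _ _); ring.
Qed.

Lemma line_line n z v s h : line n (line n z v s) v h = line n z v (s + h).
Proof.
  unfold line, pmove; cbn [fst snd].
  f_equal; [apply functional_extensionality; intros i|].
  - destruct (andb _ _); ring.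
  - destruct (Nat.ltb _ _); ring.
Qed.

Lemma pmove_S n z v k s :
  (k <= 2 * n)%nat -> pmove n z v (S k) s = shift n (pmove n z v k s) k (s * v k).
Proof.
  intros Hk. unfold shift.
  destruct (Nat.ltb_spec k (2 * n)) as [Hk'|Hk']; unfold pmove; cbn [fst snd];
    (f_equal; [apply functional_extensionality; intros i|]);
    repeat match goal with |- context [Nat.ltb ?a ?b] => destruct (Nat.ltb_spec a b) end;
    repeat match goal with |- context [Nat.eqb ?a ?b] => destruct (Nat.eqb_spec a b) end;
    simpl; subst; try lia; try reflexivity.
  f_equal. f_equal. f_equal. lia.
Qed.

Lemma shift_shift n z a h h' : shift n (shift n z a h) a h' = shift n z a (h + h').
Proof.
  unfold shift. destruct (Nat.ltb a (2 * n)); cbn [fst snd]; f_equal; try ring.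
  apply functional_extensionality; intros i. destruct (Nat.eqb i a); ring.
Qed.

Lemma shift_0 n z a : shift n z a 0 = z.
Proof.
  destruct z as [x t]. unfold shift. destruct (Nat.ltb a (2 * n)); cbn [fst snd]; f_equal; try ring.
  apply functional_extensionality; intros i. destruct (Nat.eqb i a); ring.
Qed.

Lemma valid_shift_pmove n z v k s a h :
  (a <= 2 * n)%nat -> valid n z -> valid n (shift n (pmove n z v k s) a h).
Proof.
  intros Ha Hz i Hi. unfold shift.
  destruct (Nat.ltb_spec a (2 * n)); unfold pmove; cbn [fst snd];
  repeat match goal with |- context [Nat.ltb ?a ?b] => destruct (Nat.ltb_spec a b) end;
    repeat match goal with |- context [Nat.eqb ?a ?b] => destruct (Nat.eqb_spec a b) end;
  simpl; try lia; apply Hz; auto.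
Qed.

Lemma edist_shift_pmove n z v k s c V :
  (forall i, (i <= 2 * n)%nat -> Rabs (v i) <= V) -> (k <= 2 * n)%nat ->
  Rabs c <= Rabs (s * v k) ->
  edist n z (shift n (pmove n z v k s) k c) <= INR (2 * n + 1) * (V * Rabs s).
Proof.
  intros HV Hk Hc.
  assert (Hs : forall i, (i <= 2 * n)%nat -> Rabs (s * v i) <= V * Rabs s).
  { intros i Hi. rewrite Rabs_mult, Rmult_comm. apply Rmult_le_compat_r; [apply Rabs_pos|auto]. }
  assert (H0 : 0 <= V * Rabs s).
  { eapply Rle_trans; [apply Rabs_pos|apply (Hs k Hk)]. }
  assert (Hd : forall x, Rabs (x - x) <= V * Rabs s).
  { intros x. unfold Rminus. rewrite Rplus_opp_r, Rabs_R0; auto. }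
  assert (Hd2 : forall x y, Rabs y <= V * Rabs s -> Rabs (x - (x + y)) <= V * Rabs s).
  { intros x y Hy. replace (x - (x + y)) with (- y) by ring. rewrite Rabs_Ropp; auto. }
  assert (Hck : Rabs c <= V * Rabs s) by (eapply Rle_trans; [apply Hc|auto]).
  apply edist_le; auto.
  - intros i Hi. unfold shift. destruct (Nat.ltb_spec k (2 * n)); unfold pmove; cbn [fst snd];
    repeat match goal with |- context [Nat.ltb ?a ?b] => destruct (Nat.ltb_spec a b) end;
    repeat match goal with |- context [Nat.eqb ?a ?b] => destruct (Nat.eqb_spec a b) end;
    simpl; try lia; auto; apply Hd2; auto; apply Hs; lia.
  - unfold shift. destruct (Nat.ltb_spec k (2 * n)); unfold pmove; cbn [fst snd];
    repeat match goal with |- context [Nat.ltb ?a ?b] => destruct (Nat.ltb_spec a b) end;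
    try lia; auto.
Qed.

(** Continuous partial derivatives give differentiability: the increment is split along the
    staircase [pmove], and the mean value theorem is applied on each coordinate step. *)
Lemma derive_line_at_0 n Om f Df z v :
  is_open n Om ->
  (forall w, Om w -> forall a, (a <= 2 * n)%nat -> partial_lim n f w a (Df a w)) ->
  (forall a, (a <= 2 * n)%nat -> cont_on n Om (Df a)) -> Om z ->
  derivable_pt_lim (fun s => f (line n z v s)) 0 (rsum (S (2 * n)) (fun a => v a * Df a z)).
Proof.
  intros [HOv HO] Hf HDf Hz.
  set (V := rsum (S (2 * n)) (fun i => Rabs (v i))).
  assert (HV : forall i, (i <= 2 * n)%nat -> Rabs (v i) <= V).
  { intros i Hi. apply (rsum_term_le _ (fun i => Rabs (v i))); [intros; apply Rabs_pos|lia]. }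
  assert (HV0 : 0 <= V) by (eapply Rle_trans; [apply Rabs_pos|apply (HV 0%nat); lia]).
  (* Every point of the staircase at parameter [s] lies within [C * Rabs s] of [z]; the [+ 1] keeps
     [C] positive when [v] vanishes. *)
  set (C := INR (2 * n + 1) * V + 1).
  assert (HC : 0 < C) by (unfold C; pose proof (pos_INR (2 * n + 1)); nra).
  assert (Hclaim : forall k, (k <= S (2 * n))%nat -> forall eps, 0 < eps ->
    exists d, 0 < d /\ forall s, Rabs s < d ->
      Rabs (f (pmove n z v k s) - f z - s * rsum k (fun a => v a * Df a z)) <= eps * Rabs s).
  { induction k as [|k IH]; intros Hk eps He.
    - exists 1. split; [lra|]. intros s _. rewrite pmove_0. simpl.
      replace (f z - f z - s * 0) with 0 by ring. rewrite Rabs_R0.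
      apply Rmult_le_pos; [lra|apply Rabs_pos].
    - destruct (IH ltac:(lia) (eps / 2) ltac:(lra)) as [d1 [Hd1 H1]].
      pose proof (Rabs_pos (v k)) as Hvk.
      destruct (HDf k ltac:(lia) z Hz (eps / (2 * (Rabs (v k) + 1)))) as [d2 [Hd2 H2]].
      { apply Rdiv_lt_0_compat; lra. }
      destruct (HO z Hz) as [d3 [Hd3 H3]].
      exists (Rmin d1 (Rmin (d2 / C) (d3 / C))). split.
      { repeat apply Rmin_pos; auto; apply Rdiv_lt_0_compat; auto. }
      intros s Hs.
      assert (Hs1 : Rabs s < d1) by (eapply Rlt_le_trans; [apply Hs|apply Rmin_l]).
      assert (Hs2 : Rabs s * C < d2).
      { apply (Rmult_lt_reg_r (/ C)); [apply Rinv_0_lt_compat; auto|].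
        rewrite Rmult_assoc, Rinv_r, Rmult_1_r by lra.
        eapply Rlt_le_trans; [apply Hs|]. eapply Rle_trans; [apply Rmin_r|apply Rmin_l]. }
      assert (Hs3 : Rabs s * C < d3).
      { apply (Rmult_lt_reg_r (/ C)); [apply Rinv_0_lt_compat; auto|].
        rewrite Rmult_assoc, Rinv_r, Rmult_1_r by lra.
        eapply Rlt_le_trans; [apply Hs|]. eapply Rle_trans; [apply Rmin_r|apply Rmin_r]. }
      assert (Hin : forall c, Rabs c <= Rabs (s * v k) ->
                edist n z (shift n (pmove n z v k s) k c) <= Rabs s * C).
      { intros c Hc. eapply Rle_trans; [apply (edist_shift_pmove n z v k s c V); auto; lia|].
        unfold C. pose proof (Rabs_pos s). pose proof (pos_INR (2 * n + 1)). nra. }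
      assert (HOm : forall c, Rabs c <= Rabs (s * v k) -> Om (shift n (pmove n z v k s) k c)).
      { intros c Hc. apply H3.
        - apply valid_shift_pmove; [lia|apply HOv; auto].
        - eapply Rle_lt_trans; [apply Hin|]; auto. }
      destruct (MVT_from_0 (fun c => f (shift n (pmove n z v k s) k c))
                  (fun c => Df k (shift n (pmove n z v k s) k c)) (s * v k)) as [c [Hc1 Hc2]].
      { intros c Hc. apply derivable_pt_lim_recenter.
        apply derivable_pt_lim_ext with (fun h => f (shift n (shift n (pmove n z v k s) k c) k h)).
        - intros; now rewrite shift_shift.
        - apply Hf; [auto|lia]. }
      rewrite shift_0 in Hc2. rewrite pmove_S by lia. simpl rsum.
      replace (f (shift n (pmove n z v k s) k (s * v k)) - f z
               - s * (rsum k (fun a => v a * Df a z) + v k * Df k z))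
        with ((f (pmove n z v k s) - f z - s * rsum k (fun a => v a * Df a z))
              + (Df k (shift n (pmove n z v k s) k c) - Df k z) * (s * v k)) by lra.
      eapply Rle_trans; [apply Rabs_triang|].
      assert (H4 : Rabs (Df k (shift n (pmove n z v k s) k c) - Df k z)
                   < eps / (2 * (Rabs (v k) + 1))).
      { apply H2; auto. eapply Rle_lt_trans; [apply Hin|]; auto. }
      rewrite (Rabs_mult (Df k _ - _)), (Rabs_mult s).
      specialize (H1 s Hs1). pose proof (Rabs_pos s).
      assert (Rabs (Df k (shift n (pmove n z v k s) k c) - Df k z) * (Rabs s * Rabs (v k))
              <= eps / (2 * (Rabs (v k) + 1)) * (Rabs s * (Rabs (v k) + 1))).
      { apply Rmult_le_compat; try apply Rabs_pos; try lra; nra. }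
      replace (eps / (2 * (Rabs (v k) + 1)) * (Rabs s * (Rabs (v k) + 1)))
        with (eps / 2 * Rabs s) in H0 by (field; lra).
      lra. }
  intros eps He. destruct (Hclaim (S (2 * n)) ltac:(lia) (eps / 2) ltac:(lra)) as [d [Hd H]].
  exists (mkposreal d Hd). intros h Hh Hhd. simpl in Hhd.
  specialize (H h Hhd). rewrite Rplus_0_l, line_0. unfold line.
  set (L := rsum (S (2 * n)) (fun a => v a * Df a z)) in *.
  replace ((f (pmove n z v (S (2 * n)) h) - f z) / h - L)
    with ((f (pmove n z v (S (2 * n)) h) - f z - h * L) / h) by (field; auto).
  unfold Rdiv. rewrite Rabs_mult, Rabs_inv. pose proof (Rabs_pos_lt h Hh).
  apply Rle_lt_trans with (eps / 2 * Rabs h * / Rabs h).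
  - apply Rmult_le_compat_r; auto. left; apply Rinv_0_lt_compat; auto.
  - rewrite Rmult_assoc, Rinv_r by lra. lra.
Qed.

Lemma derive_line n Om f Df z v s :
  is_open n Om ->
  (forall w, Om w -> forall a, (a <= 2 * n)%nat -> partial_lim n f w a (Df a w)) ->
  (forall a, (a <= 2 * n)%nat -> cont_on n Om (Df a)) -> Om (line n z v s) ->
  derivable_pt_lim (fun s => f (line n z v s)) s
    (rsum (S (2 * n)) (fun a => v a * Df a (line n z v s))).
Proof.
  intros HO Hf HDf Hz. apply derivable_pt_lim_recenter.
  apply derivable_pt_lim_ext with (fun h => f (line n (line n z v s) v h)).
  - intros; now rewrite line_line.
  - eapply derive_line_at_0; eauto.
Qed.

(** First derivative near [0], second derivative at [0] only: the barrier is smooth only where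
    [barf] is positive and [u] is differentiable only inside [Om], so a line can be followed only
    for a short time. *)
Definition second_deriv (g : R -> R) (g2 : R) : Prop :=
  exists d g1, 0 < d /\ (forall s, Rabs s < d -> derivable_pt_lim g s (g1 s)) /\
    derivable_pt_lim g1 0 g2.

Lemma second_deriv_ext f g l :
  (forall s, f s = g s) -> second_deriv f l -> second_deriv g l.
Proof.
  intros H [d [g1 [Hd [H1 H2]]]]. exists d, g1. repeat split; auto.
  intros. apply derivable_pt_lim_ext with f; auto.
Qed.

Lemma second_deriv_const c : second_deriv (fun _ => c) 0.
Proof.
  exists 1, (fun _ => 0). split; [lra|]. split; intros; apply derivable_pt_lim_const.
Qed.

Lemma second_deriv_plus f g a b :
  second_deriv f a -> second_deriv g b -> second_deriv (fun s => f s + g s) (a + b).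
Proof.
  intros [d [f1 [Hd [H1 H2]]]] [d' [g1 [Hd' [H1' H2']]]].
  exists (Rmin d d'), (fun s => f1 s + g1 s). split; [apply Rmin_pos; auto|]. split.
  - intros s Hs. apply derivable_pt_lim_plus; [apply H1|apply H1'];
      (eapply Rlt_le_trans; [apply Hs|]); [apply Rmin_l|apply Rmin_r].
  - apply derivable_pt_lim_plus; auto.
Qed.

Lemma second_deriv_scal c f a : second_deriv f a -> second_deriv (fun s => c * f s) (c * a).
Proof.
  intros [d [f1 [Hd [H1 H2]]]]. exists d, (fun s => c * f1 s). split; auto. split.
  - intros s Hs. apply derivable_pt_lim_scal; auto.
  - apply derivable_pt_lim_scal; auto.
Qed.

(** If [g2 < 0], then [g1], which vanishes at the minimum, is negative just to the right of [0], and
    [g] would fall below [g 0] there. *)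
Lemma second_deriv_min g g2 d :
  second_deriv g g2 -> 0 < d -> (forall s, Rabs s < d -> g 0 <= g s) -> 0 <= g2.
Proof.
  intros [d' [g1 [Hd' [H1 H2]]]] Hd Hmin.
  assert (Hg1 : g1 0 = 0).
  { assert (D : derivable_pt_lim g 0 (g1 0)) by (apply H1; rewrite Rabs_R0; auto).
    apply (deriv_minimum g (- d) d 0 (exist _ _ D)); try lra.
    intros x Hx1 Hx2. apply Hmin. apply Rabs_def1; lra. }
  apply Rnot_lt_le. intros Hneg.
  destruct (H2 (- g2)) as [d2 Hd2]; [lra|].
  set (s := Rmin (Rmin d d') d2 / 2).
  pose proof (cond_pos d2) as Hp2.
  assert (Hm1 : Rmin (Rmin d d') d2 <= d2) by apply Rmin_r.
  assert (Hm2 : Rmin (Rmin d d') d2 <= d) by (eapply Rle_trans; [apply Rmin_l|apply Rmin_l]).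
  assert (Hm3 : Rmin (Rmin d d') d2 <= d') by (eapply Rle_trans; [apply Rmin_l|apply Rmin_r]).
  assert (Hm : 0 < Rmin (Rmin d d') d2) by (repeat apply Rmin_pos; auto).
  destruct (MVT_cor2 g g1 0 s) as [c [Hc1 Hc2]].
  - unfold s; lra.
  - intros c Hc. apply H1. rewrite Rabs_right; unfold s in *; lra.
  - assert (Hc : g1 c < 0).
    { assert (Hc0 : c <> 0) by lra.
      assert (Hcd : Rabs c < d2) by (rewrite Rabs_right; unfold s in *; lra).
      specialize (Hd2 c Hc0 Hcd). rewrite Rplus_0_l, Hg1, Rminus_0_r in Hd2.
      apply Rabs_def2 in Hd2.
      assert (Hq : g1 c / c < 0) by lra.
      replace (g1 c) with (g1 c / c * c) by (field; lra). nra. }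
    assert (Hs : g 0 <= g s) by (apply Hmin; rewrite Rabs_right; unfold s; lra).
    nra.
Qed.

Lemma second_deriv_Rpower F F1 F2 a :
  (forall s, derivable_pt_lim F s (F1 s)) -> derivable_pt_lim F1 0 F2 -> 0 < F 0 ->
  second_deriv (fun s => Rpower (F s) (- a))
    (- a * F2 * Rpower (F 0) (- a - 1) + a * (a + 1) * F1 0 ^ 2 * Rpower (F 0) (- a - 2)).
Proof.
  intros HF HF1 H0.
  assert (HFc : continuity_pt F 0).
  { apply derivable_continuous_pt. exists (F1 0). apply HF. }
  destruct (HFc (F 0) H0) as [d [Hd Hpos]].
  assert (Hp : forall s, Rabs s < d -> 0 < F s).
  { intros s Hs. destruct (Req_dec s 0) as [->|Hs0]; auto.
    assert (H : Rabs (F s - F 0) < F 0).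
    { apply (Hpos s). split; [split; [exact I|auto]|]. simpl. unfold Rdist.
      rewrite Rminus_0_r; auto. }
    apply Rabs_def2 in H. lra. }
  exists d, (fun s => (- a * F1 s) * Rpower (F s) (- a - 1)). split; auto. split.
  - intros s Hs.
    replace (- a * F1 s * Rpower (F s) (- a - 1)) with (- a * Rpower (F s) (- a - 1) * F1 s) by ring.
    apply (derivable_pt_lim_comp F (fun x => Rpower x (- a))); auto.
    apply derivable_pt_lim_power; auto.
  - replace (- a * F2 * Rpower (F 0) (- a - 1) + a * (a + 1) * F1 0 ^ 2 * Rpower (F 0) (- a - 2))
      with (- a * F2 * Rpower (F 0) (- a - 1)
            + - a * F1 0 * ((- a - 1) * Rpower (F 0) (- a - 1 - 1) * F1 0)).
    + apply (derivable_pt_lim_mult (fun s => - a * F1 s) (fun s => Rpower (F s) (- a - 1))).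
      * apply derivable_pt_lim_scal; auto.
      * apply (derivable_pt_lim_comp F (fun x => Rpower x (- a - 1))); auto.
        apply derivable_pt_lim_power; auto.
    + replace (- a - 1 - 1) with (- a - 2) by ring. ring.
Qed.

(* The direction at [z] of the horizontal vector field [sum_i xi_i X_i]. *)
Definition hdir (n : nat) (z : pt) (xi : nat -> R) (i : nat) : R :=
  if Nat.ltb i (2 * n) then xi i else 2 * dot (2 * n) (Jx n (fst z)) xi.

Lemma hdir_lt n z xi i : (i < 2 * n)%nat -> hdir n z xi i = xi i.
Proof. intros H. unfold hdir. destruct (Nat.ltb_spec i (2 * n)); [auto|lia]. Qed.

Lemma hdir_t n z xi : hdir n z xi (2 * n) = 2 * dot (2 * n) (Jx n (fst z)) xi.
Proof. unfold hdir. rewrite Nat.ltb_irrefl. auto. Qed.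

(** The commutator term [2 * Jm n j i * Du tI z] of [X_i X_j u] is antisymmetric in [i, j] and drops
    out of the quadratic form. What remains is the ordinary Hessian in the direction [hdir]. *)
Lemma qform_XXu n Du D2u z xi :
  qform (2 * n) (fun i j => XXu n Du D2u i j z) xi
  = qform (S (2 * n)) (fun a b => D2u a b z) (hdir n z xi).
Proof.
  rewrite qform_S, hdir_t.
  rewrite (qform_ext _ _ (fun a b => D2u a b z) (hdir n z xi) xi); [|auto|apply hdir_lt].
  rewrite (rsum_ext _ _ (fun i => (D2u i (2 * n)%nat z + D2u (2 * n)%nat i z) * xi i)).
  2:{ intros. rewrite hdir_lt; auto. }
  set (t := (2 * n)%nat).
  set (Jv := Jx n (fst z)). set (s := dot t Jv xi).
  assert (HJ : rsum t (fun i => rsum t (fun j => Jm n j i * xi i * xi j)) = 0).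
  { transitivity (dot t (Jx n xi) xi); [|apply dot_J_self].
    rewrite rsum_swap. unfold dot. apply rsum_ext; intros. unfold Jx.
    rewrite <- rsum_scal_r. apply rsum_ext; intros; ring. }
  assert (E1 : rsum t (fun i => rsum t (fun j => D2u i t z * xi i * (Jv j * xi j)))
               = rsum t (fun i => D2u i t z * xi i) * s).
  { rewrite <- rsum_scal_r. apply rsum_ext; intros. rewrite rsum_scal. reflexivity. }
  assert (E2 : rsum t (fun i => rsum t (fun j => (Jv i * xi i) * (D2u t j z * xi j)))
               = rsum t (fun i => D2u t i z * xi i) * s).
  { rewrite (Rmult_comm _ s). unfold s, dot. rewrite <- rsum_scal_r.
    apply rsum_ext; intros. rewrite rsum_scal. reflexivity. }
  assert (E3 : rsum t (fun i => rsum t (fun j => (Jv i * xi i) * (Jv j * xi j))) = s * s).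
  { unfold s at 1, dot. rewrite <- rsum_scal_r. apply rsum_ext; intros. rewrite rsum_scal. reflexivity. }
  replace (rsum t (fun i => (D2u i t z + D2u t i z) * xi i))
    with (rsum t (fun i => D2u i t z * xi i) + rsum t (fun i => D2u t i z * xi i))
    by (rewrite <- rsum_plus; apply rsum_ext; intros; ring).
  transitivity (qform t (fun a b => D2u a b z) xi
     + 2 * Du t z * rsum t (fun i => rsum t (fun j => Jm n j i * xi i * xi j))
     + 2 * rsum t (fun i => rsum t (fun j => D2u i t z * xi i * (Jv j * xi j)))
     + 2 * rsum t (fun i => rsum t (fun j => (Jv i * xi i) * (D2u t j z * xi j)))
     + 4 * D2u t t z * rsum t (fun i => rsum t (fun j => (Jv i * xi i) * (Jv j * xi j)))).
  - unfold qform. rewrite <- !rsum_scal, <- !rsum_plus. apply rsum_ext; intros.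
    rewrite <- !rsum_scal, <- !rsum_plus. apply rsum_ext; intros. unfold XXu. fold t Jv. ring.
  - rewrite HJ, E1, E2, E3. ring.
Qed.

Lemma line_in_open n Om z v :
  is_open n Om -> Om z -> exists d, 0 < d /\ forall s, Rabs s < d -> Om (line n z v s).
Proof.
  intros [HOv HO] Hz. destruct (HO z Hz) as [d [Hd H]].
  set (V := rsum (S (2 * n)) (fun i => Rabs (v i))).
  assert (HV : forall i, (i <= 2 * n)%nat -> Rabs (v i) <= V).
  { intros i Hi. apply (rsum_term_le _ (fun i => Rabs (v i))); [intros; apply Rabs_pos|lia]. }
  assert (HV0 : 0 <= V) by (eapply Rle_trans; [apply Rabs_pos|apply (HV 0%nat); lia]).
  set (C := INR (2 * n + 1) * V + 1).
  assert (HC : 0 < C) by (unfold C; pose proof (pos_INR (2 * n + 1)); nra).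
  exists (d / C). split; [apply Rdiv_lt_0_compat; auto|]. intros s Hs.
  apply H; [apply valid_line; auto|].
  apply Rle_lt_trans with (INR (2 * n + 1) * (V * Rabs s)).
  - unfold line. rewrite pmove_S by lia. apply edist_shift_pmove; auto. lra.
  - apply Rle_lt_trans with (C * Rabs s).
    + unfold C. pose proof (Rabs_pos s). pose proof (pos_INR (2 * n + 1)). nra.
    + apply (Rmult_lt_compat_l C) in Hs; auto.
      replace (C * (d / C)) with d in Hs by (field; lra). auto.
Qed.

(** Straight lines suffice: since [<J xi, xi> = 0], the vertical speed [2 <J x, xi>] is constant
    along the line, which is therefore an integral curve of [sum_i xi_i X_i]. Differentiating [u]
    twice along it gives the horizontal Hessian. *)
Lemma second_deriv_horizontal n Om u Du D2u z xi :
  is_open n Om -> C2_on n Om u Du D2u -> Om z ->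
  second_deriv (fun s => u (line n z (hdir n z xi) s))
    (qform (2 * n) (fun i j => XXu n Du D2u i j z) xi).
Proof.
  intros HO [HD [_ [HcD HcD2]]] Hz. set (v := hdir n z xi).
  destruct (line_in_open n Om z v HO Hz) as [d [Hd Hl]].
  exists d, (fun s => rsum (S (2 * n)) (fun a => v a * Du a (line n z v s))).
  split; auto. split.
  - intros s Hs. apply (derive_line n Om u Du); auto.
    intros w Hw a Ha. apply (HD w Hw a Ha).
  - rewrite qform_XXu. fold v. unfold qform.
    rewrite rsum_swap.
    assert (Hk : forall k, (k <= S (2 * n))%nat ->
      derivable_pt_lim (fun s => rsum k (fun a => v a * Du a (line n z v s))) 0
        (rsum k (fun b => rsum (S (2 * n)) (fun a => D2u a b z * v a * v b)))).
    { induction k as [|k IH]; intros Hk; cbn [rsum]; [apply derivable_pt_lim_const|].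
      apply derivable_pt_lim_plus; [apply IH; lia|].
      replace (rsum (2 * n) (fun a => D2u a k z * v a * v k) + D2u (2 * n)%nat k z * v (2 * n)%nat * v k)
        with (v k * rsum (S (2 * n)) (fun a => v a * D2u a k z)).
      - apply derivable_pt_lim_scal.
        apply (derive_line_at_0 n Om (Du k) (fun a => D2u a k)); auto.
        + intros w Hw a Ha. apply (HD w Hw a Ha). lia.
        + intros a Ha. apply HcD2; auto; lia.
      - cbn [rsum]. rewrite Rmult_plus_distr_l, <- rsum_scal.
        f_equal; [apply rsum_ext; intros|]; ring. }
    apply Hk; auto.
Qed.

(** * The barrier *)

(** This is [<G y, y>] for [G = J^t A0 J]. Evaluating [A0] at [J y] makes the ellipticity bounds
    immediate, as [J] is an isometry. *)
Definition qA (n : nat) (A0 : nat -> nat -> R) (y : nat -> R) : R := qform (2 * n) A0 (Jx n y).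

Definition Gmat (n : nat) (A0 : nat -> nat -> R) : nat -> nat -> R :=
  matmul (2 * n) (matmul (2 * n) (transp (Jm n)) A0) (Jm n).

Definition Gvec (n : nat) (A0 : nat -> nat -> R) (y : nat -> R) : nat -> R :=
  mvec (2 * n) (Gmat n A0) y.

Definition sym_on (k : nat) (M : nat -> nat -> R) : Prop :=
  forall i j, (i < k)%nat -> (j < k)%nat -> M i j = M j i.

(* [mvec A0 (Gvec y) = y] says that [J^t A0 J] is the inverse of [A0]. *)
Definition frozen_coef (n : nat) (lam Lam : R) (A0 : nat -> nat -> R) : Prop :=
  sym_on (2 * n) A0 /\
  (forall xi, lam * dot (2 * n) xi xi <= qform (2 * n) A0 xi <= Lam * dot (2 * n) xi xi) /\
  (forall y i, (i < 2 * n)%nat -> mvec (2 * n) A0 (Gvec n A0 y) i = y i).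

Lemma Gvec_eq n A0 y i :
  Gvec n A0 y i = mvec (2 * n) (transp (Jm n)) (mvec (2 * n) A0 (Jx n y)) i.
Proof. unfold Gvec, Gmat. rewrite !mvec_matmul. reflexivity. Qed.

Lemma dot_Gvec n A0 x y :
  dot (2 * n) x (Gvec n A0 y) = dot (2 * n) (Jx n x) (mvec (2 * n) A0 (Jx n y)).
Proof.
  rewrite (dot_ext _ x x (Gvec n A0 y)
             (mvec (2 * n) (transp (Jm n)) (mvec (2 * n) A0 (Jx n y))));
    [|auto|intros; apply Gvec_eq].
  rewrite mvec_transp. reflexivity.
Qed.

Lemma mvec_sym k A x y : sym_on k A -> dot k x (mvec k A y) = dot k (mvec k A x) y.
Proof.
  intros HA. rewrite mvec_transp. apply dot_ext; auto. intros i Hi.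
  apply rsum_ext; intros. unfold transp. rewrite HA; auto.
Qed.

Lemma qA_plus n A0 y xi s :
  sym_on (2 * n) A0 ->
  qA n A0 (fun i => y i + s * xi i)
  = qA n A0 y + 2 * s * dot (2 * n) (Gvec n A0 y) xi + s ^ 2 * qA n A0 xi.
Proof.
  intros HA. unfold qA. rewrite (dot_sym _ (Gvec n A0 y)), dot_Gvec, !qform_dot.
  rewrite (dot_ext _ (Jx n (fun i => y i + s * xi i)) (fun i => Jx n y i + s * Jx n xi i)
     (mvec _ A0 (Jx n (fun i => y i + s * xi i)))
     (fun i => mvec (2 * n) A0 (Jx n y) i + s * mvec (2 * n) A0 (Jx n xi) i)).
  - rewrite dot_plus_l, !dot_plus_r, !dot_scal_l, !dot_scal_r.
    change (dot (2 * n) (fun i => Jx n y i)) with (dot (2 * n) (Jx n y)).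
    change (dot (2 * n) (fun i => mvec (2 * n) A0 (Jx n y) i)) with (dot (2 * n) (mvec (2 * n) A0 (Jx n y))).
    rewrite (mvec_sym _ A0 (Jx n y) (Jx n xi) HA).
    rewrite (dot_sym _ (mvec (2 * n) A0 (Jx n y)) (Jx n xi)). ring.
  - intros. rewrite Jx_plus, Jx_scal. reflexivity.
  - intros. rewrite <- mvec_scal, <- mvec_plus. apply mvec_ext. intros.
    rewrite Jx_plus, Jx_scal. reflexivity.
Qed.

Lemma qA_ext n A0 x y : (forall i, (i < 2 * n)%nat -> x i = y i) -> qA n A0 x = qA n A0 y.
Proof. intros H. apply qform_ext; auto. intros. apply mvec_ext; auto. Qed.

Definition barf (n : nat) (A0 : nat -> nat -> R) (q z : pt) : R :=
  qA n A0 (ydiff q z) ^ 2 + tdiff n q z ^ 2.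

Definition alpha (n : nat) : R := INR (2 * n + 1) / 4.

Definition barrier (n : nat) (A0 : nat -> nat -> R) (q z : pt) : R :=
  Rpower (barf n A0 q z) (- alpha n).

(** The horizontal gradient of [barf]; [bhess] below is its symmetrised horizontal Hessian. Both are
    read off from the expansion of [barf] along horizontal lines. *)
Definition bgrad (n : nat) (A0 : nat -> nat -> R) (q z : pt) (i : nat) : R :=
  4 * qA n A0 (ydiff q z) * Gvec n A0 (ydiff q z) i + 4 * tdiff n q z * Jx n (ydiff q z) i.

Definition bhess (n : nat) (A0 : nat -> nat -> R) (q z : pt) (i j : nat) : R :=
  8 * (Gvec n A0 (ydiff q z) i * Gvec n A0 (ydiff q z) j)
  + (4 * qA n A0 (ydiff q z) * Gmat n A0 i j
     + 8 * (Jx n (ydiff q z) i * Jx n (ydiff q z) j)).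

Definition barrier_hess (n : nat) (A0 : nat -> nat -> R) (q z : pt) (i j : nat) : R :=
  - alpha n * Rpower (barf n A0 q z) (- alpha n - 1) * bhess n A0 q z i j
  + alpha n * (alpha n + 1) * Rpower (barf n A0 q z) (- alpha n - 2)
    * (bgrad n A0 q z i * bgrad n A0 q z j).

Lemma qform_plus k M N x : qform k (fun i j => M i j + N i j) x = qform k M x + qform k N x.
Proof.
  unfold qform. rewrite <- rsum_plus. apply rsum_ext; intros.
  rewrite <- rsum_plus. apply rsum_ext; intros; ring.
Qed.

Lemma qform_scal k c M x : qform k (fun i j => c * M i j) x = c * qform k M x.
Proof.
  unfold qform. rewrite <- rsum_scal. apply rsum_ext; intros.
  rewrite <- rsum_scal. apply rsum_ext; intros; ring.
Qed.

Lemma qform_rank1 k v x : qform k (fun i j => v i * v j) x = dot k v x ^ 2.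
Proof.
  unfold qform. rewrite <- Rsqr_pow2. unfold Rsqr, dot. rewrite <- rsum_scal_r.
  apply rsum_ext; intros. rewrite <- rsum_scal. apply rsum_ext; intros; ring.
Qed.

Lemma qA_Gmat n A0 y : qform (2 * n) (Gmat n A0) y = qA n A0 y.
Proof.
  rewrite qform_dot. change (mvec (2 * n) (Gmat n A0) y) with (Gvec n A0 y).
  rewrite dot_Gvec. unfold qA. rewrite qform_dot. reflexivity.
Qed.

Lemma ydiff_line n q z xi s i :
  (i < 2 * n)%nat -> ydiff q (line n z (hdir n z xi) s) i = ydiff q z i + s * xi i.
Proof. intros Hi. unfold ydiff. rewrite line_fst, hdir_lt by auto. ring. Qed.

Lemma Jx_ydiff n q z i : Jx n (ydiff q z) i = Jx n (fst z) i + -1 * Jx n (fst q) i.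
Proof.
  rewrite <- Jx_scal, <- Jx_plus. apply mvec_ext; intros; unfold ydiff; ring.
Qed.

Lemma tdiff_line n q z xi s :
  tdiff n q (line n z (hdir n z xi) s)
  = tdiff n q z + s * (2 * dot (2 * n) (Jx n (ydiff q z)) xi).
Proof.
  unfold tdiff. rewrite line_snd, hdir_t.
  rewrite (dot_ext _ (Jx n (fst q)) (Jx n (fst q)) (fst (line n z (hdir n z xi) s))
             (fun i => fst z i + s * xi i)); [|auto|].
  2:{ intros. rewrite line_fst, hdir_lt; auto. }
  rewrite (dot_ext _ (Jx n (ydiff q z)) (fun i => Jx n (fst z) i + -1 * Jx n (fst q) i) xi xi);
    [|intros; apply Jx_ydiff|auto].
  rewrite dot_plus_r, dot_scal_r, dot_plus_l, dot_scal_l.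
  change (dot (2 * n) (fun i => Jx n (fst z) i)) with (dot (2 * n) (Jx n (fst z))). ring.
Qed.

Lemma derivable_pt_lim_pow2 f f' x :
  derivable_pt_lim f x f' -> derivable_pt_lim (fun s => f s ^ 2) x (2 * f x * f').
Proof.
  intros H. apply derivable_pt_lim_ext with (fun s => f s * f s); [intros; ring|].
  replace (2 * f x * f') with (f' * f x + f x * f') by ring.
  apply (derivable_pt_lim_mult f f); auto.
Qed.

Lemma derivable_pt_lim_affine a b x : derivable_pt_lim (fun s => a + s * b) x b.
Proof.
  assert (H : 0 + (1 * b + x * 0) = b) by ring. refine (eq_ind _ (derivable_pt_lim _ x) _ _ H). clear H.
  apply derivable_pt_lim_plus; [apply derivable_pt_lim_const|].
  apply (derivable_pt_lim_mult (fun s => s) (fun _ => b));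
    [apply derivable_pt_lim_id|apply derivable_pt_lim_const].
Qed.

Lemma derivable_pt_lim_quadratic a b c x :
  derivable_pt_lim (fun s => a + s * b + s ^ 2 * c) x (b + x * (2 * c)).
Proof.
  apply derivable_pt_lim_plus; [apply derivable_pt_lim_affine|].
  replace (x * (2 * c)) with (2 * x * 1 * c + x ^ 2 * 0) by ring.
  apply (derivable_pt_lim_mult (fun s => s ^ 2) (fun _ => c)).
  - apply (derivable_pt_lim_pow2 (fun s => s)), derivable_pt_lim_id.
  - apply derivable_pt_lim_const.
Qed.

(** Along a horizontal line [ydiff] and [tdiff] are affine in [s], so [barf] is an explicit quartic
    polynomial [F] and only the one-variable chain rule is needed. *)
Lemma second_deriv_barrier n A0 q z xi :
  sym_on (2 * n) A0 -> 0 < barf n A0 q z ->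
  second_deriv (fun s => barrier n A0 q (line n z (hdir n z xi) s))
    (qform (2 * n) (barrier_hess n A0 q z) xi).
Proof.
  intros HA Hpos.
  set (y := ydiff q z). set (b := dot (2 * n) (Gvec n A0 y) xi).
  set (e := dot (2 * n) (Jx n y) xi). set (c := qA n A0 xi). set (T := tdiff n q z).
  set (F := fun s => (qA n A0 y + s * (2 * b) + s ^ 2 * c) ^ 2 + (T + s * (2 * e)) ^ 2).
  set (F1 := fun s => 2 * (qA n A0 y + s * (2 * b) + s ^ 2 * c) * (2 * b + s * (2 * c))
                      + 2 * (T + s * (2 * e)) * (2 * e)).
  set (F2 := 8 * b ^ 2 + (4 * qA n A0 y * c + 8 * e ^ 2)).
  assert (HF : forall s, barf n A0 q (line n z (hdir n z xi) s) = F s).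
  { intros s. unfold barf, F. rewrite tdiff_line.
    rewrite (qA_ext n A0 _ (fun i => y i + s * xi i)) by (intros; apply ydiff_line; auto).
    rewrite qA_plus by auto. fold y b e c T. f_equal. f_equal. ring. }
  assert (HF0 : F 0 = barf n A0 q z) by (rewrite <- HF, line_0; auto).
  apply second_deriv_ext with (fun s => Rpower (F s) (- alpha n)).
  { intros s. unfold barrier. rewrite HF. auto. }
  replace (qform (2 * n) (barrier_hess n A0 q z) xi) with
    (- alpha n * F2 * Rpower (F 0) (- alpha n - 1)
     + alpha n * (alpha n + 1) * F1 0 ^ 2 * Rpower (F 0) (- alpha n - 2)).
  - apply second_deriv_Rpower.
    + intros s. unfold F, F1. apply derivable_pt_lim_plus.
      * apply (derivable_pt_lim_pow2 (fun s => qA n A0 y + s * (2 * b) + s ^ 2 * c)).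
        apply derivable_pt_lim_quadratic.
      * apply (derivable_pt_lim_pow2 (fun s => T + s * (2 * e))). apply derivable_pt_lim_affine.
    + unfold F1.
      replace F2 with
        ((2 * (2 * b + 0 * (2 * c)) * (2 * b + 0 * (2 * c))
          + 2 * (qA n A0 y + 0 * (2 * b) + 0 ^ 2 * c) * (2 * c)) + (2 * (2 * e)) * (2 * e))
        by (unfold F2; ring).
      apply derivable_pt_lim_plus.
      * apply (derivable_pt_lim_mult (fun s => 2 * (qA n A0 y + s * (2 * b) + s ^ 2 * c))
                 (fun s => 2 * b + s * (2 * c))).
        -- apply derivable_pt_lim_scal. apply derivable_pt_lim_quadratic.
        -- apply derivable_pt_lim_affine.
      * apply derivable_pt_lim_ext with (fun s => 4 * T * e + s * (2 * (2 * e) * (2 * e)));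
          [intros; ring|]. apply derivable_pt_lim_affine.
    + rewrite HF0; auto.
  - rewrite HF0. unfold barrier_hess.
    rewrite (qform_plus _ (fun i j => - alpha n * Rpower (barf n A0 q z) (- alpha n - 1) * bhess n A0 q z i j)
      (fun i j => alpha n * (alpha n + 1) * Rpower (barf n A0 q z) (- alpha n - 2)
         * (bgrad n A0 q z i * bgrad n A0 q z j))).
    rewrite !qform_scal, qform_rank1.
    replace (dot (2 * n) (bgrad n A0 q z) xi) with (F1 0).
    + unfold bhess.
      rewrite (qform_plus _ (fun i j => 8 * (Gvec n A0 (ydiff q z) i * Gvec n A0 (ydiff q z) j))),
        (qform_plus _ (fun i j => 4 * qA n A0 (ydiff q z) * Gmat n A0 i j)).
      rewrite !qform_scal, !qform_rank1, qA_Gmat. fold y b e c. fold F2. ring.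
    + unfold bgrad, F1. rewrite (dot_plus_l _ xi (fun i => 4 * qA n A0 (ydiff q z) * Gvec n A0 (ydiff q z) i)).
      rewrite !dot_scal_l. fold y b e T. ring.
Qed.

Lemma qA_bounds n lam Lam A0 y :
  frozen_coef n lam Lam A0 ->
  lam * dot (2 * n) y y <= qA n A0 y <= Lam * dot (2 * n) y y.
Proof.
  intros [_ [H _]]. specialize (H (Jx n y)). rewrite dot_J_J in H. exact H.
Qed.

Lemma barf_bounds n lam Lam A0 q z :
  0 < lam -> lam <= 1 -> 1 <= Lam -> frozen_coef n lam Lam A0 ->
  lam ^ 2 * hdist n q z ^ 4 <= barf n A0 q z <= Lam ^ 2 * hdist n q z ^ 4.
Proof.
  intros Hl0 Hl HL HA. rewrite hdist_pow4. unfold barf, dist4.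
  pose proof (qA_bounds n lam Lam A0 (ydiff q z) HA) as [H1 H2].
  pose proof (dot_nonneg (2 * n) (ydiff q z)) as H3.
  set (D := dot (2 * n) (ydiff q z) (ydiff q z)) in *.
  set (Q := qA n A0 (ydiff q z)) in *. pose proof (pow2_ge_0 (tdiff n q z)) as HT.
  assert (0 <= lam * D) by nra.
  (* The [t]-part has coefficient [1]; [lam <= 1 <= Lam] lets it share the bounds of the
     [y]-part. *)
  assert (lam ^ 2 <= 1) by nra. assert (1 <= Lam ^ 2) by nra.
  rewrite !Rmult_plus_distr_l, <- !Rpow_mult_distr.
  split; apply Rplus_le_compat; try (apply pow_incr; lra); nra.
Qed.

Lemma Gmat_sym n A0 : sym_on (2 * n) A0 -> sym_on (2 * n) (Gmat n A0).
Proof.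
  intros HA i j Hi Hj. unfold Gmat, matmul, transp.
  transitivity (rsum (2 * n) (fun l => rsum (2 * n) (fun m => Jm n m i * A0 m l * Jm n l j))).
  - apply rsum_ext; intros. rewrite rsum_scal_r. reflexivity.
  - rewrite rsum_swap. apply rsum_ext; intros m Hm. rewrite <- rsum_scal_r.
    apply rsum_ext; intros l Hl. rewrite (HA m l) by auto. ring.
Qed.

Lemma mvec_delta k M i j :
  (j < k)%nat -> mvec k M (fun l => if Nat.eqb j l then 1 else 0) i = M i j.
Proof.
  intros Hj. unfold mvec. rewrite (rsum_ext _ _ (fun l => (if Nat.eqb j l then 1 else 0) * M i l))
    by (intros; ring).
  apply rsum_delta; auto.
Qed.

Lemma dot_delta k i x : (i < k)%nat -> dot k (fun l => if Nat.eqb i l then 1 else 0) x = x i.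
Proof. intros Hi. apply rsum_delta; auto. Qed.

Lemma qform_perturb k E delta xi :
  0 <= delta -> dot k (mvec k E xi) (mvec k E xi) <= delta ^ 2 * dot k xi xi ->
  Rabs (qform k E xi) <= delta * dot k xi xi.
Proof.
  intros Hd H. pose proof (dot_nonneg k xi) as Hx.
  apply abs_le_of_sq; [nra|]. rewrite qform_dot.
  eapply Rle_trans; [apply dot_CS|]. nra.
Qed.

(** * The barrier of [A0] is a subsolution for every matrix close to [A0] *)

Section Subsolution.

Variables (n : nat) (lam Lam delta : R) (A0 A : nat -> nat -> R).
Hypothesis Hlam : 0 < lam.
Hypothesis HLam : 1 <= Lam.
Hypothesis HA0 : frozen_coef n lam Lam A0.
Hypothesis HA : sym_on (2 * n) A.
Hypothesis Hdelta : 0 <= delta.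
Hypothesis Hclose : forall xi,
  dot (2 * n) (mvec (2 * n) (fun i j => A i j - A0 i j) xi)
              (mvec (2 * n) (fun i j => A i j - A0 i j) xi) <= delta ^ 2 * dot (2 * n) xi xi.

Let E := fun i j => A i j - A0 i j.

Lemma qform_close xi : Rabs (qform (2 * n) A xi - qform (2 * n) A0 xi) <= delta * dot (2 * n) xi xi.
Proof.
  replace (qform (2 * n) A xi - qform (2 * n) A0 xi) with (qform (2 * n) E xi).
  - apply qform_perturb; auto.
  - unfold qform, E. rewrite <- rsum_minus. apply rsum_ext; intros.
    rewrite <- rsum_minus. apply rsum_ext; intros; ring.
Qed.

(** Ellipticity of [A0] at [G y], where [A0 G y = y] collapses the form to [<G y, y>]. Together with
    [dot_Jx_le] it bounds both vectors that make up [bgrad] by the degenerate weight [qA], so the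
    perturbation can be absorbed even where [y] is small. *)
Lemma dot_Gvec_Gvec_le y : lam * dot (2 * n) (Gvec n A0 y) (Gvec n A0 y) <= qA n A0 y.
Proof.
  destruct HA0 as [_ [HB HI]]. eapply Rle_trans; [apply (HB (Gvec n A0 y))|].
  rewrite qform_dot. rewrite (dot_ext _ _ (Gvec n A0 y) _ y) by auto.
  rewrite dot_sym, dot_Gvec. unfold qA. rewrite qform_dot. lra.
Qed.

Lemma qform_A0_Gvec y : qform (2 * n) A0 (Gvec n A0 y) = qA n A0 y.
Proof.
  destruct HA0 as [_ [_ HI]].
  rewrite qform_dot, (dot_ext _ _ (Gvec n A0 y) _ y) by auto.
  rewrite dot_sym, dot_Gvec. unfold qA. rewrite qform_dot. reflexivity.
Qed.

Lemma dot_Jx_le y : lam * dot (2 * n) (Jx n y) (Jx n y) <= qA n A0 y.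
Proof. destruct HA0 as [_ [HB _]]. apply (HB (Jx n y)). Qed.

Lemma qA_nonneg y : 0 <= qA n A0 y.
Proof.
  pose proof (qA_bounds n lam Lam A0 y HA0). pose proof (dot_nonneg (2 * n) y). nra.
Qed.

(** [tr (A0 G) = 2n] because [G] inverts [A0]. The error [tr ((A - A0) G)] is at most
    [delta * tr G], by pairing the nonnegative matrices [G] and [delta I - (A - A0)], and each
    diagonal entry of [G] is at most [Lam]. *)
Lemma pairing_Gmat_le : pairing (2 * n) A (Gmat n A0) <= INR (2 * n) * (1 + delta * Lam).
Proof.
  destruct HA0 as [HS [HB HI]].
  assert (E0 : pairing (2 * n) A0 (Gmat n A0) = INR (2 * n)).
  { unfold pairing. rewrite <- (Rmult_1_r (INR (2 * n))), <- rsum_const.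
    apply rsum_ext; intros i Hi.
    transitivity (mvec (2 * n) A0 (Gvec n A0 (fun l => if Nat.eqb i l then 1 else 0)) i).
    - apply rsum_ext; intros j Hj. f_equal. unfold Gvec. rewrite mvec_delta by auto.
      apply Gmat_sym; auto.
    - rewrite HI, Nat.eqb_refl; auto. }
  assert (Htr : rsum (2 * n) (fun i => Gmat n A0 i i) <= INR (2 * n) * Lam).
  { rewrite <- rsum_const. apply rsum_le; intros i Hi.
    set (e := fun l => if Nat.eqb i l then 1 else 0).
    replace (Gmat n A0 i i) with (qA n A0 e).
    - eapply Rle_trans; [apply (qA_bounds n lam Lam A0 e HA0)|].
      unfold e at 1. rewrite dot_delta by auto. unfold e. rewrite Nat.eqb_refl. lra.
    - rewrite <- qA_Gmat, qform_dot. unfold e at 1. rewrite dot_delta by auto.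
      unfold e. rewrite mvec_delta; auto. }
  assert (HP : 0 <= pairing (2 * n) (Gmat n A0)
                 (fun i j => delta * (if Nat.eqb i j then 1 else 0) + -1 * E i j)).
  { apply pairing_nonneg.
    - apply Gmat_sym; auto.
    - intros x. rewrite qA_Gmat. apply qA_nonneg.
    - intros x. rewrite (qform_plus _ (fun i j => delta * (if Nat.eqb i j then 1 else 0))), !qform_scal.
      replace (qform (2 * n) (fun i j => if Nat.eqb i j then 1 else 0) x) with (dot (2 * n) x x).
      + pose proof (qform_perturb (2 * n) E delta x Hdelta (Hclose x)) as H.
        pose proof (Rle_abs (qform (2 * n) E x)). change (fun i j => E i j) with E. lra.
      + unfold qform, dot. apply rsum_ext; intros i Hi.
        rewrite (rsum_ext _ _ (fun j => (if Nat.eqb i j then 1 else 0) * (x i * x j))) by (intros; ring).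
        rewrite rsum_delta; auto. }
  rewrite pairing_plus_r, !pairing_scal_r in HP.
  replace (pairing (2 * n) (Gmat n A0) (fun i j => if Nat.eqb i j then 1 else 0))
    with (rsum (2 * n) (fun i => Gmat n A0 i i)) in HP.
  2:{ unfold pairing. apply rsum_ext; intros i Hi.
      rewrite (rsum_ext _ (fun j => Gmat n A0 i j * _) (fun j => (if Nat.eqb i j then 1 else 0) * Gmat n A0 i j)) by (intros; ring).
      rewrite rsum_delta; auto. }
  assert (EA : pairing (2 * n) A (Gmat n A0) = pairing (2 * n) A0 (Gmat n A0) + pairing (2 * n) (Gmat n A0) E).
  { rewrite !(pairing_sym _ _ (Gmat n A0)), <- pairing_plus_r.
    apply pairing_ext; intros. unfold E. ring. }
  rewrite EA, E0. apply (Rmult_le_compat_l delta) in Htr; auto. lra.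
Qed.

(* At [A = A0] the bracket equals
   [q f (16 (alpha + 1) - 8 n - 16) = 4 q f]; the closeness of [A] to [A0]
   costs at most that much. *)
Lemma barrier_subsolution q z :
  delta * (8 * (2 * INR n + 5) / lam + 16 / lam + 8 * INR n * Lam) <= 4 ->
  0 < barf n A0 q z -> 0 <= pairing (2 * n) A (barrier_hess n A0 q z).
Proof.
  intros Hd Hf.
  set (y := ydiff q z). set (T := tdiff n q z). set (Q := qA n A0 y). set (f := barf n A0 q z) in *.
  assert (HQ : 0 <= Q) by apply qA_nonneg.
  pose proof (dot_Gvec_Gvec_le y) as HG. pose proof (dot_Jx_le y) as HJ.
  fold Q in HG, HJ.
  pose proof (dot_nonneg (2 * n) (Gvec n A0 y)) as HG0.
  pose proof (dot_nonneg (2 * n) (Jx n y)) as HJ0.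
  set (g2 := dot (2 * n) (Gvec n A0 y) (Gvec n A0 y)) in *.
  set (j2 := dot (2 * n) (Jx n y) (Jx n y)) in *.
  assert (HG' : g2 <= Q / lam) by (apply Rmult_le_reg_l with lam; auto; unfold Rdiv;
     rewrite (Rmult_comm Q), <- Rmult_assoc, Rinv_r by lra; lra).
  assert (HJ' : j2 <= Q / lam) by (apply Rmult_le_reg_l with lam; auto; unfold Rdiv;
     rewrite (Rmult_comm Q), <- Rmult_assoc, Rinv_r by lra; lra).
  set (P := pairing (2 * n) A (bhess n A0 q z)).
  (* At [A = A0] the three terms of [bhess] contribute [8 Q], [8 n Q] and [8 Q]; the part with
     [delta] collects their errors. *)
  assert (HP : P <= Q * (8 * INR n + 16 + delta * (16 / lam + 8 * INR n * Lam))).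
  { unfold P, bhess.
    rewrite (pairing_plus_r _ A (fun i j => 8 * (Gvec n A0 (ydiff q z) i * Gvec n A0 (ydiff q z) j))),
        (pairing_plus_r _ A (fun i j => 4 * qA n A0 (ydiff q z) * Gmat n A0 i j)).
    rewrite !pairing_scal_r, !pairing_rank1.
    change (fun i j => Gmat n A0 i j) with (Gmat n A0). fold y Q.
    pose proof pairing_Gmat_le as H1.
    pose proof (qform_close (Gvec n A0 y)) as H2. rewrite qform_A0_Gvec in H2. fold g2 Q in H2.
    pose proof (qform_close (Jx n y)) as H3. fold j2 in H3.
    change (qform (2 * n) A0 (Jx n y)) with Q in H3.
    pose proof (Rle_abs (qform (2 * n) A (Gvec n A0 y) - Q)).
    pose proof (Rle_abs (qform (2 * n) A (Jx n y) - Q)).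
    rewrite mult_INR in H1. simpl (INR 2) in H1.
    assert (delta * g2 <= delta * (Q / lam)) by (apply Rmult_le_compat_l; auto).
    assert (delta * j2 <= delta * (Q / lam)) by (apply Rmult_le_compat_l; auto).
    assert (4 * Q * pairing (2 * n) A (Gmat n A0) <= 4 * Q * (2 * INR n * (1 + delta * Lam)))
      by (apply Rmult_le_compat_l; lra).
    change (fun i => Jx n y i) with (Jx n y). change (fun i => Gvec n A0 y i) with (Gvec n A0 y).
    unfold Rdiv in *. lra. }
  set (W := qform (2 * n) A (bgrad n A0 q z)).
  assert (HW : Q * f * (16 - 32 * delta / lam) <= W).
  { pose proof (qform_close (bgrad n A0 q z)) as H1.
    pose proof (Rle_abs (- (qform (2 * n) A (bgrad n A0 q z) - qform (2 * n) A0 (bgrad n A0 q z)))) as H2.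
    rewrite Rabs_Ropp in H2. fold W in H1, H2.
    (* [A0 G y = y] turns the cross term into a multiple of [<y, J y> = 0]; the squares give
       [16 Q^2 Q + 16 T^2 Q]. *)
    assert (H3 : qform (2 * n) A0 (bgrad n A0 q z) = 16 * Q * f).
    { rewrite qform_dot.
      rewrite (dot_ext _ _ (fun i => 4 * Q * Gvec n A0 y i + 4 * T * Jx n y i) _
        (fun i => 4 * Q * y i + 4 * T * mvec (2 * n) A0 (Jx n y) i)); [|reflexivity|].
      - rewrite dot_plus_l, !dot_plus_r, !dot_scal_l, !dot_scal_r.
        change (dot (2 * n) (fun i => Gvec n A0 y i)) with (dot (2 * n) (Gvec n A0 y)).
        change (dot (2 * n) (fun i => Jx n y i)) with (dot (2 * n) (Jx n y)).
        change (fun i => mvec (2 * n) A0 (Jx n y) i) with (mvec (2 * n) A0 (Jx n y)).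
        change (fun i => y i) with y.
        destruct HA0 as [HS [_ HI]].
        rewrite (mvec_sym _ A0 (Gvec n A0 y) (Jx n y) HS).
        rewrite (dot_ext _ (mvec (2 * n) A0 (Gvec n A0 y)) y _ (Jx n y)) by auto.
        rewrite (dot_sym _ y (Jx n y)), dot_J_self.
        rewrite (dot_sym _ (Gvec n A0 y) y), dot_Gvec.
        replace (dot (2 * n) (Jx n y) (mvec (2 * n) A0 (Jx n y))) with Q
          by (unfold Q, qA; rewrite qform_dot; auto).
        unfold f, barf. fold y T Q. ring.
      - intros i Hi. unfold bgrad. fold y T Q. rewrite mvec_plus, !mvec_scal.
        change (fun i => Gvec n A0 y i) with (Gvec n A0 y).
        destruct HA0 as [_ [_ HI]]. rewrite HI by auto. reflexivity. }
    assert (H4 : dot (2 * n) (bgrad n A0 q z) (bgrad n A0 q z) <= 32 * (Q ^ 2 * g2 + T ^ 2 * j2)).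
    { unfold g2, j2, dot. rewrite <- !rsum_scal, <- rsum_plus, <- rsum_scal.
      apply rsum_le; intros i Hi. unfold bgrad. fold y T Q.
      pose proof (pow2_ge_0 (Q * Gvec n A0 y i - T * Jx n y i)). nra. }
    assert (H5 : Q ^ 2 * g2 + T ^ 2 * j2 <= f * (Q / lam)).
    { unfold f, barf. fold y T Q. rewrite Rmult_plus_distr_r.
      apply Rplus_le_compat; apply Rmult_le_compat_l; auto; apply pow2_ge_0. }
    assert (delta * dot (2 * n) (bgrad n A0 q z) (bgrad n A0 q z) <= delta * (32 * (f * (Q / lam))))
      by (apply Rmult_le_compat_l; lra).
    replace (Q * f * (16 - 32 * delta / lam)) with (16 * Q * f - delta * (32 * (f * (Q / lam)))) by (field; lra).
    lra. }
  assert (Hal : alpha n = (2 * INR n + 1) / 4).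
  { unfold alpha. rewrite plus_INR, mult_INR. simpl. field. }
  pose proof (pos_INR n) as Hn.
  assert (Hmain : 0 <= - f * P + (alpha n + 1) * W).
  { assert (Ha : 0 <= alpha n + 1) by lra.
    assert (G1 : (alpha n + 1) * (Q * f * (16 - 32 * delta / lam)) <= (alpha n + 1) * W)
      by (apply Rmult_le_compat_l; auto).
    assert (G2 : f * P <= f * (Q * (8 * INR n + 16 + delta * (16 / lam + 8 * INR n * Lam))))
      by (apply Rmult_le_compat_l; lra).
    assert (G3 : 0 <= Q * f * (4 - delta * (8 * (2 * INR n + 5) / lam + 16 / lam + 8 * INR n * Lam))).
    { apply Rmult_le_pos; [apply Rmult_le_pos|]; lra. }
    assert (G4 : (alpha n + 1) * (Q * f * (16 - 32 * delta / lam))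
                 - f * (Q * (8 * INR n + 16 + delta * (16 / lam + 8 * INR n * Lam)))
      = Q * f * (4 - delta * (8 * (2 * INR n + 5) / lam + 16 / lam + 8 * INR n * Lam))).
    { rewrite Hal. field. lra. }
    lra. }
  unfold barrier_hess.
  rewrite (pairing_plus_r _ A (fun i j => - alpha n * Rpower (barf n A0 q z) (- alpha n - 1) * bhess n A0 q z i j)),
    !pairing_scal_r, pairing_rank1. fold f.
  change (fun i j => bhess n A0 q z i j) with (bhess n A0 q z). fold P.
  change (fun i => bgrad n A0 q z i) with (bgrad n A0 q z). fold W.
  (* Both terms share the positive factor [alpha f^(-alpha - 2)], so the sign is that of the bracket
     in [Hmain]. *)
  replace (Rpower f (- alpha n - 1)) with (f * Rpower f (- alpha n - 2)).
  - replace (- alpha n * (f * Rpower f (- alpha n - 2)) * P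
       + alpha n * (alpha n + 1) * Rpower f (- alpha n - 2) * W)
      with (alpha n * Rpower f (- alpha n - 2) * (- f * P + (alpha n + 1) * W)) by ring.
    apply Rmult_le_pos; auto. apply Rmult_le_pos; [lra|]. unfold Rpower. left; apply exp_pos.
  - rewrite <- (Rpower_1 f) at 1 by auto. rewrite <- Rpower_plus. f_equal. ring.
Qed.

End Subsolution.

(** * The growth lemma *)

Definition lsum {T : Type} (E : list T) (f : T -> R) : R := fold_right (fun q s => f q + s) 0 E.

Lemma lsum_le {T : Type} (E : list T) f g : (forall q, In q E -> f q <= g q) -> lsum E f <= lsum E g.
Proof.
  induction E as [|q E IH]; intros H; simpl; [lra|].
  apply Rplus_le_compat; [apply H; left; auto|apply IH; intros; apply H; right; auto].
Qed.

Lemma lsum_plus {T : Type} (E : list T) f g : lsum E (fun q => f q + g q) = lsum E f + lsum E g.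
Proof. induction E as [|q E IH]; simpl; [ring|]. rewrite IH; ring. Qed.

Lemma lsum_scal {T : Type} (E : list T) c f : lsum E (fun q => c * f q) = c * lsum E f.
Proof. induction E as [|q E IH]; simpl; [ring|]. rewrite IH; ring. Qed.

Lemma lsum_const {T : Type} (E : list T) c : lsum E (fun _ => c) = INR (length E) * c.
Proof. induction E as [|q E IH]; [simpl; ring|]. simpl length. rewrite S_INR. simpl. rewrite IH. ring. Qed.

Lemma lsum_nonneg {T : Type} (E : list T) f : (forall q, In q E -> 0 <= f q) -> 0 <= lsum E f.
Proof. intros H. replace 0 with (lsum E (fun _ => 0)); [apply lsum_le; auto|]. rewrite lsum_const. ring. Qed.

Definition indic {T : Type} (P : T -> Prop) (q : T) : R := if excluded_middle_informative (P q) then 1 else 0.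

Definition count {T : Type} (E : list T) (P : T -> Prop) : R := lsum E (indic P).

Lemma cont_on_lsum n F E (f : pt -> pt -> R) :
  (forall q, In q E -> cont_on n F (f q)) -> cont_on n F (fun z => lsum E (fun q => f q z)).
Proof.
  induction E as [|q E IH]; intros H; simpl; [apply cont_on_const|].
  apply cont_on_plus; [apply H; left; auto|apply IH; intros; apply H; right; auto].
Qed.

Lemma second_deriv_lsum n (E : list pt) (f : pt -> R -> R) (M : pt -> nat -> nat -> R) xi :
  (forall q, In q E -> second_deriv (f q) (qform n (M q) xi)) ->
  second_deriv (fun s => lsum E (fun q => f q s))
    (qform n (fun i j => lsum E (fun q => M q i j)) xi).
Proof.
  induction E as [|q E IH]; intros H; simpl.
  - replace (qform n (fun _ _ => 0) xi) with 0; [apply second_deriv_const|].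
    symmetry; apply rsum_zero; intros; apply rsum_zero; intros; ring.
  - rewrite (qform_plus n (M q) (fun i j => lsum E (fun q => M q i j))).
    apply second_deriv_plus; [apply H; left; auto|apply IH; intros; apply H; right; auto].
Qed.

Lemma pairing_lsum k A (E : list pt) (M : pt -> nat -> nat -> R) :
  pairing k A (fun i j => lsum E (fun q => M q i j)) = lsum E (fun q => pairing k A (M q)).
Proof.
  induction E as [|q E IH]; simpl.
  - apply rsum_zero; intros; apply rsum_zero; intros; ring.
  - rewrite pairing_plus_r, IH. reflexivity.
Qed.

(** At a minimum of [u - Phi] the horizontal Hessian of the difference is nonnegative, hence so is
    its pairing with [A z], against the strict inequality. Only quadratic forms along horizontal
    lines through [z] are compared, so the asymmetry of [X_i X_j u] is harmless. *)
Lemma no_interior_min n Om u Du D2u z A Phi M :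
  is_open n Om -> C2_on n Om u Du D2u -> Om z ->
  sym_on (2 * n) (A z) -> (forall xi, 0 <= qform (2 * n) (A z) xi) ->
  (forall xi, second_deriv (fun s => Phi (line n z (hdir n z xi) s)) (qform (2 * n) M xi)) ->
  LA n A Du D2u z < pairing (2 * n) (A z) M ->
  (forall v, exists d, 0 < d /\ forall s, Rabs s < d -> u z - Phi z <= u (line n z v s) - Phi (line n z v s)) ->
  False.
Proof.
  intros HO HC Hz HS HA HPhi HLA Hmin.
  assert (H : 0 <= pairing (2 * n) (A z) (fun i j => XXu n Du D2u i j z + -1 * M i j)).
  { apply pairing_nonneg; auto. intros xi.
    rewrite (qform_plus _ (fun i j => XXu n Du D2u i j z)), qform_scal.
    destruct (Hmin (hdir n z xi)) as [d [Hd Hm]].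
    apply (second_deriv_min (fun s => u (line n z (hdir n z xi) s) + -1 * Phi (line n z (hdir n z xi) s)) _ d); auto.
    - apply second_deriv_plus; [eapply second_deriv_horizontal; eauto|].
      apply (second_deriv_scal (-1) (fun s => Phi (line n z (hdir n z xi) s))). apply HPhi.
    - intros s Hs. rewrite line_0. specialize (Hm s Hs). lra. }
  rewrite pairing_plus_r, pairing_scal_r in H.
  change (pairing (2 * n) (A z) (fun i j => XXu n Du D2u i j z)) with (LA n A Du D2u z) in H.
  change (pairing (2 * n) (A z) (fun i j => M i j)) with (pairing (2 * n) (A z) M) in H. lra.
Qed.

Lemma edist_line_le n z v s :
  edist n z (line n z v s)
  <= INR (2 * n + 1) * (rsum (S (2 * n)) (fun i => Rabs (v i)) * Rabs s).
Proof.
  unfold line. rewrite pmove_S by lia. apply edist_shift_pmove; [|lia|lra].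
  intros i Hi. apply (rsum_term_le _ (fun i => Rabs (v i))); [intros; apply Rabs_pos|lia].
Qed.

Lemma cont_on_line n f z v eps :
  cont_on n (fun _ => True) f -> 0 < eps ->
  exists d, 0 < d /\ forall s, Rabs s < d -> Rabs (f (line n z v s) - f z) < eps.
Proof.
  intros Hf He. destruct (Hf z I eps He) as [d [Hd H]].
  set (C := INR (2 * n + 1) * rsum (S (2 * n)) (fun i => Rabs (v i)) + 1).
  assert (HC : 0 < C).
  { unfold C. pose proof (pos_INR (2 * n + 1)).
    assert (0 <= rsum (S (2 * n)) (fun i => Rabs (v i))) by (apply rsum_nonneg; intros; apply Rabs_pos).
    nra. }
  exists (d / C). split; [apply Rdiv_lt_0_compat; auto|]. intros s Hs. apply H; auto.
  eapply Rle_lt_trans; [apply edist_line_le|].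
  apply Rle_lt_trans with (C * Rabs s).
  - unfold C. pose proof (Rabs_pos s). lra.
  - apply (Rmult_lt_compat_l C) in Hs; auto.
    replace (C * (d / C)) with d in Hs by (field; lra). auto.
Qed.

Lemma line_in_cball_holes n p R0 h (E : list pt) z v :
  valid n z -> hdist n p z < R0 -> (forall q, In q E -> h < hdist n q z) ->
  exists d, 0 < d /\ forall s, Rabs s < d ->
    cball n p R0 (line n z v s) /\ forall q, In q E -> h <= hdist n q (line n z v s).
Proof.
  intros Hv Hp HE. induction E as [|q E IH].
  - destruct (cont_on_line n (hdist n p) z v (R0 - hdist n p z)) as [d [Hd H]];
      [apply cont_on_hdist|lra|].
    exists d; split; auto. intros s Hs. split; [split|intros q []].
    + apply valid_line; auto.
    + specialize (H s Hs). apply Rabs_def2 in H. lra.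
  - destruct IH as [d [Hd H]]; [intros; apply HE; right; auto|].
    assert (Hq : h < hdist n q z) by (apply HE; left; auto).
    destruct (cont_on_line n (hdist n q) z v (hdist n q z - h)) as [d' [Hd' H']];
      [apply cont_on_hdist|lra|].
    exists (Rmin d d'). split; [apply Rmin_pos; auto|]. intros s Hs.
    destruct (H s) as [H1 H2]; [eapply Rlt_le_trans; [apply Hs|apply Rmin_l]|].
    assert (H3 : Rabs (hdist n q (line n z v s) - hdist n q z) < hdist n q z - h)
      by (apply H'; eapply Rlt_le_trans; [apply Hs|apply Rmin_r]).
    apply Rabs_def2 in H3. split; auto.
    intros q' [<-|Hq']; [lra|auto].
Qed.

Lemma cont_on_barrier n A0 F q :
  (forall z, F z -> 0 < barf n A0 q z) -> cont_on n F (barrier n A0 q).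
Proof.
  intros Hp. apply (cont_on_comp n F (barf n A0 q) (fun x => Rpower x (- alpha n))).
  - unfold barf. apply cont_on_plus; apply cont_on_pow; [|apply cont_on_tdiff].
    unfold qA, qform. apply cont_on_rsum; intros. apply cont_on_rsum; intros.
    assert (HJ : forall i, cont_on n F (fun z => Jx n (ydiff q z) i)).
    { intros k. unfold Jx. apply cont_on_rsum; intros. apply cont_on_scal, cont_on_ydiff; auto. }
    apply cont_on_mult; [apply cont_on_scal|]; apply HJ.
  - intros z Fz. apply derivable_continuous_pt.
    exists (- alpha n * Rpower (barf n A0 q z) (- alpha n - 1)).
    apply derivable_pt_lim_power; auto.
Qed.

Lemma Rpower_antimono x y a : 0 <= a -> 0 < x -> x <= y -> Rpower y (- a) <= Rpower x (- a).
Proof.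
  intros Ha Hx Hxy. rewrite !Rpower_Ropp. apply Rinv_le_contravar.
  - unfold Rpower; apply exp_pos.
  - apply Rle_Rpower_l; auto.
Qed.

Lemma Rpower_alpha n x : 0 < x -> Rpower (x ^ 4) (- alpha n) = / x ^ (2 * n + 1).
Proof.
  intros Hx. rewrite <- (Rpower_pow 4) by auto. rewrite Rpower_mult.
  replace (INR 4 * - alpha n) with (- INR (2 * n + 1)) by (unfold alpha; simpl (INR 4); field).
  rewrite Rpower_Ropp, Rpower_pow; auto.
Qed.

Lemma alpha_nonneg n : 0 <= alpha n.
Proof. unfold alpha. pose proof (pos_INR (2 * n + 1)). lra. Qed.

Lemma barrier_bounds n lam Lam A0 q z :
  0 < lam -> lam <= 1 -> 1 <= Lam -> frozen_coef n lam Lam A0 -> 0 < hdist n q z ->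
  0 < barf n A0 q z /\
  / (Lam * hdist n q z) ^ (2 * n + 1) <= barrier n A0 q z <= / (lam * hdist n q z) ^ (2 * n + 1).
Proof.
  intros Hl0 Hl HL HA Hd.
  destruct (barf_bounds n lam Lam A0 q z Hl0 Hl HL HA) as [H1 H2].
  set (d := hdist n q z) in *.
  assert (Hd4 : 0 < d ^ 4) by (apply pow_lt; auto).
  (* The factor [lam^2] is weakened to [lam^4] (and [Lam^2] to [Lam^4] below), so that both bounds
     are fourth powers and [Rpower_alpha] applies. *)
  assert (H3 : (lam * d) ^ 4 <= barf n A0 q z).
  { eapply Rle_trans; [|apply H1]. rewrite Rpow_mult_distr. apply Rmult_le_compat_r; [lra|].
    replace (lam ^ 4) with (lam ^ 2 * lam ^ 2) by ring.
    assert (0 <= lam ^ 2 <= 1) by nra. nra. }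
  assert (H4 : barf n A0 q z <= (Lam * d) ^ 4).
  { eapply Rle_trans; [apply H2|]. rewrite Rpow_mult_distr. apply Rmult_le_compat_r; [lra|].
    replace (Lam ^ 4) with (Lam ^ 2 * Lam ^ 2) by ring.
    assert (1 <= Lam ^ 2) by nra. nra. }
  assert (0 < lam * d) by nra. assert (0 < Lam * d) by nra.
  assert (0 < (lam * d) ^ 4) by (apply pow_lt; auto).
  unfold barrier. split; [lra|].
  rewrite <- !Rpower_alpha by auto.
  split; apply Rpower_antimono; try apply alpha_nonneg; lra.
Qed.

Lemma indic_true {T : Type} (P : T -> Prop) q : P q -> indic P q = 1.
Proof. intros H. unfold indic. destruct (excluded_middle_informative (P q)); tauto. Qed.

Lemma indic_nonneg {T : Type} (P : T -> Prop) q : 0 <= indic P q.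
Proof. unfold indic. destruct (excluded_middle_informative (P q)); lra. Qed.

(* Dyadic annuli [2^j h <= d < 2^(j+1) h]; the exponents [Q = 2n+2] of the
   count and [Q - 1] of the kernel leave a factor [2^j]. *)
Lemma riesz_sum_bound n C0 h (E : list pt) z J :
  0 < h -> 0 <= C0 ->
  (forall rho, h <= rho -> count E (fun q => hdist n q z <= rho) <= C0 * (rho / h) ^ (2 * n + 2)) ->
  (forall q, In q E -> h <= hdist n q z) ->
  lsum E (fun q => indic (fun q => hdist n q z < 2 ^ J * h) q * / hdist n q z ^ (2 * n + 1))
  <= C0 * 2 ^ (2 * n + 2) * (2 ^ J - 1) * / h ^ (2 * n + 1).
Proof.
  intros Hh HC Hcount HE. induction J as [|J IH].
  - simpl. apply Rle_trans with (lsum E (fun _ => 0)).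
    + apply lsum_le. intros q Hq. specialize (HE q Hq). unfold indic.
      destruct (excluded_middle_informative _); lra.
    + rewrite lsum_const. lra.
  - assert (H2J : 1 <= 2 ^ J) by (apply pow_R1_Rle; lra).
    set (a := 2 ^ J * h). assert (Ha : h <= a) by (unfold a; nra).
    apply Rle_trans with
      (lsum E (fun q => indic (fun q => hdist n q z < 2 ^ J * h) q * / hdist n q z ^ (2 * n + 1)
          + / a ^ (2 * n + 1) * indic (fun q => hdist n q z <= 2 * a) q)).
    + apply lsum_le. intros q Hq. specialize (HE q Hq). cbv beta.
      assert (Hinv : 0 <= / hdist n q z ^ (2 * n + 1))
        by (left; apply Rinv_0_lt_compat, pow_lt; lra).
      assert (Hinv' : 0 <= / a ^ (2 * n + 1))
        by (left; apply Rinv_0_lt_compat, pow_lt; lra).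
      pose proof (indic_nonneg (fun q => hdist n q z <= 2 * a) q).
      unfold indic at 1 2. fold a.
      destruct (excluded_middle_informative (hdist n q z < 2 ^ S J * h)) as [H1|H1];
      destruct (excluded_middle_informative (hdist n q z < a)) as [H2|H2]; try nra.
      rewrite indic_true.
      * assert (/ hdist n q z ^ (2 * n + 1) <= / a ^ (2 * n + 1)); [|lra].
        apply Rinv_le_contravar; [apply pow_lt; lra|]. apply pow_incr. lra.
      * simpl in H1. unfold a. lra.
    + rewrite lsum_plus, lsum_scal. fold (count E (fun q => hdist n q z <= 2 * a)).
      assert (Hc : count E (fun q => hdist n q z <= 2 * a) <= C0 * (2 * a / h) ^ (2 * n + 2))
        by (apply Hcount; lra).
      assert (Hinv' : 0 <= / a ^ (2 * n + 1))
        by (left; apply Rinv_0_lt_compat, pow_lt; lra).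
      apply (Rmult_le_compat_l _ _ _ Hinv') in Hc.
      replace (/ a ^ (2 * n + 1) * (C0 * (2 * a / h) ^ (2 * n + 2)))
        with (C0 * 2 ^ (2 * n + 2) * 2 ^ J * / h ^ (2 * n + 1)) in Hc.
      * simpl (2 ^ S J). lra.
      * replace (2 * a / h) with (2 * 2 ^ J) by (unfold a; field; lra).
        unfold a. rewrite !Rpow_mult_distr.
        replace (2 * n + 2)%nat with (S (2 * n + 1)) by lia.
        simpl ((2 ^ J) ^ S (2 * n + 1)).
        assert ((2 ^ J) ^ (2 * n + 1) <> 0) by (apply pow_nonzero; lra).
        assert (h ^ (2 * n + 1) <> 0) by (apply pow_nonzero; lra).
        field. auto.
Qed.

Lemma dyadic_scale x N : 1 <= x -> x < 2 ^ N -> exists J, x < 2 ^ J /\ 2 ^ J <= 2 * x.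
Proof.
  intros Hx. induction N as [|N IH]; intros HN; [simpl in HN; lra|].
  destruct (Rlt_or_le x (2 ^ N)) as [H|H]; auto.
  exists (S N). split; auto. simpl. lra.
Qed.

Lemma exists_dyadic_scale x : 1 <= x -> exists J, x < 2 ^ J /\ 2 ^ J <= 2 * x.
Proof.
  intros Hx. destruct (Pow_x_infinity 2) with (b := x + 1) as [N HN].
  - rewrite Rabs_right; lra.
  - apply (dyadic_scale x N); auto.
    specialize (HN N ltac:(lia)). rewrite Rabs_right in HN; [lra|].
    apply Rle_ge, pow_le; lra.
Qed.

(** For a pole in the ball of radius [R0], the barrier on the sphere of radius [K1 * R0] is at most
    [(4 Lam R0)^-(2n+1)], while inside the small ball it is at least [(2 Lam R0)^-(2n+1)]. This gap
    of a factor at least [2] is what survives subtracting the boundary value. *)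
Definition K1 (lam Lam : R) : R := 1 + 4 * Lam / lam.

(* The bound on [delta] is the one that lets [barrier_subsolution] absorb the
   perturbation [A - A0]. *)
Definition near_frozen (n : nat) (lam Lam delta : R) (A0 : nat -> nat -> R)
  (F : pt -> Prop) (A : pt -> nat -> nat -> R) : Prop :=
  frozen_coef n lam Lam A0 /\ 0 <= delta /\
  delta * (8 * (2 * INR n + 5) / lam + 16 / lam + 8 * INR n * Lam) <= 4 /\
  forall z, F z -> sym_on (2 * n) (A z) /\
    (forall xi, lam * dot (2 * n) xi xi <= qform (2 * n) (A z) xi) /\
    (forall xi, dot (2 * n) (mvec (2 * n) (fun i j => A z i j - A0 i j) xi)
                 (mvec (2 * n) (fun i j => A z i j - A0 i j) xi) <= delta ^ 2 * dot (2 * n) xi xi).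

(** Only the [x]-part of the distance is squared, because its horizontal Hessian is the constant
    [2 I]. A small multiple of it makes a sum of barriers a strict subsolution. *)
Lemma second_deriv_sq n p z xi :
  second_deriv (fun s => dot (2 * n) (ydiff p (line n z (hdir n z xi) s))
                                     (ydiff p (line n z (hdir n z xi) s)))
    (qform (2 * n) (fun i j => 2 * (if Nat.eqb i j then 1 else 0)) xi).
Proof.
  rewrite qform_scal.
  replace (qform (2 * n) (fun i j => if Nat.eqb i j then 1 else 0) xi) with (dot (2 * n) xi xi).
  2:{ unfold qform, dot. apply rsum_ext; intros i Hi.
      rewrite (rsum_ext _ (fun j => (if Nat.eqb i j then 1 else 0) * xi i * xi j)
        (fun j => (if Nat.eqb i j then 1 else 0) * (xi i * xi j))) by (intros; ring).
      rewrite rsum_delta; auto. }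
  set (y := ydiff p z). set (b := 2 * dot (2 * n) y xi). set (c := dot (2 * n) xi xi).
  apply second_deriv_ext with (fun s => dot (2 * n) y y + s * b + s ^ 2 * c).
  - intros s. unfold b, c.
    rewrite (dot_ext _ (ydiff p (line n z (hdir n z xi) s)) (fun i => y i + s * xi i)
             (ydiff p (line n z (hdir n z xi) s)) (fun i => y i + s * xi i))
      by (intros; apply ydiff_line; auto).
    rewrite dot_plus_l, !dot_plus_r, !dot_scal_l, !dot_scal_r, (dot_sym _ xi y).
    change (fun i => y i) with y. change (fun i => xi i) with xi. ring.
  - exists 1, (fun s => b + s * (2 * c)). split; [lra|]. split.
    + intros. apply derivable_pt_lim_quadratic.
    + apply derivable_pt_lim_affine.
Qed.

Lemma trace_lower n lam A :
  (forall xi, lam * dot (2 * n) xi xi <= qform (2 * n) A xi) ->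
  INR (2 * n) * lam <= pairing (2 * n) A (fun i j => if Nat.eqb i j then 1 else 0).
Proof.
  intros H. rewrite <- rsum_const. unfold pairing. apply rsum_le; intros i Hi.
  rewrite (rsum_ext _ _ (fun j => (if Nat.eqb i j then 1 else 0) * A i j)) by (intros; ring).
  rewrite rsum_delta by auto.
  specialize (H (fun l => if Nat.eqb i l then 1 else 0)).
  rewrite qform_dot, !dot_delta, mvec_delta in H by auto.
  rewrite Nat.eqb_refl in H. lra.
Qed.

(** * Comparison of a solution with a sum of barriers on a ball with holes *)

Section Comparison.

Variables (n : nat) (lam Lam delta : R) (A0 : nat -> nat -> R) (A : pt -> nat -> nat -> R)
  (Om : pt -> Prop) (v : pt -> R) (Dv : nat -> pt -> R) (D2v : nat -> nat -> pt -> R)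
  (p : pt) (R0 h m ell theta : R) (E : list pt).

Hypothesis Hn : (1 <= n)%nat.
Hypothesis Hlam0 : 0 < lam.
Hypothesis Hlam1 : lam <= 1.
Hypothesis HLam : 1 <= Lam.
Hypothesis HOm : is_open n Om.
Hypothesis HC2 : C2_on n Om v Dv D2v.
Hypothesis HF : forall z, cball n p R0 z -> Om z /\ 0 <= v z /\ LA n A Dv D2v z = 0.
Hypothesis HA : near_frozen n lam Lam delta A0 (cball n p R0) A.
Hypothesis Hh : 0 < h.
Hypothesis Htheta : 0 <= theta.
Hypothesis Hm : 0 <= m.

Let U (z : pt) : R := lsum E (fun q => barrier n A0 q z).

Hypothesis Hhole : forall q z, In q E -> cball n p R0 z -> hdist n q z <= h -> ell <= v z.
Hypothesis HUell : forall z, cball n p R0 z -> (forall q, In q E -> h <= hdist n q z) ->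
  theta * U z <= ell.
Hypothesis HUout : forall z, valid n z -> hdist n p z = R0 -> U z <= m.

(** Maximum principle for [v - theta U], with [eps |x - x_p|^2] added to [theta U] for strictness.
    The minimum of the difference cannot be interior; on the edge of a hole [theta U <= ell <= v],
    and on the outer sphere [U <= m] and [v >= 0]. Then [eps] is made small. *)
Lemma comparison w :
  cball n p R0 w -> (forall q, In q E -> h <= hdist n q w) -> theta * (U w - m) <= v w.
Proof.
  intros Hw HwE.
  set (F := fun z => cball n p R0 z /\ forall q, In q E -> h <= hdist n q z).
  assert (HR0 : 0 <= R0) by (destruct Hw as [_ Hw]; pose proof (hdist_nonneg n p w); lra).
  destruct HA as [HA0 [Hd0 [Hd HAz]]].
  assert (Hpos : forall q z, In q E -> F z -> 0 < barf n A0 q z).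
  { intros q z Hq [_ Fz]. apply (barrier_bounds n lam Lam); auto. specialize (Fz q Hq). lra. }
  assert (Hsq : forall z, cball n p R0 z -> dot (2 * n) (ydiff p z) (ydiff p z) <= R0 ^ 2).
  { intros z [_ Hz]. eapply Rle_trans; [apply dot_ydiff_le|]. apply pow_incr.
    split; [apply hdist_nonneg|auto]. }
  assert (Hall : forall eps, 0 < eps ->
    0 <= v w - (theta * U w + eps * dot (2 * n) (ydiff p w) (ydiff p w)) + (theta * m + eps * R0 ^ 2)).
  { intros eps He.
    set (Phi := fun z => theta * U z + eps * dot (2 * n) (ydiff p z) (ydiff p z)).
    destruct (compact_attains_min n F (fun z => v z - Phi z)) as [z [Fz Hz]].
    - apply compact_cball_holes.
    - apply cont_on_minus.
      + apply cont_on_subset with Om; [intros z [Fz _]; apply (HF z Fz)|]. apply HC2.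
      + unfold Phi. apply cont_on_plus; apply cont_on_scal.
        * apply (cont_on_lsum n F E (fun q z => barrier n A0 q z)). intros q Hq.
          apply cont_on_barrier. intros z Fz. apply Hpos; auto.
        * unfold dot. apply cont_on_rsum; intros. apply cont_on_mult; apply cont_on_ydiff; auto.
    - exists w; split; auto.
    - enough (0 <= v z - Phi z + (theta * m + eps * R0 ^ 2)).
      { specialize (Hz w (conj Hw HwE)). cbv beta in Hz. unfold Phi in *. lra. }
      destruct Fz as [Fz FzE]. destruct (HF z Fz) as [Oz [Vz Lz]].
      pose proof (Hsq z Fz) as Hs. apply (Rmult_le_compat_l eps) in Hs; [|lra].
      assert (Hthm : 0 <= theta * m) by (apply Rmult_le_pos; auto).
      destruct (classic (exists q, In q E /\ hdist n q z <= h)) as [[q [Hq Hqz]]|Hno].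
      { pose proof (Hhole q z Hq Fz Hqz). pose proof (HUell z Fz FzE). unfold Phi. lra. }
      destruct (Rle_lt_or_eq_dec _ _ (proj2 Fz)) as [Hlt|Heq].
      2:{ pose proof (HUout z (proj1 Fz) Heq) as HU.
          apply (Rmult_le_compat_l theta) in HU; auto. unfold Phi. lra. }
      exfalso. destruct (HAz z Fz) as [HS [HE' Hcl]].
      apply (no_interior_min n Om v Dv D2v z A Phi
        (fun i j => theta * lsum E (fun q => barrier_hess n A0 q z i j)
                    + eps * (2 * (if Nat.eqb i j then 1 else 0)))); auto.
      + intros xi. pose proof (HE' xi). pose proof (dot_nonneg (2 * n) xi). nra.
      + intros xi. unfold Phi.
        rewrite (qform_plus _ (fun i j => theta * lsum E (fun q => barrier_hess n A0 q z i j))),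
          (qform_scal _ theta), (qform_scal _ eps).
        apply second_deriv_plus; apply second_deriv_scal.
        * apply second_deriv_lsum. intros q Hq. apply second_deriv_barrier; [apply HA0|].
          apply Hpos; auto. split; auto.
        * apply second_deriv_sq.
      + rewrite Lz, pairing_plus_r, !pairing_scal_r,
          (pairing_lsum _ _ E (fun q => barrier_hess n A0 q z)).
        pose proof (trace_lower n lam (A z) HE') as Ht.
        assert (Hn' : 0 < INR (2 * n)) by (apply lt_0_INR; lia).
        assert (0 < INR (2 * n) * lam) by (apply Rmult_lt_0_compat; auto).
        assert (0 <= theta * lsum E (fun q => pairing (2 * n) (A z) (barrier_hess n A0 q z))).
        { apply Rmult_le_pos; auto. apply lsum_nonneg. intros q Hq.
          apply (barrier_subsolution n lam Lam delta); auto. apply Hpos; auto. split; auto. }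
        assert (0 < eps * (2 * pairing (2 * n) (A z) (fun i j => if Nat.eqb i j then 1 else 0))).
        { apply Rmult_lt_0_compat; lra. }
        lra.
      + intros dir. destruct (line_in_cball_holes n p R0 h E z dir) as [d [Hd' Hl]]; auto.
        * apply Fz.
        * intros q Hq. apply Rnot_le_lt. intros Hle. apply Hno. exists q; auto.
        * exists d. split; auto. intros s Hs'. apply (Hz (line n z dir s)). split; apply Hl; auto. }
  apply Rnot_lt_le. intros Hlt.
  set (gap := theta * (U w - m) - v w). assert (Hgap : 0 < gap) by (unfold gap; lra).
  pose proof (pow2_ge_0 R0) as HR2.
  (* A concrete [eps] replaces the limit: it spends at most half of the gap, and the [+ 1] covers
     [R0 = 0]. *)
  specialize (Hall (gap / (2 * (R0 ^ 2 + 1))) ltac:(apply Rdiv_lt_0_compat; lra)).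
  pose proof (dot_nonneg (2 * n) (ydiff p w)) as Hy.
  set (e := gap / (2 * (R0 ^ 2 + 1))) in *.
  assert (He : 0 < e) by (apply Rdiv_lt_0_compat; lra).
  assert (He' : e * R0 ^ 2 <= gap / 2).
  { replace (gap / 2) with (e * (R0 ^ 2 + 1)) by (unfold e; field; lra). nra. }
  assert (0 <= e * dot (2 * n) (ydiff p w) (ydiff p w)) by (apply Rmult_le_pos; lra).
  unfold gap in *. lra.
Qed.

End Comparison.

(** The value of [theta * m] in the growth lemma once [ell * N * (h / R0)^(2n+2)] is split off. The
    factor with [C0] and [K1] comes from the upper bound of the sum of barriers, the last one from
    their size on the outer sphere. *)
Definition growth_const (n : nat) (lam Lam C0 : R) : R :=
  / (2 * (C0 * 2 ^ (2 * n + 2) * (K1 lam Lam + 1)) * (4 * Lam / lam) ^ (2 * n + 1)).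

(** The packing bound makes the sum [U] of barriers at most [Umax] away from the holes, so
    [theta = ell / Umax] keeps [theta U] below [ell] there. In the inner ball [U] is at least twice
    its bound [m] on the outer sphere, hence [comparison] leaves [v >= theta m], and [m] is
    proportional to the number of poles. *)
Lemma growth_lemma n lam Lam delta C0 A0 A Om v Dv D2v p R0 h ell (E : list pt) :
  (1 <= n)%nat -> 0 < lam -> lam <= 1 -> 1 <= Lam -> 1 <= C0 ->
  is_open n Om -> C2_on n Om v Dv D2v ->
  (forall z, cball n p (K1 lam Lam * R0) z -> Om z /\ 0 <= v z /\ LA n A Dv D2v z = 0) ->
  near_frozen n lam Lam delta A0 (cball n p (K1 lam Lam * R0)) A ->
  0 < h -> h <= R0 -> 0 <= ell ->
  (forall q, In q E -> cball n p R0 q) ->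
  (forall q z, In q E -> cball n p (K1 lam Lam * R0) z -> hdist n q z <= h -> ell <= v z) ->
  (forall z rho, valid n z -> h <= rho ->
     count E (fun q => hdist n q z <= rho) <= C0 * (rho / h) ^ (2 * n + 2)) ->
  valid n p ->
  forall w, cball n p R0 w ->
    growth_const n lam Lam C0 * ell * INR (length E) * (h / R0) ^ (2 * n + 2) <= v w.
Proof.
  intros Hn Hl0 Hl1 HL HC0 HOm HC2 HF HA Hh HhR Hell HER Hhole Hcount Hvp w Hw.
  set (k1 := K1 lam Lam) in *. set (s := (2 * n + 1)%nat).
  assert (Hll : 1 <= Lam / lam).
  { apply Rmult_le_reg_r with lam; auto. unfold Rdiv. rewrite Rmult_assoc, Rinv_l; lra. }
  assert (Hk1 : 5 <= k1) by (unfold k1, K1; unfold Rdiv in *; lra).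
  assert (HR : 0 < R0) by lra.
  set (N := INR (length E)). assert (HN : 0 <= N) by apply pos_INR.
  set (B := C0 * 2 ^ (2 * n + 2) * (k1 + 1)).
  assert (H2Q : 1 <= 2 ^ (2 * n + 2)) by (apply pow_R1_Rle; lra).
  assert (HB : C0 <= B).
  { unfold B. assert (Hc : C0 <= C0 * 2 ^ (2 * n + 2)) by nra.
    set (c := C0 * 2 ^ (2 * n + 2)) in *. nra. }
  assert (HLs : 1 <= (4 * Lam / lam) ^ s).
  { apply pow_R1_Rle. unfold Rdiv in *. lra. }
  assert (Hgc : growth_const n lam Lam C0 = / (2 * B * (4 * Lam / lam) ^ s)) by reflexivity.
  assert (Hpk : 0 < 2 * B * (4 * Lam / lam) ^ s) by nra.
  assert (HhRp : 0 < (h / R0) ^ (2 * n + 2)).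
  { apply pow_lt, Rdiv_lt_0_compat; auto. }
  (* Once [v w >= ell] the claim is immediate, as the packing bound gives [N (h / R0)^(2n+2) <= C0].
     This disposes of the points [w] inside a hole. *)
  assert (Hell_case : ell <= v w -> growth_const n lam Lam C0 * ell * N * (h / R0) ^ (2 * n + 2) <= v w).
  { intros Hv. eapply Rle_trans; [|apply Hv].
    assert (HNc : N <= C0 * (R0 / h) ^ (2 * n + 2)).
    { eapply Rle_trans; [|apply (Hcount p R0 Hvp HhR)]. unfold N. rewrite <- (Rmult_1_r (INR _)), <- lsum_const.
      apply lsum_le. intros q Hq. rewrite indic_true; [lra|]. rewrite hdist_sym. apply HER; auto. }
    assert (H1 : N * (h / R0) ^ (2 * n + 2) <= C0).
    { apply Rle_trans with (C0 * (R0 / h) ^ (2 * n + 2) * (h / R0) ^ (2 * n + 2)).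
      - apply Rmult_le_compat_r; lra.
      - rewrite Rmult_assoc, <- Rpow_mult_distr. replace (R0 / h * (h / R0)) with 1 by (field; lra).
        rewrite pow1. lra. }
    assert (H2 : 0 <= growth_const n lam Lam C0) by (rewrite Hgc; left; apply Rinv_0_lt_compat; auto).
    assert (H3 : growth_const n lam Lam C0 * C0 <= 1).
    { rewrite Hgc. apply Rmult_le_reg_l with (2 * B * (4 * Lam / lam) ^ s); auto.
      rewrite <- Rmult_assoc, Rinv_r by lra. nra. }
    replace (growth_const n lam Lam C0 * ell * N * (h / R0) ^ (2 * n + 2))
      with (growth_const n lam Lam C0 * (N * (h / R0) ^ (2 * n + 2)) * ell) by ring.
    assert (growth_const n lam Lam C0 * (N * (h / R0) ^ (2 * n + 2)) <= 1) by nra.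
    nra. }
  assert (Hwk : cball n p (k1 * R0) w) by (destruct Hw; split; auto; nra).
  destruct (classic (exists q, In q E /\ hdist n q w < h)) as [[q [Hq Hqw]]|Hno].
  { apply Hell_case. apply (Hhole q); auto. lra. }
  assert (HwE : forall q, In q E -> h <= hdist n q w).
  { intros q Hq. apply Rnot_lt_le. intros H. apply Hno. exists q; auto. }
  set (U := fun z => lsum E (fun q => barrier n A0 q z)).
  (* The outcome of [riesz_sum_bound] at a dyadic scale [2^J <= 2 (k1 + 1) R0 / h], which reaches
     every pole from any point of the big ball; [/ lam ^ s] is the price of passing from [barf] to
     the gauge. *)
  set (Umax := / lam ^ s * (2 * B * (R0 / h) * / h ^ s)).
  assert (Hls : 0 < / lam ^ s) by (apply Rinv_0_lt_compat, pow_lt; auto).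
  assert (Hhs : 0 < / h ^ s) by (apply Rinv_0_lt_compat, pow_lt; auto).
  assert (HRh : 1 <= R0 / h).
  { apply Rmult_le_reg_r with h; auto. unfold Rdiv. rewrite Rmult_assoc, Rinv_l; lra. }
  assert (HUm0 : 0 < Umax).
  { assert (0 < / h) by (apply Rinv_0_lt_compat; auto).
    unfold Umax. repeat apply Rmult_lt_0_compat; lra. }
  set (theta := ell / Umax).
  assert (Htheta : 0 <= theta) by (apply Rmult_le_pos; [auto|left; apply Rinv_0_lt_compat; auto]).
  set (m := N * / (4 * Lam * R0) ^ s).
  assert (H4LR : 0 < / (4 * Lam * R0) ^ s) by (apply Rinv_0_lt_compat, pow_lt; nra).
  assert (Hfro : frozen_coef n lam Lam A0) by apply HA.
  assert (HUmax : forall z, cball n p (k1 * R0) z -> (forall q, In q E -> h <= hdist n q z) -> U z <= Umax).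
  { intros z [Vz Hz] HzE.
    destruct (exists_dyadic_scale ((k1 + 1) * (R0 / h))) as [J [HJ1 HJ2]].
    { rewrite <- (Rmult_1_r 1). apply Rmult_le_compat; lra. }
    pose proof (riesz_sum_bound n C0 h E z J Hh ltac:(lra) (fun rho Hr => Hcount z rho Vz Hr) HzE) as Hrs.
    apply Rle_trans with (/ lam ^ s * lsum E (fun q => indic (fun q => hdist n q z < 2 ^ J * h) q * / hdist n q z ^ s)).
    - rewrite <- lsum_scal. apply lsum_le. intros q Hq. rewrite indic_true.
      + pose proof (HzE q Hq).
        destruct (barrier_bounds n lam Lam A0 q z) as [_ [_ Hb]]; auto; [lra|].
        fold s in Hb. rewrite Rpow_mult_distr, Rinv_mult in Hb. lra.
      + pose proof (hdist_triangle n q p z) as Ht. pose proof (HER q Hq) as [_ Hq'].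
        rewrite hdist_sym in Hq'.
        apply (Rmult_lt_compat_r h) in HJ1; auto.
        replace ((k1 + 1) * (R0 / h) * h) with ((k1 + 1) * R0) in HJ1 by (field; lra). lra.
    - unfold Umax. apply Rmult_le_compat_l; [lra|]. fold s in Hrs.
      eapply Rle_trans; [apply Hrs|].
      apply Rmult_le_compat_r; [lra|].
      apply Rle_trans with (C0 * 2 ^ (2 * n + 2) * (2 * ((k1 + 1) * (R0 / h)))).
      + apply Rmult_le_compat_l; [apply Rmult_le_pos|]; lra.
      + unfold B. lra. }
  assert (Hcomp : theta * (U w - m) <= v w).
  { apply (comparison n lam Lam delta A0 A Om v Dv D2v p (k1 * R0) h m ell theta E); auto.
    - unfold m. apply Rmult_le_pos; lra.
    - intros z Hz HzE. fold (U z).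
      replace ell with (theta * Umax) by (unfold theta; field; lra).
      apply Rmult_le_compat_l; auto.
    - intros z Vz Hz. unfold m, N. rewrite <- lsum_const. apply lsum_le. intros q Hq.
      assert (Hqz : 4 * Lam / lam * R0 <= hdist n q z).
      { pose proof (hdist_triangle n p q z) as Ht. pose proof (HER q Hq) as [_ Hq'].
        rewrite Hz in Ht. unfold k1, K1 in Ht. lra. }
      assert (Hqz' : 4 * Lam * R0 <= lam * hdist n q z).
      { apply (Rmult_le_compat_l lam) in Hqz; [|lra].
        replace (lam * (4 * Lam / lam * R0)) with (4 * Lam * R0) in Hqz by (field; lra). auto. }
      assert (0 < 4 * Lam * R0) by nra.
      assert (0 < hdist n q z) by nra.
      destruct (barrier_bounds n lam Lam A0 q z) as [_ [_ Hb]]; auto.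
      eapply Rle_trans; [apply Hb|]. fold s.
      apply Rinv_le_contravar; [apply pow_lt; auto|]. apply pow_incr; lra. }
  assert (HUw : 2 * m <= U w).
  { unfold m. rewrite <- Rmult_assoc, (Rmult_comm 2 N), Rmult_assoc. unfold N. rewrite <- lsum_const.
    apply lsum_le. intros q Hq.
    pose proof (HwE q Hq).
    destruct (barrier_bounds n lam Lam A0 q w) as [_ [Hb _]]; auto; [lra|].
    eapply Rle_trans; [|apply Hb]. fold s.
    assert (Hqw : hdist n q w <= 2 * R0).
    { pose proof (hdist_triangle n q p w) as Ht. pose proof (HER q Hq) as [_ Hq'].
      rewrite hdist_sym in Hq'. destruct Hw as [_ Hw]. lra. }
    apply Rle_trans with (/ (2 * Lam * R0) ^ s).
    - replace (4 * Lam * R0) with (2 * (2 * Lam * R0)) by ring.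
      rewrite Rpow_mult_distr, Rinv_mult.
      assert (0 < / (2 * Lam * R0) ^ s) by (apply Rinv_0_lt_compat, pow_lt; nra).
      assert (/ 2 ^ s <= / 2).
      { apply Rinv_le_contravar; [lra|]. unfold s. rewrite Nat.add_1_r. simpl.
        assert (1 <= 2 ^ (2 * n)) by (apply pow_R1_Rle; lra). lra. }
      nra.
    - apply Rinv_le_contravar; [apply pow_lt; nra|]. apply pow_incr. nra. }
  eapply Rle_trans; [|apply Hcomp].
  apply Rle_trans with (theta * m); [|apply Rmult_le_compat_l; lra].
  right. rewrite Hgc. unfold theta, Umax, m.
  replace (2 * n + 2)%nat with (S s) by (unfold s; lia).
  replace (4 * Lam * R0) with (4 * Lam / lam * (lam * R0)) by (field; lra).
  rewrite (Rpow_mult_distr (4 * Lam / lam)), (Rpow_mult_distr lam).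
  unfold Rdiv at 2. rewrite Rpow_mult_distr, pow_inv. simpl pow.
  assert (h ^ s <> 0) by (apply pow_nonzero; lra).
  assert (R0 ^ s <> 0) by (apply pow_nonzero; lra).
  assert (lam ^ s <> 0) by (apply pow_nonzero; lra).
  assert ((4 * Lam / lam) ^ s <> 0) by lra.
  set (L := (4 * Lam / lam) ^ s) in *.
  field. repeat split; auto; lra.
Qed.

(** * Counting lattice points in gauge balls *)

Lemma lsum_app {T : Type} (E F : list T) f : lsum (E ++ F) f = lsum E f + lsum F f.
Proof. induction E as [|q E IH]; simpl; [ring|]. rewrite IH; ring. Qed.

Lemma lsum_flat_map {S T : Type} (g : S -> list T) l f :
  lsum (flat_map g l) f = lsum l (fun x => lsum (g x) f).
Proof. induction l as [|x l IH]; simpl; [auto|]. rewrite lsum_app, IH. auto. Qed.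

Lemma lsum_map {S T : Type} (g : S -> T) l f : lsum (map g l) f = lsum l (fun x => f (g x)).
Proof. induction l as [|x l IH]; simpl; [auto|]. rewrite IH. auto. Qed.

Lemma lsum_filter {T : Type} (E : list T) (b : T -> bool) f :
  lsum (filter b E) f = lsum E (fun q => if b q then f q else 0).
Proof.
  induction E as [|q E IH]; simpl; [auto|]. destruct (b q); simpl; rewrite IH; ring.
Qed.

Lemma indic_false {T : Type} (P : T -> Prop) q : ~ P q -> indic P q = 0.
Proof. intros H. unfold indic. destruct (excluded_middle_informative (P q)); tauto. Qed.

Lemma indic_mono {S T : Type} (P : S -> Prop) (P' : T -> Prop) q q' :
  (P q -> P' q') -> indic P q <= indic P' q'.
Proof.
  intros H. unfold indic. destruct (excluded_middle_informative (P q));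
  destruct (excluded_middle_informative (P' q')); try lra; tauto.
Qed.

Lemma indic_mult_le {S T W : Type} (P : S -> Prop) (P1 : T -> Prop) (P2 : W -> Prop) q q1 q2 :
  (P q -> P1 q1 /\ P2 q2) -> indic P q <= indic P1 q1 * indic P2 q2.
Proof.
  intros H. unfold indic. destruct (excluded_middle_informative (P q));
  destruct (excluded_middle_informative (P1 q1));
  destruct (excluded_middle_informative (P2 q2)); try lra; tauto.
Qed.

Lemma indic_mult_ge {S T W : Type} (P : S -> Prop) (P1 : T -> Prop) (P2 : W -> Prop) q q1 q2 :
  (P1 q1 -> P2 q2 -> P q) -> indic P1 q1 * indic P2 q2 <= indic P q.
Proof.
  intros H. unfold indic. destruct (excluded_middle_informative (P q));
  destruct (excluded_middle_informative (P1 q1));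
  destruct (excluded_middle_informative (P2 q2)); try lra; tauto.
Qed.

(** The induction moves the starting index [a], so the bound must record that the integers below [a]
    are gone; hence [Rmax lo (INR a)]. *)
Lemma count_seq_le k a lo hi :
  lo <= hi -> count (seq a k) (fun j => lo <= INR j <= hi) <= Rmax 0 (hi - Rmax lo (INR a) + 1).
Proof.
  intros Hlh. revert a. induction k as [|k IH]; intros a; unfold count; simpl lsum.
  - apply Rmax_l.
  - specialize (IH (S a)). unfold count in IH. rewrite S_INR in IH.
    unfold indic at 1. destruct (excluded_middle_informative (lo <= INR a <= hi)) as [H|H].
    + rewrite (Rmax_right lo (INR a)) by lra. rewrite (Rmax_right lo (INR a + 1)) in IH by lra.
      eapply Rle_trans; [apply Rplus_le_compat_l, IH|].
      unfold Rmax. repeat destruct (Rle_dec _ _); lra.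
    + rewrite Rplus_0_l. eapply Rle_trans; [apply IH|].
      unfold Rmax. repeat destruct (Rle_dec _ _); lra.
Qed.

(** Once [a] lies in the interval, the induction hypothesis is used with [lo] raised to [INR a]. The
    invariant [INR a <= lo + 1] survives this step, whereas [INR a <= lo] would not. *)
Lemma count_seq_ge k a lo hi :
  INR a <= lo + 1 -> hi <= INR a + INR k ->
  hi - lo - 1 <= count (seq a k) (fun j => lo <= INR j <= hi).
Proof.
  revert a lo. induction k as [|k IH]; intros a lo Ha Hk; unfold count; simpl lsum.
  - simpl in Hk. lra.
  - rewrite S_INR in Hk. unfold indic at 1.
    destruct (excluded_middle_informative (lo <= INR a <= hi)) as [H|H].
    + specialize (IH (S a) (INR a)). rewrite S_INR in IH.
      assert (H1 : hi - INR a - 1 <= count (seq (S a) k) (fun j => lo <= INR j <= hi)).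
      { eapply Rle_trans; [apply IH; lra|]. apply lsum_le. intros j _. apply indic_mono. lra. }
      unfold count in H1. lra.
    + rewrite Rplus_0_l. destruct (Rlt_or_le (INR a) lo) as [H1|H1].
      * apply IH; rewrite S_INR; lra.
      * assert (hi < INR a) by (apply Rnot_le_lt; intros Hx; apply H; lra).
        apply Rle_trans with 0; [lra|]. apply lsum_nonneg. intros; apply indic_nonneg.
Qed.

Definition mesh (h : R) (M : nat) : list R :=
  map (fun j => h * (INR j - INR M)) (seq 0 (2 * M + 1)).

Lemma mesh_mem_iff h M c r j :
  0 < h -> (Rabs (h * (INR j - INR M) - c) <= r
            <-> (c - r) / h + INR M <= INR j <= (c + r) / h + INR M).
Proof.
  intros Hh. set (x := INR j - INR M).
  assert (E1 : (c - r) / h <= x <-> c - r <= h * x).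
  { split; intros H.
    - apply (Rmult_le_compat_l h) in H; [|lra]. replace (h * ((c - r) / h)) with (c - r) in H by (field; lra). auto.
    - apply Rmult_le_reg_l with h; auto. replace (h * ((c - r) / h)) with (c - r) by (field; lra). auto. }
  assert (E2 : x <= (c + r) / h <-> h * x <= c + r).
  { split; intros H.
    - apply (Rmult_le_compat_l h) in H; [|lra]. replace (h * ((c + r) / h)) with (c + r) in H by (field; lra). auto.
    - apply Rmult_le_reg_l with h; auto. replace (h * ((c + r) / h)) with (c + r) by (field; lra). auto. }
  unfold x in *. split.
  - intros H. pose proof (Rle_abs (h * (INR j - INR M) - c)).
    pose proof (Rle_abs (- (h * (INR j - INR M) - c))) as H'. rewrite Rabs_Ropp in H'.
    destruct E1 as [_ E1], E2 as [_ E2]. specialize (E1 ltac:(lra)). specialize (E2 ltac:(lra)). lra.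
  - intros H. destruct E1 as [E1 _], E2 as [E2 _]. specialize (E1 ltac:(lra)). specialize (E2 ltac:(lra)).
    apply Rabs_le. lra.
Qed.

Lemma count_mesh_le h M c r :
  0 < h -> 0 <= r -> count (mesh h M) (fun x => Rabs (x - c) <= r) <= 2 * r / h + 1.
Proof.
  intros Hh Hr. unfold count, mesh. rewrite lsum_map.
  assert (Hrh : 0 <= r / h) by (apply Rmult_le_pos; [auto|left; apply Rinv_0_lt_compat; auto]).
  apply Rle_trans with (count (seq 0 (2 * M + 1)) (fun j => (c - r) / h + INR M <= INR j <= (c + r) / h + INR M)).
  - apply lsum_le. intros j _. apply indic_mono. apply mesh_mem_iff; auto.
  - eapply Rle_trans; [apply count_seq_le|].
    + unfold Rdiv in *. lra.
    + pose proof (Rmax_l ((c - r) / h + INR M) (INR 0)).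
      apply Rmax_lub; unfold Rdiv in *; lra.
Qed.

Lemma count_mesh_ge h M c r :
  0 < h -> Rabs c + r <= h * INR M -> 2 * r / h - 1 <= count (mesh h M) (fun x => Rabs (x - c) <= r).
Proof.
  intros Hh Hr. unfold count, mesh. rewrite lsum_map.
  apply Rle_trans with (count (seq 0 (2 * M + 1)) (fun j => (c - r) / h + INR M <= INR j <= (c + r) / h + INR M)).
  - pose proof (Rle_abs c). pose proof (Rle_abs (- c)) as H'. rewrite Rabs_Ropp in H'.
    assert (H1 : - INR M <= (c - r) / h).
    { apply Rmult_le_reg_l with h; auto. replace (h * ((c - r) / h)) with (c - r) by (field; lra). lra. }
    assert (H2 : (c + r) / h <= INR M).
    { apply Rmult_le_reg_l with h; auto. replace (h * ((c + r) / h)) with (c + r) by (field; lra). lra. }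
    eapply Rle_trans; [|apply count_seq_ge].
    + unfold Rdiv. lra.
    + simpl. lra.
    + rewrite plus_INR, mult_INR. simpl. lra.
  - apply lsum_le. intros j _. apply indic_mono. apply mesh_mem_iff; auto.
Qed.

Definition upd (x : nat -> R) (k : nat) (a : R) (i : nat) : R := if Nat.eqb i k then a else x i.

Fixpoint grid (h : R) (M k : nat) : list (nat -> R) :=
  match k with
  | O => (fun _ => 0) :: nil
  | S k' => flat_map (fun x => map (upd x k') (mesh h M)) (grid h M k')
  end.

(** Spacing [h] in [x] and [h^2] in [t], following the anisotropic dilations. It is a plain product
    grid, with no use of the group law. *)
Definition lattice (n : nat) (h : R) (M : nat) : list pt :=
  flat_map (fun x => map (fun t => (x, t)) (mesh (h ^ 2) M)) (grid h M (2 * n)).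

Lemma grid_zero h M k x : In x (grid h M k) -> forall i, (k <= i)%nat -> x i = 0.
Proof.
  revert x. induction k as [|k IH]; intros x Hx i Hi; simpl in Hx.
  - destruct Hx as [<-|[]]. auto.
  - apply in_flat_map in Hx. destruct Hx as [x' [Hx' Hx]].
    apply in_map_iff in Hx. destruct Hx as [a [<- _]].
    unfold upd. destruct (Nat.eqb_spec i k); [lia|]. apply IH; auto. lia.
Qed.

Lemma lattice_valid n h M q : In q (lattice n h M) -> valid n q.
Proof.
  intros Hq. apply in_flat_map in Hq. destruct Hq as [x [Hx Hq]].
  apply in_map_iff in Hq. destruct Hq as [t [<- _]]. intros i Hi.
  apply (grid_zero h M (2 * n)); auto.
Qed.

Definition in_box (k : nat) (c : nat -> R) (r : R) (x : nat -> R) : Prop :=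
  forall i, (i < k)%nat -> Rabs (x i - c i) <= r.

Lemma in_box_upd k c r x a :
  in_box (S k) c r (upd x k a) <-> in_box k c r x /\ Rabs (a - c k) <= r.
Proof.
  unfold in_box, upd. split.
  - intros H. split.
    + intros i Hi. specialize (H i ltac:(lia)). destruct (Nat.eqb_spec i k); [lia|auto].
    + specialize (H k ltac:(lia)). rewrite Nat.eqb_refl in H. auto.
  - intros [H1 H2] i Hi. destruct (Nat.eqb_spec i k) as [->|]; auto. apply H1. lia.
Qed.

Lemma count_grid_le h M k c r :
  0 < h -> 0 <= r -> count (grid h M k) (in_box k c r) <= (2 * r / h + 1) ^ k.
Proof.
  intros Hh Hr. assert (Hrh : 0 <= 2 * r / h + 1).
  { assert (0 <= r / h) by (apply Rmult_le_pos; [auto|left; apply Rinv_0_lt_compat; auto]).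
    unfold Rdiv in *. lra. }
  induction k as [|k IH].
  - unfold count; simpl. unfold indic. destruct (excluded_middle_informative _); lra.
  - unfold count; simpl grid. rewrite lsum_flat_map.
    apply Rle_trans with (lsum (grid h M k) (fun x => (2 * r / h + 1) * indic (in_box k c r) x)).
    + apply lsum_le. intros x _. rewrite lsum_map.
      apply Rle_trans with (lsum (mesh h M) (fun a => indic (in_box k c r) x * indic (fun a => Rabs (a - c k) <= r) a)).
      * apply lsum_le. intros a _. apply indic_mult_le. apply in_box_upd.
      * rewrite lsum_scal, Rmult_comm. apply Rmult_le_compat_r; [apply indic_nonneg|].
        apply (count_mesh_le h M (c k) r); auto.
    + rewrite lsum_scal. simpl. apply Rmult_le_compat_l; auto.
Qed.

Lemma count_grid_ge h M k c r :
  0 < h -> 0 <= 2 * r / h - 1 -> (forall i, (i < k)%nat -> Rabs (c i) + r <= h * INR M) ->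
  (2 * r / h - 1) ^ k <= count (grid h M k) (in_box k c r).
Proof.
  intros Hh Hr. induction k as [|k IH]; intros Hc.
  - unfold count; simpl. rewrite indic_true; [lra|]. intros i Hi; lia.
  - unfold count; simpl grid. rewrite lsum_flat_map.
    apply Rle_trans with (lsum (grid h M k) (fun x => (2 * r / h - 1) * indic (in_box k c r) x)).
    + rewrite lsum_scal. simpl. apply Rmult_le_compat_l; auto.
    + apply lsum_le. intros x _. rewrite lsum_map.
      apply Rle_trans with (lsum (mesh h M) (fun a => indic (in_box k c r) x * indic (fun a => Rabs (a - c k) <= r) a)).
      * rewrite lsum_scal, Rmult_comm. apply Rmult_le_compat_l; [apply indic_nonneg|].
        apply (count_mesh_ge h M (c k) r); auto.
      * apply lsum_le. intros a _. apply indic_mult_ge. intros. apply in_box_upd; auto.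
Qed.

(** One factor [3] per coordinate, from [2 s + 1 <= 3 s] for [s >= 1], with [s = rho / h] for each
    [x_i] and [s = (rho / h)^2] for [t]. *)
Definition upper_count (n : nat) : R := 3 ^ (2 * n + 1).

(** Comes from a box inscribed in the ball, of half-width [rho / (4 n)] in each [x_i] and
    [rho^2 / 2] in [tdiff]. *)
Definition lower_count (n : nat) : R := / (4 * INR n) ^ (2 * n) / 2.

(** For fixed [x] the ball meets the vertical line inside an interval whose centre [ct x] shifts
    with [x] but whose half-length is [rho^2]. The twist of the group law therefore does not affect
    the count. *)
Lemma count_lattice_le n h M z rho :
  0 < h -> h <= rho ->
  count (lattice n h M) (fun q => hdist n q z <= rho) <= upper_count n * (rho / h) ^ (2 * n + 2).
Proof.
  intros Hh Hr. assert (Hh2 : 0 < h ^ 2) by (apply pow_lt; auto).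
  set (ct := fun x => snd z + 2 * dot (2 * n) (Jx n (fst z)) x).
  set (b := 2 * rho ^ 2 / h ^ 2 + 1).
  unfold count, lattice. rewrite lsum_flat_map.
  apply Rle_trans with (lsum (grid h M (2 * n)) (fun x => b * indic (in_box (2 * n) (fst z) rho) x)).
  - apply lsum_le. intros x _. rewrite lsum_map.
    apply Rle_trans with (lsum (mesh (h ^ 2) M)
      (fun t => indic (in_box (2 * n) (fst z) rho) x * indic (fun t => Rabs (t - ct x) <= rho ^ 2) t)).
    + apply lsum_le. intros t _. apply indic_mult_le. rewrite hdist_sym. intros Hd.
      pose proof (hdist_nonneg n z (x, t)). split.
      * intros i Hi. eapply Rle_trans; [apply (ydiff_abs_le n z (x, t) i Hi)|auto].
      * replace (t - ct x) with (tdiff n z (x, t)) by (unfold tdiff, ct; cbn [fst snd]; ring).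
        eapply Rle_trans; [apply tdiff_abs_le|]. apply pow_incr; auto.
    + rewrite lsum_scal, Rmult_comm. apply Rmult_le_compat_r; [apply indic_nonneg|].
      apply (count_mesh_le (h ^ 2) M (ct x) (rho ^ 2)); auto. apply pow2_ge_0.
  - rewrite lsum_scal.
    assert (Hq : 1 <= rho / h).
    { apply Rmult_le_reg_r with h; auto. unfold Rdiv. rewrite Rmult_assoc, Rinv_l; lra. }
    assert (Hb : b <= 3 * (rho / h) ^ 2).
    { unfold b. replace (2 * rho ^ 2 / h ^ 2) with (2 * (rho / h) ^ 2) by (field; lra). nra. }
    assert (Hb0 : 0 <= b).
    { unfold b. replace (2 * rho ^ 2 / h ^ 2) with (2 * (rho / h) ^ 2) by (field; lra). nra. }
    assert (Hg : count (grid h M (2 * n)) (in_box (2 * n) (fst z) rho) <= (3 * (rho / h)) ^ (2 * n)).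
    { eapply Rle_trans; [apply count_grid_le; lra|]. apply pow_incr. unfold Rdiv in *. lra. }
    assert (Hg0 : 0 <= count (grid h M (2 * n)) (in_box (2 * n) (fst z) rho))
      by (apply lsum_nonneg; intros; apply indic_nonneg).
    apply Rle_trans with (3 * (rho / h) ^ 2 * (3 * (rho / h)) ^ (2 * n)).
    + apply Rmult_le_compat; auto.
    + right. unfold upper_count. rewrite Rpow_mult_distr, !pow_add. ring.
Qed.

(** The truncation index [M] is taken large, depending on [z1], so that the grid covers a box
    inscribed in the ball; the upper bound holds for every truncation and every centre. *)
Lemma exists_lattice n z1 rho h :
  (1 <= n)%nat -> 0 < h -> 4 * INR n * h <= rho ->
  exists L : list pt, (forall q, In q L -> valid n q) /\
    (forall z r, h <= r -> count L (fun q => hdist n q z <= r) <= upper_count n * (r / h) ^ (2 * n + 2)) /\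
    lower_count n * (rho / h) ^ (2 * n + 2) <= count L (fun q => hdist n z1 q <= rho).
Proof.
  intros Hn Hh Hrho. assert (Hh2 : 0 < h ^ 2) by (apply pow_lt; auto).
  assert (Hn1 : 1 <= INR n) by (apply (le_INR 1); auto).
  assert (Hrho0 : 0 < rho) by nra.
  (* The box with half-widths [a], [b] fits in the ball: [|y|^2 <= 2n a^2 <= rho^2 / 8] and
     [(rho^2 / 8)^2 + (rho^2 / 2)^2 <= rho^4]. Each half-width is at least one spacing by the
     hypothesis on [h]. *)
  set (a := rho / (4 * INR n)). set (b := rho ^ 2 / 2).
  assert (Ha : h <= a).
  { unfold a. apply Rmult_le_reg_r with (4 * INR n); [lra|].
    replace (rho / (4 * INR n) * (4 * INR n)) with rho by (field; lra). lra. }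
  assert (Hb : h ^ 2 <= b).
  { unfold b. assert (4 * h <= rho) by nra. nra. }
  (* [X] bounds the [x]-coordinates over the box and [Y] the ends of every vertical interval above
     it; together they tell how far the grid must reach. *)
  set (X := rsum (2 * n) (fun i => Rabs (fst z1 i)) + a).
  set (JS := rsum (2 * n) (fun i => Rabs (Jx n (fst z1) i) * X)).
  set (Y := Rabs (snd z1) + 2 * JS + b).
  assert (HX : forall i, (i < 2 * n)%nat -> Rabs (fst z1 i) + a <= X).
  { intros i Hi. apply Rplus_le_compat_r.
    apply (rsum_term_le (2 * n) (fun i => Rabs (fst z1 i))); auto. intros; apply Rabs_pos. }
  destruct (INR_unbounded (X / h + Rabs (Y / h ^ 2))) as [M HM].
  assert (HX0 : 0 <= X).
  { apply Rplus_le_le_0_compat; [apply rsum_nonneg; intros; apply Rabs_pos|lra]. }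
  assert (HM1 : X <= h * INR M).
  { pose proof (Rabs_pos (Y / h ^ 2)). replace X with (h * (X / h)) at 1 by (field; lra).
    apply Rmult_le_compat_l; lra. }
  assert (HM2 : Y <= h ^ 2 * INR M).
  { pose proof (Rle_abs (Y / h ^ 2)).
    assert (0 <= X / h) by (apply Rmult_le_pos; [auto|left; apply Rinv_0_lt_compat; auto]).
    replace Y with (h ^ 2 * (Y / h ^ 2)) at 1 by (field; lra).
    apply Rmult_le_compat_l; lra. }
  exists (lattice n h M). split; [apply lattice_valid|]. split.
  { intros z r Hr. apply count_lattice_le; auto. }
  set (ct := fun x => snd z1 + 2 * dot (2 * n) (Jx n (fst z1)) x).
  unfold count at 1, lattice. rewrite lsum_flat_map.
  apply Rle_trans with (lsum (grid h M (2 * n)) (fun x => (2 * b / h ^ 2 - 1) * indic (in_box (2 * n) (fst z1) a) x)).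
  - rewrite lsum_scal.
    assert (Hq : 1 <= a / h).
    { apply Rmult_le_reg_r with h; auto. unfold Rdiv at 1. rewrite Rmult_assoc, Rinv_l; lra. }
    assert (Hq2 : 1 <= b / h ^ 2).
    { apply Rmult_le_reg_r with (h ^ 2); auto. unfold Rdiv at 1. rewrite Rmult_assoc, Rinv_l; lra. }
    assert (Hg : (a / h) ^ (2 * n) <= count (grid h M (2 * n)) (in_box (2 * n) (fst z1) a)).
    { apply Rle_trans with ((2 * a / h - 1) ^ (2 * n)).
      - apply pow_incr. unfold Rdiv in *. lra.
      - apply count_grid_ge; auto.
        + unfold Rdiv in *. lra.
        + intros i Hi. specialize (HX i Hi). lra. }
    apply Rle_trans with (b / h ^ 2 * (a / h) ^ (2 * n)).
    + right. unfold lower_count, a, b.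
      replace (rho / (4 * INR n) / h) with (/ (4 * INR n) * (rho / h)) by (field; lra).
      rewrite (Rpow_mult_distr (/ (4 * INR n))), pow_add, pow_inv.
      replace (rho ^ 2 / 2 / h ^ 2) with ((rho / h) ^ 2 / 2) by (field; lra).
      unfold Rdiv. ring.
    + apply Rmult_le_compat; auto; [lra|apply pow_le; lra|unfold Rdiv in *; lra].
  - apply lsum_le. intros x _. rewrite lsum_map.
    destruct (classic (in_box (2 * n) (fst z1) a x)) as [Hx|Hx].
    2:{ rewrite indic_false, Rmult_0_r by auto. apply lsum_nonneg; intros; apply indic_nonneg. }
    rewrite (indic_true (in_box (2 * n) (fst z1) a)), Rmult_1_r by auto.
    eapply Rle_trans; [apply (count_mesh_ge (h ^ 2) M (ct x) b); auto|].
    + eapply Rle_trans; [|apply HM2]. unfold Y. apply Rplus_le_compat_r.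
      unfold ct. eapply Rle_trans; [apply Rabs_triang|]. apply Rplus_le_compat_l.
      rewrite Rabs_mult, Rabs_right by lra. apply Rmult_le_compat_l; [lra|].
      unfold dot, JS. eapply Rle_trans; [apply rsum_Rabs|]. apply rsum_le. intros i Hi.
      rewrite Rabs_mult. apply Rmult_le_compat_l; [apply Rabs_pos|].
      replace (x i) with (fst z1 i + (x i - fst z1 i)) by ring.
      eapply Rle_trans; [apply Rabs_triang|]. specialize (HX i Hi). specialize (Hx i Hi). lra.
    + apply lsum_le. intros t _. apply indic_mono. intros Ht.
      apply hdist_le_dist4; [lra|]. unfold dist4.
      assert (Hy : dot (2 * n) (ydiff z1 (x, t)) (ydiff z1 (x, t)) <= rho ^ 2 / 8).
      { apply Rle_trans with (rsum (2 * n) (fun _ => a ^ 2)).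
        - apply rsum_le. intros i Hi. specialize (Hx i Hi). unfold ydiff; cbn [fst].
          replace ((x i - fst z1 i) * (x i - fst z1 i)) with ((x i - fst z1 i) ^ 2) by ring.
          rewrite <- (pow2_abs (x i - fst z1 i)). apply pow_incr. split; [apply Rabs_pos|auto].
        - rewrite rsum_const, mult_INR. replace (INR 2) with 2 by (simpl; ring). unfold a.
          replace (2 * INR n * (rho / (4 * INR n)) ^ 2) with (rho ^ 2 / 8 * / INR n) by (field; lra).
          apply Rle_trans with (rho ^ 2 / 8 * 1); [|lra]. apply Rmult_le_compat_l; [nra|].
          rewrite <- Rinv_1. apply Rinv_le_contravar; lra. }
      pose proof (dot_nonneg (2 * n) (ydiff z1 (x, t))).
      assert (HT : tdiff n z1 (x, t) ^ 2 <= b ^ 2).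
      { replace (tdiff n z1 (x, t)) with (t - ct x) by (unfold tdiff, ct; cbn [fst snd]; ring).
        rewrite <- (pow2_abs (t - ct x)). apply pow_incr. split; [apply Rabs_pos|auto]. }
      assert (HY : dot (2 * n) (ydiff z1 (x, t)) (ydiff z1 (x, t)) ^ 2 <= (rho ^ 2 / 8) ^ 2)
        by (apply pow_incr; auto).
      unfold b in HT. replace (rho ^ 4) with ((rho ^ 2) ^ 2) by ring.
      assert (0 <= (rho ^ 2) ^ 2) by apply pow2_ge_0. nra.
Qed.

(** * The Harnack inequality *)

Definition select {T : Type} (P : T -> Prop) (L : list T) : list T :=
  filter (fun q => if excluded_middle_informative (P q) then true else false) L.

Lemma in_select {T : Type} (P : T -> Prop) L q : In q (select P L) <-> In q L /\ P q.
Proof.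
  unfold select. rewrite filter_In.
  destruct (excluded_middle_informative (P q)); intuition congruence.
Qed.

Lemma length_select {T : Type} (P : T -> Prop) L : INR (length (select P L)) = count L P.
Proof.
  rewrite <- (Rmult_1_r (INR _)), <- lsum_const. unfold select. rewrite lsum_filter.
  unfold count, indic. f_equal. apply functional_extensionality; intros q.
  destruct (excluded_middle_informative (P q)); auto.
Qed.

Lemma count_select_le {T : Type} (P P' : T -> Prop) L : count (select P L) P' <= count L P'.
Proof.
  unfold count, select. rewrite lsum_filter. apply lsum_le. intros q _.
  pose proof (indic_nonneg P' q). destruct (excluded_middle_informative (P q)); lra.
Qed.

Lemma C2_on_affine n Om u Du D2u c sg :
  C2_on n Om u Du D2u ->
  C2_on n Om (fun z => c + sg * u z) (fun a z => sg * Du a z) (fun a b z => sg * D2u a b z).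
Proof.
  intros [HD [H0 [H1 H2]]]. repeat split.
  - unfold partial_lim. replace (sg * Du a z) with (0 + sg * Du a z) by ring.
    apply (derivable_pt_lim_plus (fun _ => c) (fun h => sg * u (shift n z a h))).
    + apply derivable_pt_lim_const.
    + apply (derivable_pt_lim_scal (fun h => u (shift n z a h))). apply (HD z H a H3).
  - intros b Hb. apply (derivable_pt_lim_scal (fun h => Du b (shift n z a h))).
    apply (HD z H a H3); auto.
  - apply cont_on_plus; [apply cont_on_const|apply cont_on_scal; auto].
  - intros a Ha. apply cont_on_scal; auto.
  - intros a b Ha Hb. apply cont_on_scal; auto.
Qed.

Lemma LA_scal n A Du D2u sg z :
  LA n A (fun a z => sg * Du a z) (fun a b z => sg * D2u a b z) z = sg * LA n A Du D2u z.
Proof.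
  change (LA n A Du D2u z) with (pairing (2 * n) (A z) (fun i j => XXu n Du D2u i j z)).
  rewrite <- pairing_scal_r. apply pairing_ext. intros i j _ _. unfold XXu. ring.
Qed.

(** The hypothesis provides a left inverse, [G A = I] entrywise. Transposing, with [A] and [G]
    symmetric, gives [A G = I], the side used in the barrier computation. *)
Lemma frozen_coef_of_symplectic n lam Lam Om A z :
  in_Mn n lam Lam Om A -> symplectic n Om A -> Om z -> frozen_coef n lam Lam (A z).
Proof.
  intros HM HS Hz. destruct (HM z Hz) as [Hsym [_ HB]]. specialize (HS z Hz).
  split; [exact Hsym|]. split.
  - intros xi. rewrite <- sqnorm_dot. apply HB.
  - intros y i Hi. unfold Gvec. rewrite <- mvec_matmul.
    transitivity (rsum (2 * n) (fun j => (if Nat.eqb i j then 1 else 0) * y j)).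
    + apply rsum_ext; intros j Hj. f_equal. rewrite Nat.eqb_sym, <- HS by auto.
      change (rsum (2 * n) (fun l => A z i l * Gmat n (A z) l j)
              = rsum (2 * n) (fun l => Gmat n (A z) j l * A z l i)).
      apply rsum_ext; intros l Hl.
      rewrite (Hsym i l), (Gmat_sym n (A z) Hsym l j) by auto. ring.
    + apply rsum_delta; auto.
Qed.

Lemma near_frozen_subset n lam Lam delta A0 (F G : pt -> Prop) A :
  (forall z, F z -> G z) -> near_frozen n lam Lam delta A0 G A -> near_frozen n lam Lam delta A0 F A.
Proof. intros H [H1 [H2 [H3 H4]]]. split; [auto|]. split; [auto|]. split; auto. Qed.

Lemma bernoulli_minus b k : 0 <= b <= 1 -> 1 - INR k * b <= (1 - b) ^ k.
Proof.
  intros Hb. induction k as [|k IH]; [simpl; lra|]. rewrite S_INR. simpl pow.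
  apply Rle_trans with ((1 - b) * (1 - INR k * b)).
  - pose proof (pos_INR k). assert (0 <= INR k * b * b) by (repeat apply Rmult_le_pos; lra). nra.
  - apply Rmult_le_compat_l; lra.
Qed.

(* The gain in one application of the growth lemma at height [M / 4] to
   half of the lattice points of a ball. *)
Definition gain (n : nat) (lam Lam : R) : R :=
  growth_const n lam Lam (upper_count n) * lower_count n / 8.

(** Chosen so that [(2n+2) * shrink = gain / (2 + gain)]. Bernoulli's inequality then gives
    [(1 - shrink)^(2n+2) >= 2 / (2 + gain)], so near the weighted maximum [u] exceeds its value
    there by a factor of at most [1 + gain / 2]. *)
Definition shrink (n : nat) (lam Lam : R) : R :=
  gain n lam Lam / ((2 + gain n lam Lam) * INR (2 * n + 2)).

Lemma upper_count_ge_1 n : 1 <= upper_count n.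
Proof. apply pow_R1_Rle; lra. Qed.

Lemma growth_const_pos n lam Lam C0 :
  0 < lam -> 1 <= Lam -> 1 <= C0 -> 0 < growth_const n lam Lam C0.
Proof.
  intros Hl HL HC. unfold growth_const, K1.
  assert (0 < 4 * Lam / lam) by (apply Rdiv_lt_0_compat; lra).
  apply Rinv_0_lt_compat. repeat apply Rmult_lt_0_compat; try lra; apply pow_lt; lra.
Qed.

Lemma gain_pos n lam Lam : (1 <= n)%nat -> 0 < lam -> 1 <= Lam -> 0 < gain n lam Lam.
Proof.
  intros Hn Hl HL. unfold gain, lower_count.
  pose proof (growth_const_pos n lam Lam (upper_count n) Hl HL (upper_count_ge_1 n)).
  assert (1 <= INR n) by (apply (le_INR 1); auto).
  assert (0 < / (4 * INR n) ^ (2 * n)) by (apply Rinv_0_lt_compat, pow_lt; lra).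
  unfold Rdiv. repeat apply Rmult_lt_0_compat; lra.
Qed.

(** The quantity [M tau^Q] links the two points: it is at least [u z * r^Q] by maximality, and at
    most a constant times [u w * r^Q] by the growth lemma on the ball of radius [2 * r], which is
    why the equation is required up to [K1 * (2 * r)]. *)
Lemma harnack_near_frozen n lam Lam delta A0 A Om u Du D2u z0 r :
  (1 <= n)%nat -> 0 < lam -> lam <= 1 -> 1 <= Lam ->
  is_open n Om -> C2_on n Om u Du D2u -> valid n z0 -> 0 < r ->
  (forall z, cball n z0 (K1 lam Lam * (2 * r)) z -> Om z /\ 0 <= u z /\ LA n A Du D2u z = 0) ->
  near_frozen n lam Lam delta A0 (cball n z0 (K1 lam Lam * (2 * r))) A ->
  forall z w, cball n z0 r z -> cball n z0 r w ->
    u z <= (2 * K1 lam Lam / shrink n lam Lam) ^ (2 * n + 2) / gain n lam Lam * u w.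
Proof.
  intros Hn Hl0 Hl1 HL HOm HC2 Hv0 Hr HF HA z w Hz Hw.
  set (k1 := K1 lam Lam) in *. set (Q := (2 * n + 2)%nat).
  set (C0 := upper_count n). assert (HC0 : 1 <= C0) by apply upper_count_ge_1.
  set (c1 := growth_const n lam Lam C0).
  assert (Hc1 : 0 < c1) by (apply growth_const_pos; auto).
  set (c0 := lower_count n).
  set (kap := gain n lam Lam). assert (Hkap : 0 < kap) by (apply gain_pos; auto).
  assert (Ekap : kap = c1 * c0 / 8) by reflexivity.
  set (beta := shrink n lam Lam).
  assert (HQ : 1 <= INR Q) by (apply (le_INR 1); unfold Q; lia).
  assert (Ebeta : beta = kap / ((2 + kap) * INR Q)) by reflexivity.
  assert (EQb : INR Q * beta = kap / (2 + kap)) by (rewrite Ebeta; field; lra).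
  assert (Hbeta0 : 0 < beta) by (rewrite Ebeta; apply Rdiv_lt_0_compat; nra).
  assert (Hk2 : kap / (2 + kap) < 1).
  { apply Rmult_lt_reg_r with (2 + kap); [lra|]. unfold Rdiv. rewrite Rmult_assoc, Rinv_l; lra. }
  assert (Hbeta1 : beta < 1) by nra.
  assert (Hk1 : 5 <= k1).
  { unfold k1, K1. assert (1 <= Lam / lam); [|unfold Rdiv in *; lra].
    apply Rmult_le_reg_r with lam; auto. unfold Rdiv. rewrite Rmult_assoc, Rinv_l; lra. }
  assert (Hsub : forall q, cball n z0 (2 * r) q -> cball n z0 (k1 * (2 * r)) q).
  { intros q [Hq1 Hq2]. split; auto. nra. }
  assert (Hr2 : forall q, cball n z0 r q -> cball n z0 (2 * r) q).
  { intros q [Hq1 Hq2]. split; auto. lra. }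
  assert (Huw : 0 <= u w) by (apply HF; auto).
  set (phi := fun q => u q * (2 * r - hdist n z0 q) ^ Q).
  assert (Hcu : cont_on n (cball n z0 (k1 * (2 * r))) u).
  { apply cont_on_subset with Om; [intros q Hq; apply (HF q Hq)|apply HC2]. }
  destruct (compact_attains_min n (cball n z0 (2 * r)) (fun q => -1 * phi q)) as [z1 [Hz1 Hmax]].
  { apply compact_cball. }
  { apply cont_on_scal. unfold phi. apply cont_on_mult.
    - apply cont_on_subset with (2 := Hcu). auto.
    - apply cont_on_pow, cont_on_minus; [apply cont_on_const|apply cont_on_hdist]. }
  { exists z; auto. }
  assert (Hmax' : forall q, cball n z0 (2 * r) q -> phi q <= phi z1).
  { intros q Hq. specialize (Hmax q Hq). cbv beta in Hmax. lra. }
  clear Hmax.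
  set (M := u z1). set (tau := 2 * r - hdist n z0 z1).
  assert (HM0 : 0 <= M) by (apply HF; auto).
  assert (Htau0 : 0 <= tau) by (destruct Hz1; unfold tau; lra).
  assert (Ephi : phi z1 = M * tau ^ Q) by reflexivity.
  assert (Hzphi : u z * r ^ Q <= M * tau ^ Q).
  { rewrite <- Ephi. apply Rle_trans with (phi z); [|apply Hmax'; auto]. unfold phi.
    apply Rmult_le_compat_l; [apply HF; auto|]. apply pow_incr. destruct Hz. lra. }
  assert (HrQ : 0 < r ^ Q) by (apply pow_lt; auto).
  set (Cst := (2 * k1 / beta) ^ Q / kap).
  assert (HCst : 0 < Cst).
  { apply Rdiv_lt_0_compat; auto. apply pow_lt, Rdiv_lt_0_compat; lra. }
  (* Setting [u z <= 0] aside makes [M] and [tau] positive, so that the small ball about [z1] is not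
     degenerate. *)
  destruct (Rle_or_lt (u z) 0) as [Huz|Huz].
  { assert (0 <= Cst * u w) by (apply Rmult_le_pos; lra). lra. }
  assert (HMt : 0 < M * tau ^ Q) by (eapply Rlt_le_trans; [|apply Hzphi]; apply Rmult_lt_0_compat; auto).
  assert (HM : 0 < M).
  { destruct HM0 as [|E]; auto. rewrite <- E in HMt. lra. }
  assert (Htau : 0 < tau).
  { destruct Htau0 as [|E]; auto. rewrite <- E in HMt. unfold Q in HMt.
    rewrite pow_i in HMt by lia. lra. }
  assert (Htau2 : tau <= 2 * r) by (pose proof (hdist_nonneg n z0 z1); unfold tau; lra).
  (* Then [k1 * rho = beta * tau], and the enlarged ball that the growth lemma needs around [z1]
     stays where the weight is at least [((1 - beta) tau)^Q]. *)
  set (rho := beta * tau / k1).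
  assert (Erho : k1 * rho = beta * tau) by (unfold rho; field; lra).
  assert (Hrho : 0 < rho) by (apply Rdiv_lt_0_compat; [apply Rmult_lt_0_compat|]; lra).
  assert (Hrhot : rho <= tau) by nra.
  assert (Hbt : beta * tau <= tau) by nra.
  assert (Hin : forall q, cball n z1 (k1 * rho) q -> cball n z0 (2 * r) q).
  { intros q [Vq Hq]. split; auto. pose proof (hdist_triangle n z0 z1 q). unfold tau in *. lra. }
  assert (Hin' : forall q, cball n z1 rho q -> cball n z1 (k1 * rho) q).
  { intros q [Vq Hq]. split; auto. nra. }
  set (S := (1 + kap / 2) * M).
  assert (HS : forall q, cball n z1 (k1 * rho) q -> u q <= S).
  { intros q Hq. pose proof (Hmax' q (Hin q Hq)) as H. rewrite Ephi in H. unfold phi in H.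
    assert (Hd : (1 - beta) * tau <= 2 * r - hdist n z0 q).
    { destruct Hq as [_ Hq]. pose proof (hdist_triangle n z0 z1 q). unfold tau in *. lra. }
    assert (Hp : ((1 - beta) * tau) ^ Q <= (2 * r - hdist n z0 q) ^ Q).
    { apply pow_incr. split; [apply Rmult_le_pos; lra|auto]. }
    assert (Huq : 0 <= u q) by (apply HF; auto).
    pose proof (bernoulli_minus beta Q ltac:(lra)) as Hb. rewrite EQb in Hb.
    assert (HtQ : 0 < tau ^ Q) by (apply pow_lt; auto).
    rewrite Rpow_mult_distr in Hp.
    assert (H1 : u q * ((1 - beta) ^ Q * tau ^ Q) <= M * tau ^ Q).
    { eapply Rle_trans; [|apply H]. apply Rmult_le_compat_l; auto. }
    assert (H2 : u q * (1 - beta) ^ Q <= M).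
    { apply Rmult_le_reg_r with (tau ^ Q); auto. lra. }
    assert (H3 : u q * (1 - kap / (2 + kap)) <= M).
    { eapply Rle_trans; [|apply H2]. apply Rmult_le_compat_l; auto. }
    apply (Rmult_le_compat_l (1 + kap / 2)) in H3; [|lra].
    replace ((1 + kap / 2) * (u q * (1 - kap / (2 + kap)))) with (u q) in H3 by (field; lra).
    exact H3. }
  (* The tolerance [M / 4] turns the alternative [u < M / 2] or [u >= M / 2] at lattice points into
     [S - u >= M / 4] or [u >= M / 4] on whole balls of radius [h]. *)
  destruct (unif_cont_cball n z0 (k1 * (2 * r)) u (M / 4) Hcu ltac:(lra)) as [h0 [Hh0 Hunif]].
  assert (Hn1 : 1 <= INR n) by (apply (le_INR 1); auto).
  set (h := Rmin h0 (rho / (4 * INR n))).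
  assert (Hh : 0 < h) by (apply Rmin_pos; auto; apply Rdiv_lt_0_compat; lra).
  assert (Hhh0 : h <= h0) by apply Rmin_l.
  assert (Hhrho : 4 * INR n * h <= rho).
  { assert (H : h <= rho / (4 * INR n)) by apply Rmin_r.
    apply (Rmult_le_compat_l (4 * INR n)) in H; [|lra].
    replace (4 * INR n * (rho / (4 * INR n))) with rho in H by (field; lra). auto. }
  assert (Hhr : h <= rho) by nra.
  destruct (exists_lattice n z1 rho h Hn Hh Hhrho) as [L [HLv [HLup HLlow]]].
  fold C0 c0 Q in HLup, HLlow.
  set (P1 := fun q => hdist n z1 q <= rho /\ u q < M / 2).
  set (P2 := fun q => hdist n z1 q <= rho /\ M / 2 <= u q).
  assert (Hsplit : count L (fun q => hdist n z1 q <= rho) <= count L P1 + count L P2).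
  { unfold count. rewrite <- lsum_plus. apply lsum_le. intros q _. unfold indic, P1, P2.
    repeat destruct (excluded_middle_informative _); try lra. }
  assert (Hball : forall q, In q L -> hdist n z1 q <= rho -> cball n z1 rho q).
  { intros q Hq Hd. split; auto. }
  assert (Hclose : forall q q', cball n z0 (k1 * (2 * r)) q -> cball n z0 (k1 * (2 * r)) q' ->
                     hdist n q q' <= h -> Rabs (u q' - u q) < M / 4).
  { intros. apply Hunif; auto. lra. }
  assert (Hcnt : forall P q s, valid n q -> h <= s ->
     count (select P L) (fun q' => hdist n q' q <= s) <= C0 * (s / h) ^ Q).
  { intros P q s _ Hs. eapply Rle_trans; [apply count_select_le|]. apply HLup; auto. }
  assert (HrhoQ : 0 < (rho / h) ^ Q) by (apply pow_lt, Rdiv_lt_0_compat; auto).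
  (* Either half of the guaranteed number of lattice points has [u >= M / 2], or at least half of it
     has [u < M / 2]. *)
  destruct (Rle_or_lt (c0 * (rho / h) ^ Q) (2 * count L P2)) as [HP2|HP2].
  - assert (HG : c1 * (M / 4) * INR (length (select P2 L)) * (h / (2 * r)) ^ Q <= u w).
    { apply (growth_lemma n lam Lam delta C0 A0 A Om u Du D2u z0 (2 * r) h (M / 4) (select P2 L)); auto; try lra.
      - intros q Hq. apply in_select in Hq. destruct Hq as [Hq [Hd _]]. auto.
      - fold k1. intros q q' Hq Hq' Hd. apply in_select in Hq. destruct Hq as [Hq [Hqd Hqu]].
        assert (H : Rabs (u q' - u q) < M / 4) by (apply Hclose; auto).
        apply Rabs_def2 in H. lra. }
    rewrite length_select in HG.
    assert (HhQ : 0 < (h / (2 * r)) ^ Q) by (apply pow_lt, Rdiv_lt_0_compat; lra).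
    assert (H1 : kap * M * (rho / (2 * r)) ^ Q <= u w).
    { eapply Rle_trans; [|apply HG].
      replace (kap * M * (rho / (2 * r)) ^ Q)
        with (c1 * (M / 4) * (c0 * (rho / h) ^ Q / 2) * (h / (2 * r)) ^ Q).
      - apply Rmult_le_compat_r; [lra|]. apply Rmult_le_compat_l; [nra|lra].
      - replace (rho / (2 * r)) with (rho / h * (h / (2 * r))) by (field; lra).
        rewrite Rpow_mult_distr, Ekap. field. }
    apply Rmult_le_reg_r with (r ^ Q); auto.
    eapply Rle_trans; [apply Hzphi|].
    apply Rle_trans with (Cst * (kap * M * (rho / (2 * r)) ^ Q) * r ^ Q).
    (* [Cst] is made for this equality: [rho] is proportional to [tau], and the powers of [r],
       [beta] and [k1] cancel, leaving [M tau^Q]. *)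
    + right. unfold Cst.
      replace ((2 * k1 / beta) ^ Q / kap * (kap * M * (rho / (2 * r)) ^ Q) * r ^ Q)
        with (M * ((2 * k1 / beta) ^ Q * (rho / (2 * r)) ^ Q * r ^ Q)) by (field; lra).
      rewrite <- !Rpow_mult_distr. f_equal. f_equal. unfold rho. field. lra.
    + apply Rmult_le_compat_r; [lra|]. apply Rmult_le_compat_l; lra.
  (* At the centre [z1] the function [S - u] is only [kap M / 2], whereas the growth lemma would
     force at least [kap M]. *)
  - exfalso.
    assert (HP1 : c0 * (rho / h) ^ Q / 2 <= count L P1) by lra.
    assert (HG : c1 * (M / 4) * INR (length (select P1 L)) * (h / rho) ^ Q <= S + -1 * u z1).
    { apply (growth_lemma n lam Lam delta C0 A0 A Om (fun q => S + -1 * u q)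
        (fun a q => -1 * Du a q) (fun a b q => -1 * D2u a b q) z1 rho h (M / 4) (select P1 L)); auto; try lra.
      - apply C2_on_affine; auto.
      - intros q Hq. fold k1 in Hq. pose proof (HF q (Hsub q (Hin q Hq))) as [H1 [H2 H3]].
        split; auto. split; [specialize (HS q Hq); lra|]. rewrite LA_scal, H3. ring.
      - apply near_frozen_subset with (2 := HA). auto.
      - intros q Hq. apply in_select in Hq. destruct Hq as [Hq [Hd _]]. auto.
      - fold k1. intros q q' Hq Hq' Hd. apply in_select in Hq. destruct Hq as [Hq [Hqd Hqu]].
        assert (H : Rabs (u q' - u q) < M / 4) by (apply Hclose; auto).
        apply Rabs_def2 in H. unfold S. assert (0 <= kap / 2 * M) by nra. lra.
      - apply Hz1.
      - split; [apply Hz1|rewrite hdist_self; lra]. }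
    rewrite length_select in HG.
    assert (HhQ : 0 < (h / rho) ^ Q) by (apply pow_lt, Rdiv_lt_0_compat; lra).
    assert (H1 : kap * M <= S + -1 * u z1).
    { eapply Rle_trans; [|apply HG].
      replace (kap * M) with (c1 * (M / 4) * (c0 * (rho / h) ^ Q / 2) * (h / rho) ^ Q).
      - apply Rmult_le_compat_r; [lra|]. apply Rmult_le_compat_l; [nra|lra].
      - replace (kap * M) with (kap * M * (rho / h * (h / rho)) ^ Q).
        + rewrite Rpow_mult_distr, Ekap. field.
        + replace (rho / h * (h / rho)) with 1 by (field; lra). rewrite pow1. ring. }
    fold M in H1. unfold S in H1. nra.
Qed.

Lemma near_frozen_of_modulus n lam Lam Om om A delta eps z0 (F : pt -> Prop) :
  0 < lam -> 0 <= delta ->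
  delta * (8 * (2 * INR n + 5) / lam + 16 / lam + 8 * INR n * Lam) <= 4 ->
  in_Mn n lam Lam Om A -> symplectic n Om A -> in_C n Om om A ->
  Om z0 -> 0 < eps < 1 -> om eps <= delta ->
  (forall z, F z -> Om z /\ ball n z0 eps z) ->
  near_frozen n lam Lam delta (A z0) F A.
Proof.
  intros Hl Hd0 Hd HM HS HC Hz0 He Hom HF.
  split; [eapply frozen_coef_of_symplectic; eauto|]. split; [auto|]. split; [auto|].
  intros z Fz. destruct (HF z Fz) as [Oz Bz]. destruct (HM z Oz) as [Hsym [_ HB]].
  split; [exact Hsym|]. split.
  - intros xi. rewrite <- sqnorm_dot. apply HB.
  - intros xi. destruct HC as [_ HC]. specialize (HC z0 Hz0 eps He z Bz Oz xi).
    change (fun i => rsum (2 * n) (fun j => (A z i j - A z0 i j) * xi j))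
      with (mvec (2 * n) (fun i j => A z i j - A z0 i j) xi) in HC.
    rewrite !sqnorm_dot in HC.
    set (a := dot (2 * n) (mvec (2 * n) (fun i j => A z i j - A z0 i j) xi)
                (mvec (2 * n) (fun i j => A z i j - A z0 i j) xi)) in *.
    assert (Ha : 0 <= a) by apply dot_nonneg.
    pose proof (dot_nonneg (2 * n) xi) as Hx.
    rewrite <- (sqrt_sqrt a) by auto. rewrite <- (sqrt_sqrt (dot (2 * n) xi xi)) by auto.
    pose proof (sqrt_pos a) as Hs1. pose proof (sqrt_pos (dot (2 * n) xi xi)) as Hs2.
    set (s1 := sqrt a) in *. set (s2 := sqrt (dot (2 * n) xi xi)) in *.
    assert (H : s1 <= delta * s2) by nra.
    replace (delta ^ 2 * (s2 * s2)) with ((delta * s2) * (delta * s2)) by ring.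
    apply Rmult_le_compat; auto.
Qed.

Theorem theorem5p1 :
  forall (n : nat) (lam Lam : R),
    (1 <= n)%nat -> 0 < lam -> lam <= 1 -> 1 <= Lam ->
    let eta := 2 * sqrt (Lam / lam) + 1 in
    exists C K : R, 1 <= C /\ eta <= K /\
      forall om : R -> R, is_modulus om ->
        exists eps0 : R, 0 < eps0 /\
          forall (Om : pt -> Prop) (A : pt -> nat -> nat -> R)
                 (u : pt -> R) (Du : nat -> pt -> R)
                 (D2u : nat -> nat -> pt -> R) (z0 : pt) (r : R),
            is_open n Om ->
            symplectic n Om A -> in_Mn n lam Lam Om A -> in_C n Om om A ->
            C2_on n Om u Du D2u ->
            Om z0 -> 0 < r -> r <= eta / K * eps0 ->
            (forall z, ball n z0 (K * r) z -> Om z) ->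
            (forall z, ball n z0 (K * r) z -> 0 <= u z /\ LA n A Du D2u z = 0) ->
            forall z1 z2, ball n z0 r z1 -> ball n z0 r z2 -> u z1 <= C * u z2.
Proof.
  intros n lam Lam Hn Hl0 Hl1 HL eta.
  assert (Hll : 1 <= Lam / lam).
  { apply Rmult_le_reg_r with lam; auto. unfold Rdiv. rewrite Rmult_assoc, Rinv_l; lra. }
  assert (Hsq : 1 <= sqrt (Lam / lam) <= Lam / lam).
  { split; [rewrite <- sqrt_1; apply sqrt_le_1_alt; auto|].
    rewrite <- (sqrt_Rsqr (Lam / lam)) at 2 by lra. apply sqrt_le_1_alt. unfold Rsqr. nra. }
  (* The factor [2] reflects the ball of radius [2 * r] in [harnack_near_frozen]; the [+ 1] puts the
     closed ball of radius [k1 * (2 * r)] inside the open ball of radius [K * r]. *)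
  set (k1 := K1 lam Lam). set (K := 2 * k1 + 1).
  assert (Ek1 : k1 = 1 + 4 * (Lam / lam)) by (unfold k1, K1; field; lra).
  set (C := (2 * k1 / shrink n lam Lam) ^ (2 * n + 2) / gain n lam Lam).
  exists (Rmax 1 C), K. split; [apply Rmax_l|]. split; [unfold eta, K; lra|].
  intros om [Hom0 [_ [_ Homlim]]].
  set (D := 8 * (2 * INR n + 5) / lam + 16 / lam + 8 * INR n * Lam).
  assert (HD : 0 < D).
  { unfold D. pose proof (pos_INR n).
    assert (0 < 8 * (2 * INR n + 5) / lam) by (apply Rdiv_lt_0_compat; lra).
    assert (0 < 16 / lam) by (apply Rdiv_lt_0_compat; lra).
    assert (0 <= 8 * INR n * Lam) by nra. lra. }
  (* The largest perturbation that [barrier_subsolution] absorbs; it does not depend on [om]. *)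
  set (delta := 4 / D). assert (Hdelta : 0 < delta) by (apply Rdiv_lt_0_compat; lra).
  destruct (Homlim delta Hdelta) as [d [Hd Homd]].
  (* Below [d], where the modulus is under [delta], and below [1], where its bound on [A] is
     available. *)
  set (eps := Rmin (d / 2) (1 / 2)).
  assert (Heps0 : 0 < eps) by (apply Rmin_pos; lra).
  assert (Heps1 : eps <= 1 / 2) by apply Rmin_r.
  assert (Hepsd : eps <= d / 2) by apply Rmin_l.
  assert (Heta : 0 < eta) by (unfold eta; lra).
  (* Makes [r <= eta / K * eps0] mean exactly [K * r <= eps]. *)
  exists (eps / eta). split; [apply Rdiv_lt_0_compat; auto|].
  intros Om A u Du D2u z0 r HOm HSy HMn HC HC2 Hz0 Hr Hrle HKO HKu z1 z2 Hz1 Hz2.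
  assert (HK : 0 < K) by (unfold K; lra).
  assert (HKr : K * r <= eps).
  { apply (Rmult_le_compat_l K) in Hrle; [|lra].
    replace (K * (eta / K * (eps / eta))) with eps in Hrle by (field; lra). auto. }
  assert (Hin : forall z, cball n z0 (k1 * (2 * r)) z -> ball n z0 (K * r) z).
  { intros z [Hv Hz]. split; auto. unfold K. lra. }
  assert (Hcb : forall z, ball n z0 r z -> cball n z0 r z).
  { intros z [Hv Hz]. split; auto. lra. }
  assert (HH : u z1 <= C * u z2).
  { apply (harnack_near_frozen n lam Lam delta (A z0) A Om u Du D2u z0 r); auto.
    - apply HOm; auto.
    - apply (near_frozen_of_modulus n lam Lam Om om A delta eps); auto; try lra.
      + unfold delta. fold D. right. field. lra.
      + pose proof (Rle_abs (om eps)). specialize (Homd eps). lra.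
      + intros z Hz. pose proof (Hin z Hz) as Hb. split; auto.
        destruct Hb as [Hv Hb]. split; auto. lra. }
  eapply Rle_trans; [apply HH|]. apply Rmult_le_compat_r; [|apply Rmax_r].
  apply HKu. destruct Hz2 as [Hv Hz]. split; auto. unfold K. nra.
Qed.
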